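(* Let $\mathfrak g$ be a simple Lie algebra of type A or D over an algebraically closed field of characteristic zero. Then there are no almost principal nilpotent pairs in $\mathfrak g$, i.e. there is no nilpotent pair $\mathbf e$ in $\mathfrak g$ with $\dim Z(\mathbf e)=\mathrm{rk}\,\mathfrak g+1$.
   Context: A nilpotent pair in a semisimple Lie algebra $\mathfrak g$ is a pair $\mathbf e=(e_1,e_2)$ of commuting nilpotent elements of $\mathfrak g$ for which there exists a pair $(h_1,h_2)$ of commuting semisimple elements of $\mathfrak g$ with rational eigenvalues in the adjoint action and $[h_i,e_j]=\delta_{i,j}e_j$. $Z(\mathbf e)=\{x\in\mathfrak g:[x,e_1]=[x,e_2]=0\}$. A nilpotent pair is almost principal if $\dim Z(\mathbf e)=\mathrm{rk}\,\mathfrak g+1$. *)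

(* Defs.v *)
From HB Require Import structures.
From mathcomp Require Import all_boot all_algebra.

Set Implicit Arguments.
Unset Strict Implicit.
Unset Printing Implicit Defensive.

Import GRing.Theory.
Local Open Scope ring_scope.

(* Linearity in the left argument follows from linearity in the right one and
   antisymmetry; [bracket_xx_subproof] only adds something in characteristic 2. *)
HB.mixin Record Vector_isLieAlgebra (F : fieldType) L of Vector F L := {
  bracket : L -> L -> L;
  bracket_linear_subproof : forall x a y z,
    bracket x (a *: y + z) = a *: bracket x y + bracket x z;
  bracket_antisym_subproof : forall x y, bracket x y = - bracket y x;
  bracket_xx_subproof : forall x, bracket x x = 0;
  bracket_jacobi_subproof : forall x y z,
    bracket x (bracket y z) + bracket y (bracket z x)
      + bracket z (bracket x y) = 0
}.

#[short(type="lieAlgType")]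
HB.structure Definition LieAlgebra (F : fieldType) :=
  { L of Vector_isLieAlgebra F L & Vector F L }.

HB.instance Definition _ (F : fieldType) (g : lieAlgType F) (x : g) :=
  GRing.isLinear.Build F g g *:%R (bracket x) (bracket_linear_subproof x).

Section LieAlgebraTheory.

Variables (F : fieldType) (g : lieAlgType F).
Implicit Types (x y z : g) (H I : {vspace g}) (e : g * g).

Definition ad x : 'End(g) := linfun (bracket x).

Lemma adE x y : ad x y = bracket x y.
Proof. by rewrite lfunE. Qed.

Definition lie_commute x y := bracket x y = 0.

Definition lie_ideal I := forall x y, y \in I -> bracket x y \in I.

Definition lie_simple :=
  (exists x y, ~ lie_commute x y) /\
  forall I, lie_ideal I -> I = 0%VS \/ I = fullv.

(* In a semisimple Lie algebra an element is nilpotent (resp. semisimple) iff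
   its adjoint endomorphism is; over an algebraically closed field, semisimple
   endomorphisms are the diagonalizable ones. *)
Definition lie_nilpotent x := exists k, forall y, iter k (bracket x) y = 0.

Definition lie_semisimple x :=
  exists2 b : seq g, basis_of fullv b &
    {in b, forall y, exists a : F, bracket x y = a *: y}.

Definition rational_eigenvalues x :=
  forall a : F, passmx.leigenvalue (ad x) a -> exists q : rat, a = ratr q.

Definition toral H :=
  {in H &, forall x y, lie_commute x y} /\ {in H, forall x, lie_semisimple x}.

(* For semisimple g in characteristic 0, the Cartan subalgebras are the maximal
   toral subalgebras. *)
Definition cartan_subalgebra H :=
  toral H /\ forall H', toral H' -> (H <= H')%VS -> H' = H.

(* The rank is the common dimension of all Cartan subalgebras. *)
Definition lie_rank (r : nat) :=
  exists2 H, cartan_subalgebra H & \dim H = r.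

Definition nilpotent_pair e :=
  [/\ lie_nilpotent e.1, lie_nilpotent e.2, lie_commute e.1 e.2 &
    exists h : g * g,
      [/\ lie_commute h.1 h.2,
          lie_semisimple h.1 /\ rational_eigenvalues h.1,
          lie_semisimple h.2 /\ rational_eigenvalues h.2,
          bracket h.1 e.1 = e.1 /\ bracket h.1 e.2 = 0 &
          bracket h.2 e.1 = 0 /\ bracket h.2 e.2 = e.2]].

Definition pair_centralizer e : {vspace g} :=
  (lker (ad e.1) :&: lker (ad e.2))%VS.

Lemma mem_pair_centralizer e x :
  (x \in pair_centralizer e) =
  (bracket x e.1 == 0) && (bracket x e.2 == 0).
Proof.
rewrite memv_cap !memv_ker !adE.
by rewrite ![bracket _ x]bracket_antisym_subproof !oppr_eq0.
Qed.

Definition almost_principal e :=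
  nilpotent_pair e /\
  exists2 r, lie_rank r & \dim (pair_centralizer e) = r.+1.

(* g is isomorphic to the Lie algebra of the N x N matrices satisfying P, with
   the commutator bracket. *)
Definition lie_iso_matrices (N : nat) (P : 'M[F]_N -> Prop) :=
  exists phi : {linear g -> 'M[F]_N},
    [/\ injective phi,
        forall x y, phi (bracket x y) = phi x *m phi y - phi y *m phi x &
        forall A, P A <-> exists x, phi x = A].

(* A_n : sl_(n+1). *)
Definition type_A :=
  exists2 n, (0 < n)%N & lie_iso_matrices (fun A : 'M[F]_n.+1 => \tr A = 0).

(* D_n : so_(2n). All nondegenerate symmetric bilinear forms of a given
   dimension are equivalent over an algebraically closed field of
   characteristic 0, so the standard one is used. D_3 = A_3 is allowed. *)
Definition type_D :=
  exists2 n, (3 <= n)%N & lie_iso_matrices (fun A : 'M[F]_n.*2 => A^T = - A).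

End LieAlgebraTheory.

Arguments lie_simple {F} g.
Arguments lie_rank {F} g r.
Arguments type_A {F} g.
Arguments type_D {F} g.

(* Main.v *)
(* Diagonalize h_1, h_2 in the defining representation: e_1, e_2 become commuting
   matrices x, y of bidegree (1, 0) and (0, 1) for the weights (w_1, w_2) of the
   basis vectors, in gl_N or in the orthogonal algebra of the form pairing e_i
   with e_(st i), and we must show that the centralizer Z of x and y in there does
   not have dimension rk + 1 (for gl_N: N + 1).

   Raising by ad x and then by ad y shows that the part of Z in degrees >= (0, 0)
   has at least the dimension of the degree (0, 0) part, hence at least the rank.
   So if dim Z <= rk + 1, then the weights are distinct (up to one pair o, st o of
   weight 0), every integral labelling of the basis respected by x and y is
   trivial, and, after exchanging x and y, Z has no element in degrees (< 0, >= 0);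
   then no element of the algebra in such degrees commutes with x alone. Testing
   this on the elements \sum_i x^i E x^(m - i) shows that every row (w_2 constant)
   is a single x-string and that the rows are nested, as in a skew Young diagram.

   In type A this determines an endomorphism commuting with x and y by N of its
   entries. In type D, skew and symmetric endomorphisms add up to the centralizer in
   gl_N, and the symmetric ones are bounded below by the same raising argument. If
   there is no weight 0, then Z lives in degrees >= (0, 0), and there Z and the
   symmetric part fit in dimension N = 2 n. If there is one, then all weights are
   even, the nonzero rows are equal intervals, and the centralizer in gl_N has
   dimension at most N + 2, of which n + 2 is symmetric. In all cases dim Z <= rk. *)

Require Import Defs.
From HB Require Import structures.
From mathcomp Require Import all_boot all_order all_algebra.
From mathcomp Require Import zify ring lra.

Set Implicit Arguments.
Unset Strict Implicit.
Unset Printing Implicit Defensive.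

Import Order.TTheory GRing.Theory Num.Theory.
Local Open Scope ring_scope.

(** * Nonzero entries of matrices and of products *)

Section MatrixEntries.

Variable F : fieldType.

(** Defects come in pairs, which is why the value rk + 1 is skipped. The part of Z in degrees >= (0,
    0) already has dimension at least rk; every failure of rigidity (a repeated weight, a nontrivial
    labelling, elements of Z in both mixed quadrants) yields two further independent elements, hence
    dim Z >= rk + 2. What survives dim Z <= rk + 1 is rigid enough for an exact count. The obstacle
    in type D is that shapes describe endomorphisms of V, while Z is only the skew half of them. So
    the whole centralizer is bounded above and its symmetric half below: N - n, or (N + 2) - (n + 2)
    when weight 0 occurs. The 2 on the symmetric side comes from E_(o, st o) and E_(st o, o), which
    are self-adjoint and have no skew part. The same vanishing of skew entries between dual vectors
    decides the borderline cases, where a shape argument alone would leave one entry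
    undetermined. *)

Lemma sum_neq0 (I : finType) (G : I -> F) : \sum_i G i != 0 -> exists i, G i != 0.
Proof.
move=> G0; apply/existsP; apply: contraNT G0 => /existsPn G0.
by rewrite big1 // => i _; apply/eqP; rewrite -[_ == _]negbK G0.
Qed.

Lemma entry_neq0 m n (X : 'M[F]_(m, n)) : X != 0 -> exists i j, X i j != 0.
Proof.
move=> X0; have [/existsP[i /existsP[j]]|/existsPn Xq] :=
  boolP [exists i, exists j, X i j != 0]; first by exists i, j.
case/eqP: X0; apply/matrixP=> i j; rewrite mxE; apply/eqP.
by have /existsPn/(_ j) := Xq i; rewrite negbK.
Qed.

Lemma row_neq0 n (r : 'rV[F]_n) : r != 0 -> exists j, r 0 j != 0.
Proof. by case/entry_neq0 => i [j]; rewrite ord1; exists j. Qed.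

Lemma col_neq0 n (v : 'cV[F]_n) : v != 0 -> exists i, v i 0 != 0.
Proof. by case/entry_neq0 => i [j]; rewrite ord1; exists i. Qed.

Variables (m n p : nat) (A : 'M[F]_(m, n)) (B : 'M[F]_(n, p)).

Lemma mulmx_entry i j k : (forall l, A i l != 0 -> B l j != 0 -> l = k) ->
  (A *m B) i j = A i k * B k j.
Proof.
move=> uniq_k; rewrite mxE (bigD1 k) //= big1 ?addr0 // => l.
apply: contraNeq; rewrite mulf_eq0 negb_or => /andP[Ail Blj].
by apply/eqP; apply: uniq_k.
Qed.

Lemma mulmx_entry_neq0 i j : (A *m B) i j != 0 -> exists k, A i k != 0 /\ B k j != 0.
Proof.
rewrite mxE => /sum_neq0[k]; rewrite mulf_eq0 negb_or => /andP[Aik Bkj].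
by exists k.
Qed.

End MatrixEntries.

(** * Graded pairs of commuting matrices *)

Section SubspaceDimension.

Variable F : fieldType.
Implicit Types vT wT : vectType F.

(** Rank-nullity on [A]: the image has dimension at most [\dim B], and [C] is independent of [B]
    inside [A]. In use, [C] is the lowest degree and [B] collects the higher ones. *)
Lemma dim_ker_ge vT (f : 'End(vT)) (A B C : {vspace vT}) :
  (f @: A <= B)%VS -> (B <= A)%VS -> (C <= A)%VS ->
  (forall v, v \in C -> v \in B -> v = 0) ->
  (\dim C <= \dim (A :&: lker f))%N.
Proof.
move=> fAB BA CA CB0; have := limg_ker_dim f A; have := dimvS fAB.
have CB : (C :&: B = 0)%VS.
  apply/eqP; rewrite -subv0; apply/subvP=> v; rewrite memv_cap => /andP[vC vB].
  by rewrite (CB0 v) ?mem0v.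
have : (C + B <= A)%VS by rewrite subv_add CA BA.
move/dimvS; rewrite (dimv_disjoint_sum CB); lia.
Qed.

Lemma dim_sum_le vT (A B C : {vspace vT}) :
  (B <= A)%VS -> (C <= A)%VS -> (forall v, v \in B -> v \in C -> v = 0) ->
  (\dim B + \dim C <= \dim A)%N.
Proof.
move=> BA CA BC0; rewrite -dimv_disjoint_sum ?dimvS ?subv_add ?BA //.
apply/eqP; rewrite -subv0; apply/subvP=> v; rewrite memv_cap => /andP[vB vC].
by rewrite (BC0 v) ?mem0v.
Qed.

Lemma dim_le_inj vT wT (f : {linear vT -> wT}) (W : {vspace vT}) :
  (forall v, v \in W -> f v = 0 -> v = 0) -> (\dim W <= \dim {:wT})%N.
Proof.
move=> f0; rewrite -(@limg_dim_eq _ _ _ (linfun f)) ?dimvS ?subvf //.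
apply/eqP; rewrite -subv0; apply/subvP=> v.
rewrite memv_cap memv_ker lfunE /= => /andP[vW /eqP fv0].
by rewrite (f0 v) ?mem0v.
Qed.

Lemma dim_ge_surj vT k (f : {linear vT -> 'rV[F]_k}) (W : {vspace vT}) :
  (forall i, exists2 v, v \in W & f v = delta_mx 0 i) -> (k <= \dim W)%N.
Proof.
move=> fW; have imf : (linfun f @: W)%VS = fullv.
  apply/eqP; rewrite eqEsubv subvf /=; apply/subvP=> u _.
  rewrite [u]row_sum_delta; apply: memv_suml => i _; apply: memvZ.
  by have [v vW <-] := fW i; rewrite -lfunE memv_img.
have := limg_ker_dim (linfun f) W; rewrite imf dimvf dim_matrix.
rewrite (_ : 1 * k = k)%R; last exact: mul1n.
lia.
Qed.

End SubspaceDimension.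

Section MatrixEntries.

Variables (F : fieldType) (N : nat) (I : finType) (pos : I -> 'I_N * 'I_N).

Definition entries (X : 'M[F]_N) : 'rV[F]_#|I| :=
  \row_k X (pos (enum_val k)).1 (pos (enum_val k)).2.

Fact entries_is_linear : linear entries.
Proof. by move=> a X Y; apply/rowP=> k; rewrite !mxE. Qed.
HB.instance Definition _ :=
  GRing.isLinear.Build F 'M[F]_N 'rV[F]_#|I| *:%R entries entries_is_linear.

(** The upper bounds on centralizers all take this form: a matrix of [W] is determined by its
    entries at the positions [pos], indexed by a finite type of the desired cardinality. *)
Lemma dim_le_entries (W : {vspace 'M[F]_N}) :
  (forall X, X \in W -> (forall h, X (pos h).1 (pos h).2 = 0) -> X = 0) ->
  (\dim W <= #|I|)%N.
Proof.
move=> W0; have <- : \dim {:'rV[F]_#|I|} = #|I| by rewrite dimvf dim_matrix; exact: mul1n.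
apply: (@dim_le_inj _ _ _ entries) => X XW X0; apply: W0 => // h.
by move/rowP/(_ (enum_rank h)): X0; rewrite !mxE enum_rankK.
Qed.

Lemma dim_ge_entries (W : {vspace 'M[F]_N}) (X : I -> 'M[F]_N) :
  (forall h, X h \in W) ->
  (forall h h', X h (pos h').1 (pos h').2 = (h == h')%:R) ->
  (#|I| <= \dim W)%N.
Proof.
move=> XW Xpos; apply: (@dim_ge_surj _ _ _ entries) => i.
exists (X (enum_val i)) => //; apply/rowP=> k.
by rewrite !mxE Xpos (inj_eq enum_val_inj) eq_sym.
Qed.

End MatrixEntries.

Section Bracket.

Variables (F : fieldType) (N : nat).
Implicit Types (a b X Y : 'M[F]_N) (m : rel 'I_N).

Definition brk a X := a *m X - X *m a.

Fact brk_is_linear a : linear (brk a).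
Proof.
move=> c X Y; rewrite /brk mulmxDr mulmxDl -scalemxAr -scalemxAl.
by rewrite scalerBr opprD addrACA.
Qed.
HB.instance Definition _ a :=
  GRing.isLinear.Build F 'M[F]_N 'M[F]_N *:%R (brk a) (brk_is_linear a).

Lemma brkC a b X : a *m b = b *m a -> brk a (brk b X) = brk b (brk a X).
Proof.
move=> ab; rewrite /brk !mulmxBr !mulmxBl !mulmxA ab -!mulmxA ab.
by rewrite !opprB addrACA [in RHS]addrACA [- _ - _]addrC.
Qed.

(** Key locking the kernels below, so that conversion does not unfold them; the membership lemmas
    state their meaning. *)
Fact subspace_key : unit. Proof. by []. Qed.

Definition cent a : {vspace 'M[F]_N} :=
  locked_with subspace_key (lker (linfun (brk a))).

Lemma mem_cent a X : (X \in cent a) = (brk a X == 0).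
Proof. by rewrite [cent a]unlock memv_ker lfunE. Qed.

Definition restr m X : 'M[F]_N := \matrix_(i, j) if m i j then X i j else 0.

Fact restr_is_linear m : linear (restr m).
Proof.
move=> c X Y; apply/matrixP=> i j; rewrite !mxE.
by case: ifP; rewrite ?mulr0 ?addr0.
Qed.
HB.instance Definition _ m :=
  GRing.isLinear.Build F 'M[F]_N 'M[F]_N *:%R (restr m) (restr_is_linear m).

Definition supp m : {vspace 'M[F]_N} :=
  locked_with subspace_key (lker (linfun (restr [rel i j | ~~ m i j]))).

Lemma mem_supp m X :
  reflect (forall i j, X i j != 0 -> m i j) (X \in supp m).
Proof.
rewrite [supp m]unlock memv_ker lfunE; apply: (iffP eqP) => [/matrixP X0 i j | mX].
  by move: (X0 i j); rewrite !mxE /=; case: (m i j) => //= ->; rewrite eqxx.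
apply/matrixP=> i j; rewrite !mxE /=; have := mX i j.
by case: (m i j) => //= h; apply/eqP; apply: contraT => /h.
Qed.

End Bracket.

(* In the applications w i is the weight of the i-th basis vector, and then
   X i j <> 0 means that X has a component of degree w i - w j. *)
Section Graded.

Variables (F : fieldType) (N : nat) (R : realDomainType) (s : R).
Hypothesis s_gt0 : 0 < s.
Implicit Types (a X : 'M[F]_N) (w : 'I_N -> R) (U : {vspace 'M[F]_N}).

(** The step [s] is 1 for rational weights and 2 for the doubled integral weights of the orthogonal
    case. *)
Definition raises w a := forall i j, a i j != 0 -> w i = w j + s.

Definition deg_ge w t : rel 'I_N := [rel i j | t <= w i - w j].
Definition deg_eq w t : rel 'I_N := [rel i j | w i - w j == t].

Lemma brk_entry a X i j : brk a X i j != 0 ->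
  (exists k, a i k != 0 /\ X k j != 0) \/ (exists k, X i k != 0 /\ a k j != 0).
Proof.
have -> : brk a X i j = (a *m X) i j - (X *m a) i j.
  by rewrite [LHS]mxE [X in _ + X]mxE.
have [->|/mulmx_entry_neq0] := eqVneq ((a *m X) i j) 0; last by left.
by rewrite sub0r oppr_eq0 => /mulmx_entry_neq0; right.
Qed.

Lemma brk_raises w a t X : raises w a -> X \in supp F (deg_ge w t) ->
  brk a X \in supp F (deg_ge w (t + s)).
Proof.
move=> wa /mem_supp Xt; apply/mem_supp=> i j.
case/brk_entry=> [[k [/wa wi /Xt]]|[k [/Xt + /wa wk]]]; rewrite /deg_ge /=.
  by rewrite wi addrAC lerD2r.
by rewrite wk opprD addrA lerBrDr.
Qed.

(** On the part of [U] of degree at least [t], ad a takes values in degree above [t], to which the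
    degree [t] part is complementary; so its kernel is at least as large as that part. *)
Lemma graded_dim w a t U : raises w a -> (forall X, X \in U -> brk a X \in U) ->
  (\dim (U :&: supp F (deg_eq w t))
     <= \dim (U :&: cent a :&: supp F (deg_ge w t)))%N.
Proof.
move=> wa Ua; rewrite -capvA [(cent a :&: _)%VS]capvC capvA [cent a]unlock.
apply: (@dim_ker_ge _ _ _ _ (U :&: supp F [rel i j | t < w i - w j])).
- apply/subvP => _ /memv_imgP[X + ->]; rewrite lfunE !memv_cap => /andP[XU Xt].
  rewrite Ua //=; have /mem_supp Yt := brk_raises wa Xt.
  by apply/mem_supp => i j /Yt; apply: lt_le_trans; rewrite ltrDl.
- apply/subvP => X; rewrite !memv_cap => /andP[-> /mem_supp Xt].
  by apply/mem_supp => i j /Xt /ltW.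
- apply/subvP => X; rewrite !memv_cap => /andP[-> /mem_supp Xt].
  by apply/mem_supp => i j /Xt /eqP <-; exact: lexx.
move=> X; rewrite !memv_cap => /andP[_ /mem_supp Xe] /andP[_ /mem_supp Xt].
apply/matrixP=> i j; rewrite mxE; apply/eqP; apply: contraT => Xij.
by move: (Xe _ _ Xij) (Xt _ _ Xij); rewrite /deg_eq /= => /eqP ->; rewrite ltxx.
Qed.

(** Each application of ad a strictly increases the lowest degree that occurs, and only finitely
    many degrees are available; the last nonzero iterate commutes with [a]. *)
Lemma graded_push w a (P : 'M[F]_N -> Prop) X :
  raises w a -> (forall Y, P Y -> P (brk a Y)) -> P X -> X != 0 ->
  exists Y, [/\ P Y, Y != 0 & brk a Y = 0].
Proof.
move=> wa Pa PX X0.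
(* The measure: positions whose degree is at least that of some nonzero entry of [Y]. A position of
   lowest degree drops out after one step. *)
pose m (Y : 'M[F]_N) : {set 'I_N * 'I_N} := [set p | [exists q,
  (Y q.1 q.2 != 0) && (w q.1 - w q.2 <= w p.1 - w p.2)]].
have [n mX] := ubnP #|m X|; elim: n => // n IHn in X PX X0 mX *.
have [aX0|aX0] := eqVneq (brk a X) 0; first by exists X.
apply: IHn (Pa _ PX) aX0 _; rewrite ltnS in mX; apply: leq_trans mX.
have [q0 Xq0] : exists q : 'I_N * 'I_N, X q.1 q.2 != 0.
  apply/existsP; apply: contraNT X0 => /existsPn Xq; apply/eqP/matrixP => i j.
  by rewrite mxE; apply/eqP; rewrite -[_ == _]negbK (Xq (i, j)).
pose q1 := [arg min_(q < q0 | X q.1 q.2 != 0) (w q.1 - w q.2)]%O.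
have [Xq1 q1min] : X q1.1 q1.2 != 0 /\ forall q : 'I_N * 'I_N,
    X q.1 q.2 != 0 -> w q1.1 - w q1.2 <= w q.1 - w q.2.
  by rewrite /q1; case: arg_minP.
apply: proper_card; apply/properP; split.
  apply/subsetP => p; rewrite !inE => /existsP[q /andP[aXq le_qp]].
  have aXs : brk a X \in supp F (deg_ge w (w q1.1 - w q1.2 + s)).
    apply: brk_raises => //; apply/mem_supp => i j Xij; exact: (q1min (i, j)).
  apply/existsP; exists q1; rewrite Xq1; apply: le_trans le_qp.
  by have /mem_supp/(_ _ _ aXq)/= := aXs; apply: le_trans; rewrite lerDl ltW.
exists q1; rewrite inE; first by apply/existsP; exists q1; rewrite Xq1 /=.
apply/existsP => -[q /andP[aXq]]; apply/negP; rewrite -ltNge.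
have : brk a X \in supp F (deg_ge w (w q1.1 - w q1.2 + s)).
  apply: brk_raises => //; apply/mem_supp => i j Xij; exact: (q1min (i, j)).
by move=> /mem_supp/(_ _ _ aXq)/=; apply: lt_le_trans; rewrite ltrDl.
Qed.

End Graded.

Section Entries.

Variables (F : fieldType) (N : nat).
Implicit Types (X Y : 'M[F]_N).

Definition keeps (T : Type) (c : 'I_N -> T) (a : 'M[F]_N) :=
  forall i j, a i j != 0 -> c i = c j.

Lemma brk_keeps (T : Type) (c : 'I_N -> T) (f : T -> T -> bool) a X :
  keeps c a -> X \in supp F [rel i j | f (c i) (c j)] ->
  brk a X \in supp F [rel i j | f (c i) (c j)].
Proof.
move=> ca /mem_supp Xf; apply/mem_supp=> i j.
by case/brk_entry=> [[k [/ca ci /Xf]]|[k [/Xf + /ca ck]]] /=; rewrite ?ci -?ck.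
Qed.

(** At the two positions, where [S] vanishes, [X1] and [X2] form a triangular system, so they are
    independent modulo [S]. This is how defects are turned into two extra dimensions. *)
Lemma dim_add2 (S Z : {vspace 'M[F]_N}) X1 X2 i1 j1 i2 j2 :
  (S <= Z)%VS -> X1 \in Z -> X2 \in Z ->
  (forall Y, Y \in S -> Y i1 j1 = 0 /\ Y i2 j2 = 0) ->
  X1 i1 j1 != 0 -> X1 i2 j2 = 0 -> X2 i2 j2 != 0 ->
  (\dim S + 2 <= \dim Z)%N.
Proof.
move=> SZ X1Z X2Z S0 X11 X12 X22.
have X1n0 : X1 != 0 by apply: contraNneq X11 => ->; rewrite mxE.
have X2n0 : X2 != 0 by apply: contraNneq X22 => ->; rewrite mxE.
have dS1 : (\dim S + \dim <[X1]> <= \dim (S + <[X1]>))%N.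
  apply: dim_sum_le; rewrite ?addvSl ?addvSr // => _ /[swap] /vlineP[c ->].
  case/S0 => + _; rewrite mxE => /eqP; rewrite mulf_eq0 (negPf X11) orbF => /eqP ->.
  by rewrite scale0r.
have : (\dim (S + <[X1]>) + \dim <[X2]> <= \dim Z)%N.
  apply: dim_sum_le; rewrite ?subv_add ?SZ -?memvE // => _ /[swap] /vlineP[c ->].
  case/memv_addP => Y /S0[_ Y2] [_ /vlineP[d ->]] /matrixP/(_ i2 j2).
  rewrite !mxE Y2 X12 mulr0 addr0 => /eqP; rewrite mulf_eq0 (negPf X22) orbF => /eqP ->.
  by rewrite scale0r.
move: dS1; rewrite !dim_vline X1n0 X2n0; lia.
Qed.

End Entries.

Section BigradedPair.

Variables (F : fieldType) (N : nat) (R : realDomainType) (s : R).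
Hypothesis s_gt0 : 0 < s.
Implicit Types (X Y : 'M[F]_N).

Variables (w1 w2 : 'I_N -> R) (x y : 'M[F]_N).
Hypotheses (x1 : raises s w1 x) (x2 : keeps w2 x).
Hypotheses (y1 : keeps w1 y) (y2 : raises s w2 y).
Hypothesis xyC : x *m y = y *m x.

Variable U : {vspace 'M[F]_N}.
Hypotheses (Ux : forall X, X \in U -> brk x X \in U).
Hypotheses (Uy : forall X, X \in U -> brk y X \in U).

(** [U] will be all matrices, the skew ones or the symmetric ones for the form; the symmetric ones
    are not a Lie algebra but are stable under ad x and ad y. *)
Definition deg00 := (U :&: supp F (deg_eq w1 0%R) :&: supp F (deg_eq w2 0%R))%VS.
Definition cent2 := (U :&: cent x :&: cent y)%VS.
Definition quad := (cent2 :&: supp F (deg_ge w1 0%R) :&: supp F (deg_ge w2 0%R))%VS.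

Lemma mem_cent2 X :
  (X \in cent2) = [&& X \in U, brk x X == 0 & brk y X == 0].
Proof. by rewrite /cent2 !memv_cap !mem_cent andbA. Qed.

Lemma mem_quad X : (X \in quad) =
  [&& X \in cent2, X \in supp F (deg_ge w1 0%R) & X \in supp F (deg_ge w2 0%R)].
Proof. by rewrite /quad !memv_cap andbA. Qed.

Lemma cent_brk X : X \in cent x -> brk y X \in cent x.
Proof. by rewrite !mem_cent => /eqP Xx; rewrite brkC // Xx linear0. Qed.

(** [graded_dim] is applied to x in degree 0 for [w2], then to y inside the centralizer of x. The
    stable pattern [m] keeps the elements obtained apart from those in other classes of a
    labelling. *)
Lemma dim_quad (m : rel 'I_N) :
  (forall X, X \in supp F m -> brk x X \in supp F m) ->
  (forall X, X \in supp F m -> brk y X \in supp F m) ->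
  (\dim (deg00 :&: supp F m) <= \dim (quad :&: supp F m))%N.
Proof.
move=> mx my.
pose U1 := (U :&: supp F m :&: supp F (deg_eq w2 0%R))%VS.
pose U2 := (U :&: supp F m :&: cent x :&: supp F (deg_ge w1 0%R))%VS.
have h1 : (\dim (U1 :&: supp F (deg_eq w1 0%R))
    <= \dim (U1 :&: cent x :&: supp F (deg_ge w1 0%R)))%N.
  apply: graded_dim x1 _ => // X; rewrite !memv_cap => /andP[/andP[/Ux -> /mx ->]] /=.
  exact: (@brk_keeps _ _ _ w2 (fun u v => u - v == 0)).
have h2 : (\dim (U2 :&: supp F (deg_eq w2 0%R))
    <= \dim (U2 :&: cent y :&: supp F (deg_ge w2 0%R)))%N.
  apply: graded_dim y2 _ => // X; rewrite !memv_cap.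
  case/andP=> /andP[/andP[/Uy -> /my ->] /cent_brk -> /=].
  exact: (@brk_keeps _ _ _ w1 (fun u v => 0 <= u - v)).
apply: (@leq_trans (\dim (U1 :&: supp F (deg_eq w1 0%R)))).
  apply: dimvS; apply/subvP=> X; rewrite !memv_cap.
  by case/andP=> /andP[/andP[-> ->] ->] ->.
apply: leq_trans h1 _; apply: (@leq_trans (\dim (U2 :&: supp F (deg_eq w2 0%R)))).
  apply: dimvS; apply/subvP=> X; rewrite !memv_cap.
  by case/andP=> /andP[/andP[/andP[-> ->] ->] ->] ->.
apply: leq_trans h2 _; apply: dimvS; apply/subvP=> X; rewrite !memv_cap.
by case/andP=> /andP[/andP[/andP[/andP[-> ->] ->] ->] ->] ->.
Qed.

Lemma push2 (m : rel 'I_N) X :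
  (forall X, X \in supp F m -> brk x X \in supp F m) ->
  (forall X, X \in supp F m -> brk y X \in supp F m) ->
  X \in U -> X \in supp F m -> X != 0 ->
  exists Y, [/\ Y \in cent2, Y \in supp F m & Y != 0].
Proof.
move=> mx my XU Xm X0.
have [] := @graded_push _ _ _ _ s_gt0 w1 x (fun Y => Y \in (U :&: supp F m)%VS) _ x1 _ _ X0.
- by move=> Y; rewrite !memv_cap => /andP[/Ux -> /mx ->].
- by rewrite memv_cap XU.
move=> Y [YU Y0 xY].
have [] := @graded_push _ _ _ _ s_gt0 w2 y
  (fun Y => Y \in (U :&: supp F m :&: cent x)%VS) _ y2 _ _ Y0.
- by move=> T; rewrite !memv_cap => /andP[/andP[/Uy -> /my ->] /cent_brk ->].
- by rewrite memv_cap YU mem_cent xY eqxx.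
move=> T [TU T0 yT]; exists T; rewrite !memv_cap in TU; case/andP: TU => /andP[h1 h2] h3.
by split; rewrite // mem_cent2 h1 yT eqxx -mem_cent h3.
Qed.

Lemma push_y (m : rel 'I_N) X :
  (forall X, X \in supp F m -> brk y X \in supp F m) ->
  X \in U -> brk x X = 0 -> X \in supp F m -> X != 0 ->
  exists Y, [/\ Y \in cent2, Y \in supp F m & Y != 0].
Proof.
move=> my XU xX Xm X0.
have [] := @graded_push _ _ _ _ s_gt0 w2 y
  (fun Y => Y \in (U :&: supp F m :&: cent x)%VS) _ y2 _ _ X0.
- by move=> T; rewrite !memv_cap => /andP[/andP[/Uy -> /my ->] /cent_brk ->].
- by rewrite !memv_cap XU Xm mem_cent xX eqxx.
move=> T [TU T0 yT]; exists T; rewrite !memv_cap in TU; case/andP: TU => /andP[h1 h2] h3.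
by split; rewrite // mem_cent2 h1 yT eqxx -mem_cent h3.
Qed.

(** A labelling kept by x and y grades the centralizer by differences of labels. Difference 0
    contributes at least [\dim deg00], and pushing [X1] and [X2] gives one element each in the
    distinct differences l and -l. *)
Lemma dim_label (c : 'I_N -> int) (l : int) X1 X2 :
  keeps c x -> keeps c y -> (deg00 <= supp F [rel i j | c i == c j])%VS ->
  l != 0 -> X1 \in U -> X2 \in U ->
  X1 \in supp F [rel i j | c i == c j + l] ->
  X2 \in supp F [rel i j | c i == c j - l] -> X1 != 0 -> X2 != 0 ->
  (\dim deg00 + 2 <= \dim cent2)%N.
Proof.
move=> cx cy c0 l0 X1U X2U X1l X2l X10 X20.
have [Y1 [Y1c /mem_supp Y1l /entry_neq0[i1 [j1 Y1ij]]]] : exists Y,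
    [/\ Y \in cent2, Y \in supp F [rel i j | c i == c j + l] & Y != 0].
  by apply: push2 X1U X1l X10 => Y; apply: (@brk_keeps _ _ _ c (fun u v => u == v + l)).
have [Y2 [Y2c /mem_supp Y2l /entry_neq0[i2 [j2 Y2ij]]]] : exists Y,
    [/\ Y \in cent2, Y \in supp F [rel i j | c i == c j - l] & Y != 0].
  by apply: push2 X2U X2l X20 => Y; apply: (@brk_keeps _ _ _ c (fun u v => u == v - l)).
have /= e1 := Y1l _ _ Y1ij; have /= e2 := Y2l _ _ Y2ij.
apply: leq_trans (@dim_add2 _ _ (quad :&: supp F [rel i j | c i == c j]) _
  Y1 Y2 i1 j1 i2 j2 _ Y1c Y2c _ Y1ij _ Y2ij).
- rewrite leq_add2r -{1}(capv_idPl c0); apply: dim_quad => Y;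
  exact: (@brk_keeps _ _ _ c (fun u v => u == v)).
- by apply/subvP=> Y; rewrite memv_cap mem_quad => /andP[/and3P[]].
- move=> Y; rewrite memv_cap => /andP[_ /mem_supp Yc].
  split; apply/eqP; apply: contraT => /Yc /=; [move: e1|move: e2]; move: l0; clear; lia.
- apply/eqP; apply: contraT => /Y1l /=; move: e2 l0; clear; lia.
Qed.

(** Here [X1] and [X2] may lie in the same class, where pushing each of them could end in
    proportional elements. Raising the whole of [K] by y preserves its dimension count, and unequal
    labels separate the result from the equal-label part. *)
Lemma dim_cross (T : eqType) (c : 'I_N -> T) t X1 X2 i1 j1 i2 j2 :
  keeps c x -> keeps c y -> (deg00 <= supp F [rel i j | c i == c j])%VS ->
  let K := (U :&: cent x :&: supp F [rel i j | c i != c j]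
              :&: supp F (deg_eq w2 t))%VS in
  X1 \in K -> X2 \in K -> X1 i1 j1 != 0 -> X1 i2 j2 = 0 -> X2 i2 j2 != 0 ->
  (\dim deg00 + 2 <= \dim cent2)%N.
Proof.
move=> cx cy c0 K X1K X2K X11 X12 X22.
have dK : (2 <= \dim K)%N.
  have := @dim_add2 _ _ 0%VS _ X1 X2 i1 j1 i2 j2 _ X1K X2K _ X11 X12 X22.
  rewrite dimv0 sub0v; apply => // Y; rewrite memv0 => /eqP ->; by rewrite !mxE.
have h2 : (\dim K <= \dim (U :&: cent x :&: supp F [rel i j | c i != c j]
              :&: cent y :&: supp F (deg_ge w2 t)))%N.
  apply: graded_dim y2 _ => // X; rewrite !memv_cap.
  case/andP=> /andP[/Uy -> /cent_brk -> /=].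
  exact: (@brk_keeps _ _ _ c (fun u v => u != v)).
have h1 : (\dim deg00 <= \dim (quad :&: supp F [rel i j | c i == c j]))%N.
  rewrite -{1}(capv_idPl c0); apply: dim_quad => Y;
  exact: (@brk_keeps _ _ _ c (fun u v => u == v)).
apply: leq_trans (leq_add h1 (leq_trans dK h2)) _; apply: dim_sum_le.
- by apply/subvP=> Y; rewrite memv_cap mem_quad => /andP[/and3P[]].
- apply/subvP=> Y; rewrite !memv_cap.
  by case/andP=> /andP[/andP[/andP[-> ->] _] ->].
move=> Y; rewrite !memv_cap => /andP[_ /mem_supp Yc].
case/andP=> /andP[/andP[_ /mem_supp Yd] _] _.
apply/matrixP=> i j; rewrite mxE; apply/eqP; apply: contraT => Yij.
by move: (Yc _ _ Yij) (Yd _ _ Yij) => /= ->.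
Qed.

Definition quadP : rel 'I_N := [rel i j | (w1 i < w1 j) && (w2 j <= w2 i)].
Definition quadQ : rel 'I_N := [rel i j | (w2 i < w2 j) && (w1 j <= w1 i)].

Lemma dim_quad_le : (\dim deg00 <= \dim quad)%N.
Proof.
have Tx a X : X \in supp F (fun _ _ => true) -> brk a X \in supp F (fun _ _ => true).
  by move=> _; apply/mem_supp.
have h V : (V :&: supp F (fun _ _ => true))%VS = V.
  by apply/capv_idPl/subvP => X _; apply/mem_supp.
by have := dim_quad (Tx x) (Tx y); rewrite !h.
Qed.

(** An element in degrees (< 0, >= 0) and one in degrees (>= 0, < 0) would be independent modulo
    [quad]: each has an entry at which the other elements vanish. *)
Lemma quadP_or_quadQ : (\dim cent2 < \dim deg00 + 2)%N ->
  (forall X, X \in cent2 -> X \in supp F quadP -> X = 0) \/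
  (forall X, X \in cent2 -> X \in supp F quadQ -> X = 0).
Proof.
move=> small.
have [] := eqVneq (cent2 :&: supp F quadP)%VS 0%VS.
  move=> P0; left => X Xc Xp; apply/eqP; rewrite -memv0 -P0 memv_cap Xc //.
rewrite -subv0 => /subvPn[X1]; rewrite memv_cap memv0 => /andP[X1c /mem_supp X1P].
case/entry_neq0 => i1 [j1 X1ij].
right => X2 X2c /mem_supp X2Q; apply/eqP; apply: contraTT small.
case/entry_neq0 => i2 [j2 X2ij].
rewrite -leqNgt; apply: leq_trans (@dim_add2 _ _ quad _ X1 X2 i1 j1 i2 j2 _ X1c X2c _ X1ij _ X2ij).
- by rewrite leq_add2r dim_quad_le.
- by apply/subvP=> Y; rewrite mem_quad => /and3P[].
- move=> Y; rewrite mem_quad => /and3P[_ /mem_supp Y1 /mem_supp Y2].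
  move: (X1P _ _ X1ij) (X2Q _ _ X2ij) => /= /andP[a _] /andP[b _].
  split; apply/eqP; apply: contraT.
    by move/Y1; rewrite /deg_ge /= subr_ge0 leNgt a.
  by move/Y2; rewrite /deg_ge /= subr_ge0 leNgt b.
- apply/eqP; apply: contraT => /X1P /= /andP[+ _].
  by move: (X2Q _ _ X2ij) => /= /andP[_]; rewrite leNgt => /negPf ->.
Qed.

(** Degrees (< 0, >= 0) are stable under ad y, so a nonzero element there commuting with x could be
    pushed by y into the centralizer of both. *)
Lemma no_quadP : (forall X, X \in cent2 -> X \in supp F quadP -> X = 0) ->
  forall X, X \in U -> brk x X = 0 -> X \in supp F quadP -> X = 0.
Proof.
move=> noP X XU xX XP; apply/eqP; apply: contraT => X0.
have [Y [Yc /(noP _ Yc) -> /eqP //]] : exists Y,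
  [/\ Y \in cent2, Y \in supp F quadP & Y != 0].
apply: push_y X0 => // W /mem_supp XP'; apply/mem_supp => i j.
case/brk_entry=> [[k [yk /XP']]|[k [/XP' + yk]]]; rewrite /quadP /=.
  rewrite (y1 yk) (y2 yk) => /andP[-> /= /le_trans -> //].
  by rewrite lerDl ltW.
rewrite (y1 yk) (y2 yk) => /andP[-> /=]; apply: le_trans.
by rewrite lerDl ltW.
Qed.

End BigradedPair.

(** * Skew shapes *)

Section SkewShape.

Variables (F : fieldType) (N : nat) (x y : 'M[F]_N) (b1 b2 : 'I_N -> int).

Lemma mulmx_swap (A B : 'M[F]_N) i k j :
  A *m B = B *m A -> A i k != 0 -> B k j != 0 ->
  (forall m, A i m != 0 -> B m j != 0 -> m = k) ->
  exists m, B i m != 0 /\ A m j != 0.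
Proof.
move=> AB Aik Bkj uniq_k.
by apply: mulmx_entry_neq0; rewrite -AB (mulmx_entry uniq_k) mulf_neq0.
Qed.

Lemma brk0_comm (a X : 'M[F]_N) : brk a X = 0 -> a *m X = X *m a.
Proof. by move/eqP; rewrite subr_eq0 => /eqP. Qed.

Hypotheses (x1 : raises 1 b1 x) (x2 : keeps b2 x).
Hypotheses (y1 : keeps b1 y) (y2 : raises 1 b2 y).
Hypothesis xyC : x *m y = y *m x.
Hypothesis thin : forall i j, b1 i = b1 j -> b2 i = b2 j -> i = j.
Hypothesis row_conn : forall i i', b2 i = b2 i' -> b1 i < b1 i' ->
  exists j, x j i != 0.
Hypothesis row_link : forall i j, b2 j < b2 i ->
  exists k l, y k l != 0 /\ b2 k = b2 i.

Lemma x_neq0 i j : b1 j = b1 i + 1 -> b2 j = b2 i -> x j i != 0.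
Proof.
move=> e1 e2; have [||k xki] := @row_conn i j; rewrite ?e1 ?e2 ?ltrDl //.
by rewrite (@thin j k) // ?e1 ?e2; [rewrite (x1 xki)|rewrite (x2 xki)].
Qed.

Lemma row_pred i i' : b2 i = b2 i' -> b1 i < b1 i' ->
  exists j, x i' j != 0.
Proof.
move=> e2 lt1.
pose k := [arg max_(k > i | (b2 k == b2 i') && (b1 k < b1 i')) b1 k]%O.
have [/andP[/eqP k2 k1] kmax] : ((b2 k == b2 i') && (b1 k < b1 i')) /\
    forall j, (b2 j == b2 i') && (b1 j < b1 i') -> b1 j <= b1 k.
  by rewrite /k; case: arg_maxP; rewrite ?e2 ?eqxx.
have [j xjk] := row_conn k2 k1; have := x1 xjk; have := x2 xjk => e e'.
have := kmax j; rewrite e k2 eqxx /= => kj.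
by exists k; rewrite (@thin i' j) // ?e ?k2 //; lia.
Qed.

Lemma row_gapfree i i' c : b2 i = b2 i' -> b1 i <= c -> c <= b1 i' ->
  exists k, b1 k = c /\ b2 k = b2 i.
Proof.
move=> e2 ic ci'; have [n en] : exists n : nat, c = b1 i + n%:Z.
  by exists `|c - b1 i|%N; lia.
rewrite {c ic}en in ci' *; elim: n ci' => [|n IHn] le_n.
  by exists i; rewrite addr0.
have [|k [k1 k2]] := IHn; first lia.
have [||j xjk] := @row_conn k i'; rewrite ?k1 ?k2 //; first lia.
by exists j; rewrite (x1 xjk) (x2 xjk) k1 k2; split=> //; lia.
Qed.

(** One square at a time: from y k l and the arrow of x into l, [mulmx_swap] yields an arrow of y
    out of the left neighbour of l. *)
Lemma link_left k l l' : y k l != 0 -> b2 l' = b2 l -> b1 l' <= b1 l ->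
  exists k', y k' l' != 0 /\ b2 k' = b2 k.
Proof.
move=> ykl e2 le1; have [n en] : exists n : nat, b1 l = b1 l' + n%:Z.
  by exists `|b1 l - b1 l'|%N; lia.
elim: n k l ykl e2 en {le1} => [|n IHn] k l ykl e2 en.
  by exists k; rewrite (@thin l' l) //; lia.
have [|m xlm] := @row_pred l' l e2; first lia.
have [k' [xkk' yk'm]] : exists k', x k k' != 0 /\ y k' m != 0.
  apply: (mulmx_swap (k := l)) => // p ykp _.
  by apply: thin; [rewrite -(y1 ykp) (y1 ykl)|have := y2 ykp; have := y2 ykl; lia].
have [||k'' [yk'' e]] := IHn k' m yk'm.
- by rewrite e2 (x2 xlm).
- by have := x1 xlm; lia.
by exists k''; rewrite e (x2 xkk').
Qed.

(** The mirror argument: sources are found for all targets to the right in the target row. *)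
Lemma link_right k l k' : y k l != 0 -> b2 k' = b2 k -> b1 k <= b1 k' ->
  exists l', y k' l' != 0 /\ b2 l' = b2 l.
Proof.
move=> ykl e2 le1; have [n en] : exists n : nat, b1 k' = b1 k + n%:Z.
  by exists `|b1 k' - b1 k|%N; lia.
elim: n k l ykl e2 en {le1} => [|n IHn] k l ykl e2 en.
  by exists l; rewrite (@thin k' k) //; lia.
have [||m xmk] := @row_conn k k'; rewrite ?e2 //; first lia.
have [l' [yml' xl'l]] : exists l', y m l' != 0 /\ x l' l != 0.
  apply: (mulmx_swap (k := k)) => // p xmp _.
  by apply: thin; [have := x1 xmp; have := x1 xmk; lia|rewrite -(x2 xmp) (x2 xmk)].
have [||l'' [yl'' e]] := IHn m l' yml'.
- by rewrite e2 (x2 xmk).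
- by have := x1 xmk; lia.
by exists l''; rewrite e (x2 xl'l).
Qed.

Lemma y_neq0 i j : b1 j = b1 i -> b2 j = b2 i + 1 -> y j i != 0.
Proof.
move=> e1 e2; have [|k [l [ykl ek]]] := @row_link j i; first lia.
have el : b2 l = b2 i by have := y2 ykl; lia.
have kl1 := y1 ykl.
have [le_il|lt_li] := leP (b1 i) (b1 l).
  have [|k' [yk'i ek']] := link_left ykl _ le_il; first by rewrite el.
  by rewrite (@thin j k') //; [rewrite e1 (y1 yk'i)|rewrite ek' ek].
have [||l' [yjl' el']] := @link_right k l j ykl; rewrite ?ek //; first lia.
by rewrite (@thin i l') //; [rewrite -e1 (y1 yjl')|rewrite el' el].
Qed.

Lemma row_exists i j c : b2 i <= c -> c <= b2 j -> exists k, b2 k = c.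
Proof.
move=> ic cj; have [n en] : exists n : nat, b2 j = c + n%:Z.
  by exists `|b2 j - c|%N; lia.
elim: n j en {cj} => [|n IHn] j en; first by exists j; lia.
have [|k [l [ykl ek]]] := @row_link j i; first lia.
by apply: (IHn l); have := y2 ykl; lia.
Qed.

(** An arrow of y between consecutive rows spreads left in its source row and right in its target
    row. Hence both ends of a row move weakly to the left as [b2] grows, as in a skew shape. *)
Lemma row_mono i j : b2 i <= b2 j ->
  (exists k, b2 k = b2 j /\ b1 k <= b1 i) /\ (exists k, b2 k = b2 i /\ b1 j <= b1 k).
Proof.
move=> ij; have [n en] : exists n : nat, b2 j = b2 i + n%:Z.
  by exists `|b2 j - b2 i|%N; lia.
elim: n j en {ij} => [|n IHn] j en.
  split; [exists i|exists j]; lia.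
have [|k [l [ykl ek]]] := @row_link j i; first lia.
have el : b2 l = b2 i + n%:Z by have := y2 ykl; lia.
have kl1 := y1 ykl.
split.
  have [[k1 [k12 k11]] _] := IHn l el.
  have [le1|lt1] := leP (b1 k1) (b1 l).
    have [|k' [yk' ek']] := link_left ykl _ le1; first by rewrite k12.
    by exists k'; rewrite ek' ek (y1 yk').
  by exists k; split => //; lia.
have [le1|lt1] := leP (b1 k) (b1 j).
  have [|l' [yl' el']] := link_right ykl _ le1; first by rewrite ek.
  by have [|_ []] := IHn l'; rewrite ?el' // (y1 yl') => m []; exists m.
by have [_ [m [m2 m1]]] := IHn l el; exists m; split=> //; lia.
Qed.

(** The row at height [c2] has by [row_mono] a vector weakly left of [c1], seen from i, and one
    weakly right of it, seen from j; rows have no gaps. So the rectangle between two comparable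
    boxes lies in the shape. *)
Lemma order_convex i j c1 c2 : b1 i <= c1 -> c1 <= b1 j ->
  b2 i <= c2 -> c2 <= b2 j -> exists k, b1 k = c1 /\ b2 k = c2.
Proof.
move=> i1 j1 i2 j2; have [r er] := row_exists i2 j2.
have [|[k [k2 k1]] _] := @row_mono i r; first by rewrite er.
have [|_ [l [l2 l1]]] := @row_mono r j; first by rewrite er.
have [|||m [m1 m2]] := @row_gapfree k l c1; rewrite ?k2 ?l2 //.
- exact: le_trans k1 i1.
- exact: le_trans j1 l1.
by exists m; rewrite m2 k2.
Qed.

Section Endomorphism.

Variable phi : 'M[F]_N.
Hypotheses (xphi : brk x phi = 0) (yphi : brk y phi = 0).

(** Moving the target along an arrow of x forces the source to move along: the corresponding entry
    of x phi is nonzero, hence that of phi x. In particular the new source must exist in the shape.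
    The next three lemmas are the other directions. *)
Lemma endo_right t s t' : phi t s != 0 -> b1 t' = b1 t + 1 -> b2 t' = b2 t ->
  exists s', [/\ phi t' s' != 0, b1 s' = b1 s + 1 & b2 s' = b2 s].
Proof.
move=> pts e1 e2; have xt := x_neq0 e1 e2.
have [m [pm xm]] : exists m, phi t' m != 0 /\ x m s != 0.
  apply: (mulmx_swap (k := t)) => //; first exact: brk0_comm.
  by move=> m xm _; apply: thin; [have := x1 xm; lia|rewrite -(x2 xm)].
by exists m; rewrite (x1 xm) (x2 xm).
Qed.

Lemma endo_left t s s' : phi t s != 0 -> b1 s = b1 s' + 1 -> b2 s = b2 s' ->
  exists t', [/\ phi t' s' != 0, b1 t = b1 t' + 1 & b2 t = b2 t'].
Proof.
move=> pts e1 e2; have xs := x_neq0 e1 e2.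
have [m [xm pm]] : exists m, x t m != 0 /\ phi m s' != 0.
  apply: (mulmx_swap (k := s)) => //; first exact/esym/brk0_comm.
  by move=> m _ xm; apply: thin; [have := x1 xm; lia|rewrite (x2 xm)].
by exists m; rewrite (x1 xm) (x2 xm).
Qed.

Lemma endo_up t s t' : phi t s != 0 -> b1 t' = b1 t -> b2 t' = b2 t + 1 ->
  exists s', [/\ phi t' s' != 0, b1 s' = b1 s & b2 s' = b2 s + 1].
Proof.
move=> pts e1 e2; have yt := y_neq0 e1 e2.
have [m [pm ym]] : exists m, phi t' m != 0 /\ y m s != 0.
  apply: (mulmx_swap (k := t)) => //; first exact: brk0_comm.
  by move=> m ym _; apply: thin; [rewrite -(y1 ym)|have := y2 ym; lia].
by exists m; rewrite (y1 ym) (y2 ym).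
Qed.

Lemma endo_down t s s' : phi t s != 0 -> b1 s = b1 s' -> b2 s = b2 s' + 1 ->
  exists t', [/\ phi t' s' != 0, b1 t = b1 t' & b2 t = b2 t' + 1].
Proof.
move=> pts e1 e2; have ys := y_neq0 e1 e2.
have [m [ym pm]] : exists m, y t m != 0 /\ phi m s' != 0.
  apply: (mulmx_swap (k := s)) => //; first exact/esym/brk0_comm.
  by move=> m _ ym; apply: thin; [rewrite (y1 ym)|have := y2 ym; lia].
by exists m; rewrite (y1 ym) (y2 ym).
Qed.

(* A nonzero entry of negative degree would propagate to the left for ever,
   because the shape contains the whole rectangle between target and source. *)
Lemma endo_not_lower t s : phi t s != 0 -> b1 t < b1 s -> b2 t <= b2 s -> False.
Proof.
move=> pts lt1 le2; pose m (i : 'I_N) := #|[set j | b1 j < b1 i]|.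
have [n ltn] := ubnP (m t); elim: n => // n IHn in t s pts lt1 le2 ltn *.
have [||||s' [s1 s2]] := @order_convex t s (b1 s - 1) (b2 s); try lia.
have [||t' [pt' t1 t2]] := @endo_left t s s' pts; try lia.
apply: (IHn t' s') => //; try lia.
rewrite ltnS in ltn; apply: leq_trans ltn; apply: proper_card.
apply/properP; split; last by exists t'; rewrite inE ?ltxx //; lia.
by apply/subsetP => j; rewrite !inE; lia.
Qed.

Lemma endo_not_lower' t s : phi t s != 0 -> b1 t <= b1 s -> b2 t < b2 s -> False.
Proof.
move=> pts le1 lt2; pose m (i : 'I_N) := #|[set j | b2 j < b2 i]|.
have [n ltn] := ubnP (m t); elim: n => // n IHn in t s pts le1 lt2 ltn *.
have [||||s' [s1 s2]] := @order_convex t s (b1 s) (b2 s - 1); try lia.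
have [||t' [pt' t1 t2]] := @endo_down t s s' pts; try lia.
apply: (IHn t' s') => //; try lia.
rewrite ltnS in ltn; apply: leq_trans ltn; apply: proper_card.
apply/properP; split; last by exists t'; rewrite inE ?ltxx //; lia.
by apply/subsetP => j; rewrite !inE; lia.
Qed.

Lemma endo_climb t s k m : phi t s != 0 -> b1 k = b1 t -> b2 k = b2 t + m%:Z ->
  exists s', [/\ phi k s' != 0, b1 s' = b1 s & b2 s' = b2 s + m%:Z].
Proof.
move=> pts; elim: m k => [|m IHm] k k1 k2.
  have -> : k = t by apply: thin; lia.
  by exists s; rewrite addr0.
have [||||k' [e1 e2]] := @order_convex t k (b1 t) (b2 t + m%:Z); try lia.
have [s' [pk' f1 f2]] := IHm k' e1 e2.
have [||s'' [pk g1 g2]] := endo_up pk' (t' := k); try lia.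
by exists s''; split=> //; lia.
Qed.

Lemma endo_descend t s k m : phi t s != 0 -> b1 k = b1 s -> b2 s = b2 k + m%:Z ->
  exists t', [/\ phi t' k != 0, b1 t' = b1 t & b2 t = b2 t' + m%:Z].
Proof.
move=> pts; elim: m k => [|m IHm] k k1 k2.
  have -> : k = s by apply: thin; lia.
  by exists t; rewrite addr0.
have [||||k' [e1 e2]] := @order_convex k s (b1 s) (b2 k + 1); try lia.
have [||t' [pk' f1 f2]] := IHm k'; try lia.
have [||t'' [pk g1 g2]] := endo_down pk' (s' := k); try lia.
by exists t''; split=> //; lia.
Qed.

End Endomorphism.

Definition col_top i := [arg max_(k > i | b1 k == b1 i) b2 k]%O.
Definition row_min i := [arg min_(k < i | b2 k == b2 i) b1 k]%O.

(* An endomorphism of nonnegative bidegree is determined by its entries from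
   row beginnings to column tops; such a pair (t, s) with s <= t corresponds to
   the box in the column of t and the row of s. *)
Lemma dim_endo_quad (W : {vspace 'M[F]_N}) :
  (forall phi, phi \in W -> [/\ brk x phi = 0, brk y phi = 0 &
     forall t s, phi t s != 0 -> b1 s <= b1 t /\ b2 s <= b2 t]) ->
  (\dim W <= N)%N.
Proof.
move=> WP; rewrite -[leqRHS]card_ord.
apply: (@dim_le_entries _ _ _ (fun i => (col_top i, row_min i))) => phi.
case/WP => xphi yphi pos phi0; apply/eqP; apply: contraT => /entry_neq0[t0 [s0 p0]].
(* Moving the target up or to the left would increase [b2 q.1 - b1 q.1]. By [endo_up] and
   [endo_left], a nonzero entry maximizing it therefore goes from a row beginning to a column
   top. *)
pose q := [arg max_(q > (t0, s0) | phi q.1 q.2 != 0) (b2 q.1 - b1 q.1)]%O.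
have [] : phi q.1 q.2 != 0 /\ forall r : 'I_N * 'I_N, phi r.1 r.2 != 0 ->
    b2 r.1 - b1 r.1 <= b2 q.1 - b1 q.1.
  by rewrite /q; case: arg_maxP.
case: q => t s /= pts qmax.
have [st1 st2] := pos _ _ pts.
have [||||i [i1 i2]] := @order_convex s t (b1 t) (b2 s); try lia.
have := phi0 i => /= /eqP; suff [-> ->] : col_top i = t /\ row_min i = s.
  by rewrite (negPf pts).
split.
  rewrite /col_top; case: arg_maxP => // k /eqP k1 kmax.
  apply: thin; first by rewrite k1.
  have := kmax t; rewrite i1 eqxx => /(_ isT) le_tk; apply/eqP.
  move: le_tk; rewrite /= eq_le => ->; rewrite andbT leNgt; apply/negP => lt_tk.
  have [||||t' [e1 e2]] := @order_convex t k (b1 t) (b2 t + 1); try lia.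
  have [||s' [pt' _ _]] := @endo_up phi yphi t s t' pts; try lia.
  by have := qmax (t', s') pt' => /=; lia.
rewrite /row_min; case: arg_minP => // k /eqP k2 kmin.
apply: thin; last by rewrite k2.
have := kmin s; rewrite i2 eqxx => /(_ isT) le_ks; apply/eqP.
move: le_ks; rewrite /= eq_le => ->; rewrite /= leNgt; apply/negP => lt_ks.
have [||||s' [e1 e2]] := @order_convex k s (b1 s - 1) (b2 s); try lia.
have [||t' [pt' f1 f2]] := @endo_left phi xphi t s s' pts; try lia.
by have := qmax (t', s') pt' => /=; lia.
Qed.

End SkewShape.

(** * Powers of x and maps between strings *)

Section Powers.

Variables (F : fieldType) (N : nat).
Implicit Types (a x E : 'M[F]_N).

Definition mxpow x k : 'M[F]_N := iter k (mulmx x) 1%:M.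

Lemma mxpowS x k : mxpow x k.+1 = x *m mxpow x k.
Proof. by []. Qed.

Lemma mxpow_commute a x k : a *m x = x *m a -> a *m mxpow x k = mxpow x k *m a.
Proof.
move=> ax; elim: k => [|k IHk]; first by rewrite mulmx1 mul1mx.
by rewrite mxpowS mulmxA ax -!mulmxA IHk.
Qed.

Lemma mxpow_comm x k : x *m mxpow x k = mxpow x k *m x.
Proof. exact: mxpow_commute. Qed.

Lemma mxpow_raises (R : pzRingType) (s : R) (w : 'I_N -> R) x k i j :
  (forall i j, x i j != 0 -> w i = w j + s) ->
  mxpow x k i j != 0 -> w i = w j + s *+ k.
Proof.
move=> wx; elim: k i => [|k IHk] i.
  by rewrite mxE addr0; have [->|] := eqVneq i j; rewrite ?eqxx.
by rewrite mxpowS => /mulmx_entry_neq0[l [/wx -> /IHk ->]]; rewrite mulrSr addrA.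
Qed.

Lemma mxpow_keeps (T : eqType) (c : 'I_N -> T) x k i j :
  keeps c x -> mxpow x k i j != 0 -> c i = c j.
Proof.
move=> cx; elim: k i => [|k IHk] i.
  by rewrite mxE; have [->|] := eqVneq i j; rewrite ?eqxx.
by rewrite mxpowS => /mulmx_entry_neq0[l [/cx -> /IHk]].
Qed.

(* For E = u f of rank one, this endomorphism maps the x-string through the
   covector f onto the x-string through u. *)
Lemma brk_pow_sum x E m :
  mxpow x m.+1 *m E = 0 -> E *m mxpow x m.+1 = 0 ->
  brk x (\sum_(i < m.+1) mxpow x i *m E *m mxpow x (m - i)) = 0.
Proof.
move=> xE Ex; pose a i := mxpow x i *m E *m mxpow x (m.+1 - i).
have e (i : 'I_m.+1) : brk x (mxpow x i *m E *m mxpow x (m - i)) = a i.+1 - a i.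
  rewrite /brk /a subSS mxpowS !mulmxA subSn ?mxpowS -?mxpow_comm //; last by case: i.
  by rewrite -!mulmxA mxpow_comm !mulmxA.
rewrite linear_sum (eq_bigr _ (fun i _ => e i)) /=.
have -> : \sum_(i < m.+1) (a i.+1 - a i) = a m.+1 - a 0%N.
  by rewrite -(big_mkord xpredT (fun i => a i.+1 - a i)) telescope_sumr.
by rewrite /a subnn subn0 mul1mx Ex xE mul0mx subr0.
Qed.

Lemma mul_delta_mul (A B : 'M[F]_N) k l i j :
  (A *m delta_mx k l *m B) i j = A i k * B l j.
Proof.
rewrite mxE (bigD1 l) //= big1 ?addr0 => [|q ql].
  rewrite mxE (bigD1 k) //= big1 ?addr0 => [|p pk].
    by rewrite mxE !eqxx mulr1.
  by rewrite mxE (negPf pk) mulr0.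
rewrite mxE big1 ?mul0r // => p _.
by rewrite mxE (negPf ql) andbF mulr0.
Qed.

Variables (x : 'M[F]_N) (b1 : 'I_N -> int) (row : pred 'I_N).
Hypothesis xrow : forall j k, x j k != 0 -> b1 j = b1 k + 1 /\ row j = row k.
Hypothesis row_thin : forall j k, row j -> row k -> b1 j = b1 k -> j = k.
Hypothesis row_conn : forall j k, row j -> row k -> b1 j < b1 k ->
  exists l, x l j != 0.

(** Stated for a single row, since in the orthogonal case the row containing weight 0 may have a
    repeated weight. *)
Lemma mxpow_neq0 k i j : row i -> row j -> b1 j = b1 i + k%:Z -> mxpow x k j i != 0.
Proof.
move=> ri rj e; elim: k => [|k IHk] in i ri e *.
  by rewrite mxE (@row_thin i j) ?eqxx ?oner_eq0 // e addr0.
have [|l xli] := @row_conn i j ri rj; first lia.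
have [l1 rl] := xrow xli; rewrite ri in rl.
rewrite mxpowS mxpow_comm mxE (bigD1 l) //= big1 ?addr0 => [|m ml].
  by rewrite mulf_neq0 // IHk //; lia.
apply: contraNeq ml; rewrite mulf_eq0 negb_or => /andP[_ /xrow[m1 rm]].
by apply/eqP/row_thin; rewrite ?rm //; lia.
Qed.

End Powers.

(** * Pairs in gl_N with integral weights *)

Section TypeA.

Variables (F : fieldType) (N : nat).

Lemma delta_mx_neq0 i k (p q : 'I_N) :
  (delta_mx i k : 'M[F]_N) p q != 0 -> p = i /\ q = k.
Proof.
rewrite mxE; case: (eqVneq p i) => [->|_]; case: (eqVneq q k) => [->|_] //;
by rewrite eqxx.
Qed.

Lemma dim_cent_gl_int (x y : 'M[F]_N) (b1 b2 : 'I_N -> int) :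
  raises 1 b1 x -> keeps b2 x -> keeps b1 y -> raises 1 b2 y ->
  x *m y = y *m x ->
  (forall i j, b1 i = b1 j -> b2 i = b2 j -> i = j) ->
  (forall X, brk x X = 0 -> X \in supp F (quadP b1 b2) -> X = 0) ->
  (forall c : 'I_N -> int, keeps c x -> keeps c y -> forall i j, c i = c j) ->
  (\dim (cent x :&: cent y) <= N)%N.
Proof.
move=> x1 x2 y1 y2 xyC thin noP conn0.
have row_conn i i' : b2 i = b2 i' -> b1 i < b1 i' -> exists j, x j i != 0.
  move=> e2 lt1; apply/existsP; apply: contraTT isT => /existsPn xi.
  (* [k] is the next vector of the row after [i]. If x killed e_i, then E_(i, k) would commute with
     x, in degree (< 0, 0). *)
  pose k := [arg min_(k < i' | (b2 k == b2 i) && (b1 i < b1 k)) b1 k]%O.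
  have [/andP[/eqP k2 k1] kmin] : ((b2 k == b2 i) && (b1 i < b1 k)) /\
      forall j, (b2 j == b2 i) && (b1 i < b1 j) -> b1 k <= b1 j.
    by rewrite /k; case: arg_minP; rewrite ?e2 ?eqxx.
  suff : (delta_mx i k : 'M[F]_N) = 0.
    by move/matrixP/(_ i k); rewrite !mxE !eqxx => /eqP; rewrite oner_eq0.
  apply: noP; last first.
    apply/mem_supp => p q /delta_mx_neq0[-> ->].
    by rewrite /quadP /= k1 k2 lexx.
  apply/eqP; apply: contraT => /entry_neq0[p [q /brk_entry]].
  case=> -[l [u v]]; last first.
    have [_ el] := delta_mx_neq0 u; rewrite {l}el in u v *.
    have kq := x1 _ _ v; have q2 := x2 _ _ v.
    have [e|ne] := eqVneq (b1 q) (b1 i).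
      by move: v; rewrite (thin _ _ e) -?q2 ?k2 // => v; have := xi k; rewrite v.
    by have := kmin q; rewrite -q2 k2 eqxx /=; lia.
  by have [el _] := delta_mx_neq0 v; have := xi p; rewrite -el u.
have row_link i j : b2 j < b2 i -> exists k l, y k l != 0 /\ b2 k = b2 i.
  move=> lt2; have [/existsP[k /existsP[l /andP[ykl /eqP e]]]|/existsPn y0] :=
    boolP [exists k, exists l, (y k l != 0) && (b2 k == b2 i)]; first by exists k, l.
  (* If no arrow of y enters the row of [i], the indicator of the rows from that height on is kept
     by x and y, but it separates [i] from [j]. *)
  have := conn0 (fun k => if b2 i <= b2 k then 1 else 0) _ _ i j.
  rewrite lexx leNgt lt2 /= => h; suff: 1 = 0 :> int by [].
  apply: h => p q; first by move/x2 ->.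
  move=> ypq; have /existsPn/(_ q) := y0 p; rewrite ypq /= => ne.
  by rewrite (_ : (b2 i <= b2 p) = (b2 i <= b2 q)) //; have := y2 _ _ ypq; lia.
have [N0|[i0 _]] : N = 0%N \/ exists i0 : 'I_N, true.
  by case: (N) => [|n]; [left|right; exists ord0].
  rewrite -[leqRHS]card_ord; apply: (@dim_le_entries _ _ _ (fun i => (i, i))) => X _ _.
  by apply/matrixP => -[k k_lt]; exfalso; move: k_lt; rewrite N0.
have OC := order_convex x1 x2 y1 y2 xyC thin row_conn row_link.
have mono := row_mono x1 x2 y1 y2 xyC thin row_conn row_link.
have [m0 _ m0min] := @arg_minP _ _ _ i0 xpredT b2 isT.
have [M0 _ M0max] := @arg_maxP _ _ _ i0 xpredT b2 isT.
have [gm /eqP gm2 gmin] := @arg_minP _ _ _ m0 [pred k | b2 k == b2 m0] b1 (eqxx _).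
have [sm /eqP sm2 smax] := @arg_maxP _ _ _ m0 [pred k | b2 k == b2 m0] b1 (eqxx _).
have [gM /eqP gM2 gMin] := @arg_minP _ _ _ M0 [pred k | b2 k == b2 M0] b1 (eqxx _).
have [sM /eqP sM2 sMax] := @arg_maxP _ _ _ M0 [pred k | b2 k == b2 M0] b1 (eqxx _).
(* If the lowest row begins furthest left, [gm] is the least box of the shape: nonzero entries slide
   to source [gm], so column [gm] determines phi. *)
have [le_g|lt_g] := leP (b1 gm) (b1 gM).
  have gm_le s : b1 gm <= b1 s.
    have [|[k [k2 k1]] _] := mono s M0; first exact: M0max.
    by apply: le_trans k1; apply: le_trans le_g _; apply: gMin; apply/eqP.
  rewrite -[leqRHS]card_ord; apply: (@dim_le_entries _ _ _ (fun i => (i, gm))) => phi.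
  rewrite memv_cap !mem_cent => /andP[/eqP xphi /eqP yphi] /= phi0.
  apply/eqP; apply: contraT => /entry_neq0[t0 [s0 p0]].
  have [[t s] /= pts smin] := @arg_minP _ _ _ (t0, s0)
    [pred q : 'I_N * 'I_N | phi q.1 q.2 != 0] (fun q => b1 q.2 + b2 q.2) p0.
  have s2 : b2 gm <= b2 s by rewrite gm2 m0min.
  have e1 : b1 s = b1 gm.
    apply/eqP; rewrite eq_le gm_le andbT leNgt; apply/negP => lt1.
    have [||||s' [f1 f2]] := OC gm s (b1 s - 1) (b2 s); try lia.
    have [||t' [pt' _ _]] := endo_left x1 x2 thin row_conn xphi pts (s' := s'); try lia.
    by have := smin (t', s') pt' => /=; lia.
  have e2 : b2 s = b2 gm.
    apply/eqP; rewrite eq_le s2 andbT leNgt; apply/negP => lt1.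
    have [||||s' [f1 f2]] := OC gm s (b1 s) (b2 s - 1); try lia.
    have [||t' [pt' _ _]] :=
      endo_down x1 x2 y1 y2 xyC thin row_conn row_link yphi pts (s' := s'); try lia.
    by have := smin (t', s') pt' => /=; lia.
  by have := phi0 t; rewrite -(thin _ _ e1 e2) => /eqP; rewrite (negPf pts).
(* Dually, if the top row ends furthest right, [sM] is the greatest box and row [sM] determines
   phi. *)
have [le_s|lt_s] := leP (b1 sm) (b1 sM).
  have le_sM s : b1 s <= b1 sM.
    have [|_ [k [k2 k1]]] := mono m0 s; first exact: m0min.
    by apply: le_trans k1 _; apply: le_trans le_s; apply: smax; apply/eqP.
  rewrite -[leqRHS]card_ord; apply: (@dim_le_entries _ _ _ (fun i => (sM, i))) => phi.
  rewrite memv_cap !mem_cent => /andP[/eqP xphi /eqP yphi] /= phi0.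
  apply/eqP; apply: contraT => /entry_neq0[t0 [s0 p0]].
  have [[t s] /= pts tmax] := @arg_maxP _ _ _ (t0, s0)
    [pred q : 'I_N * 'I_N | phi q.1 q.2 != 0] (fun q => b1 q.1 + b2 q.1) p0.
  have t2 : b2 t <= b2 sM by rewrite sM2; exact: M0max.
  have e1 : b1 t = b1 sM.
    apply/eqP; rewrite eq_le le_sM /= leNgt; apply/negP => lt1.
    have [||||t' [f1 f2]] := OC t sM (b1 t + 1) (b2 t); try lia.
    have [||s' [pt' _ _]] := endo_right x1 x2 thin row_conn xphi pts (t' := t'); try lia.
    by have := tmax (t', s') pt' => /=; lia.
  have e2 : b2 t = b2 sM.
    apply/eqP; rewrite eq_le t2 /= leNgt; apply/negP => lt1.
    have [||||t' [f1 f2]] := OC t sM (b1 t) (b2 t + 1); try lia.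
    have [||s' [pt' _ _]] :=
      endo_up x1 x2 y1 y2 xyC thin row_conn row_link yphi pts (t' := t'); try lia.
    by have := tmax (t', s') pt' => /=; lia.
  by have := phi0 s; rewrite -(thin _ _ e1 e2) => /eqP; rewrite (negPf pts).
have gs_m : b1 gm <= b1 sm by apply: gmin; rewrite /= sm2.
have gs_M : b1 gM <= b1 sM by apply: gMin; rewrite /= sM2.
(* There remains a top row that begins and ends strictly left of the lowest one. With [m] the larger
   of the two lengths, the string map [X] commutes with x, and its degree is b1 sM - b1 sm or b1 gM
   - b1 gm in the first coordinate, negative in both cases. *)
have [m [em1 em2 em3]] : exists m : nat, [/\ b1 sM - b1 gM <= m%:Z,
    b1 sm - b1 gm <= m%:Z & m%:Z <= b1 sM - b1 gM \/ m%:Z <= b1 sm - b1 gm].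
  by exists (maxn `|b1 sM - b1 gM| `|b1 sm - b1 gm|)%N; split; lia.
pose E : 'M[F]_N := delta_mx gM sm.
pose X := \sum_(i < m.+1) mxpow x i *m E *m mxpow x (m - i).
have XE a b : X a b = \sum_(i < m.+1) mxpow x i a gM * mxpow x (m - i) sm b.
  by rewrite summxE; apply: eq_bigr => i _; rewrite mul_delta_mul.
have xpow k a b : mxpow x k a b != 0 -> b1 a = b1 b + k%:Z /\ b2 a = b2 b.
  move=> xk; rewrite (mxpow_keeps x2 xk); split=> //.
  by rewrite (@mxpow_raises _ _ _ 1 b1 x k a b x1 xk) pmulrn intz.
have X0 : X = 0.
  apply: noP.
    apply: brk_pow_sum; apply/eqP; apply: contraT => /entry_neq0[a [b]].
      rewrite -[_ *m _]mulmx1 mul_delta_mul mulf_eq0 negb_or => /andP[/xpow[a1 a2] _].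
      by have := sMax a; rewrite /= a2 gM2 eqxx => /(_ isT); lia.
    rewrite -[E]mul1mx mul_delta_mul mulf_eq0 negb_or => /andP[_ /xpow[a1 a2]].
    by have := gmin b; rewrite /= -a2 sm2 eqxx => /(_ isT); lia.
  apply/mem_supp => a b; rewrite XE => /sum_neq0[i].
  rewrite mulf_eq0 negb_or => /andP[/xpow[a1 a2] /xpow[c1 c2]].
  rewrite /quadP /= -c2 a2 sm2 gM2 m0min // andbT.
  by case: i a1 c1 => i /= lt_im; lia.
have row_pow i j k : b2 i = b2 j -> b1 j = b1 i + k%:Z -> mxpow x k j i != 0.
  move=> e2 e1; apply: (@mxpow_neq0 _ _ x b1 [pred l | b2 l == b2 i]) => //=.
  - by move=> a b xab; rewrite (x1 _ _ xab) (x2 _ _ xab).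
  - by move=> a b /eqP a2 /eqP c2 /thin ->; rewrite ?a2 ?c2.
  - by move=> a b /eqP a2 /eqP c2; apply: row_conn; rewrite a2 c2.
  by rewrite e2.
(* [p] is where the term x^(m - d) E x^d, with [d] the length of the lowest row, sends [gm]; no
   other term contributes to this entry. *)
have [p [p1 p2]] : exists p, b1 p = b1 gM + m%:Z - (b1 sm - b1 gm) /\ b2 p = b2 gM.
  by apply: (row_gapfree x1 x2 row_conn (i' := sM)); rewrite ?gM2 ?sM2 //; lia.
have [d ed] : exists d : nat, b1 sm - b1 gm = d%:Z by exists `|b1 sm - b1 gm|%N; lia.
have dm : (m - d < m.+1)%N by lia.
have : X p gm = 0 by rewrite X0 mxE.
rewrite XE (bigD1 (Ordinal dm)) //= big1 ?addr0 => [|i ne].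
  move/eqP; rewrite mulf_eq0 => /orP[]; apply: contraTT => _; apply: row_pow; rewrite ?gm2 ?sm2 //; lia.
apply/eqP; apply: contraNT ne; rewrite mulf_eq0 negb_or => /andP[/xpow[a1 _] _].
by apply/eqP/val_inj => /=; lia.
Qed.

End TypeA.

(** * Pairs in gl_N *)

Section TypeARational.

Variables (F : fieldType) (N : nat).

(** Weights congruent to [w i0] modulo integers form a class closed under x and y. As labellings are
    trivial, all weights differ by integers. *)
Lemma integral_part (w : 'I_N -> rat) i0 (a : 'M[F]_N) :
  raises 1 w a \/ keeps w a ->
  keeps (fun k => if w k - w i0 \is a Num.int then 1 else 0 : int) a.
Proof.
move=> wa p q apq; case: wa => /(_ _ _ apq) -> //.
by rewrite addrAC rpredDr ?int_num1.
Qed.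

Lemma dim_diag_ge : (N <= \dim (supp F [rel i j : 'I_N | i == j]))%N.
Proof.
rewrite -[leqLHS]card_ord.
apply: (@dim_ge_entries _ _ _ (fun i => (i, i)) _ (fun i => delta_mx i i)) => h.
  by apply/mem_supp => p q /delta_mx_neq0[-> ->] /=.
by move=> h'; rewrite mxE andbb eq_sym.
Qed.

(** The scalars add one dimension, so N + 1 here corresponds to rk + 1 in sl_N. Assuming this value
    gives the rigidity from which at most N follows. *)
Lemma dim_cent_gl (x y : 'M[F]_N) (w1 w2 : 'I_N -> rat) :
  raises 1 w1 x -> keeps w2 x -> keeps w1 y -> raises 1 w2 y ->
  x *m y = y *m x -> \dim (cent x :&: cent y) <> N.+1.
Proof.
move=> x1 x2 y1 y2 xyC dimZ.
have cent2E : cent2 x y fullv = (cent x :&: cent y)%VS by rewrite /cent2 capfv.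
have Uf a (X : 'M[F]_N) : X \in fullv -> brk a X \in fullv by rewrite !memvf.
have le_quad : (\dim (deg00 w1 w2 (@fullv F 'M_N)) <= N.+1)%N.
  rewrite -dimZ -cent2E; apply: leq_trans (dim_quad_le ltr01 x1 x2 y1 y2 xyC (Uf x) (Uf y)) _.
  by apply: dimvS; apply/subvP => X; rewrite mem_quad => /and3P[].
have diag_le : (supp F [rel i j : 'I_N | i == j] <= deg00 w1 w2 (@fullv F 'M_N))%VS.
  apply/subvP => X /mem_supp Xd; rewrite /deg00 !memv_cap memvf.
  by apply/andP; split; apply/mem_supp => i j /Xd /eqP ->; rewrite /deg_eq /= subrr.
have diag_ge : (N <= \dim (deg00 w1 w2 (@fullv F 'M_N)))%N.
  have := dim_diag_ge; have := dimvS diag_le; lia.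
have thin i j : w1 i = w1 j -> w2 i = w2 j -> i = j.
  (* E_(i, j) and E_(j, i) would be two elements of degree 0 outside the diagonal, already giving N
     + 2. *)
  move=> e1 e2; apply/eqP; apply: contraT => ij.
  have := @dim_add2 _ _ _ (deg00 w1 w2 fullv) (delta_mx i j) (delta_mx j i) i j j i diag_le.
  have memd p q : w1 p = w1 q -> w2 p = w2 q ->
      (delta_mx p q : 'M[F]_N) \in deg00 w1 w2 (@fullv F 'M_N).
    move=> f1 f2; rewrite /deg00 !memv_cap memvf.
    by apply/andP; split; apply/mem_supp => a b /delta_mx_neq0[-> ->]; rewrite /deg_eq /= ?f1 ?f2 subrr.
  rewrite !mxE !eqxx [j == i]eq_sym !(negPf ij) oner_neq0 /= => h.
  have : (\dim (supp F [rel i j : 'I_N | i == j]) + 2 <= \dim (deg00 w1 w2 (@fullv F 'M_N)))%N.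
    apply: h => //; try exact: memd.
    move=> Y /mem_supp Yd; split; apply/eqP; apply: contraT => /Yd /=; last by rewrite eq_sym (negPf ij).
    by rewrite (negPf ij).
  have := dim_diag_ge; lia.
have deg00_diag : (deg00 w1 w2 (@fullv F 'M_N) <= supp F [rel i j : 'I_N | i == j])%VS.
  apply/subvP => X; rewrite /deg00 !memv_cap => /andP[/andP[_ /mem_supp X1] /mem_supp X2].
  apply/mem_supp => i j Xij; apply/eqP; apply: thin; apply/eqP; rewrite -subr_eq0.
    exact: X1.
  exact: X2.
have conn0 (c : 'I_N -> int) : keeps c x -> keeps c y -> forall i j, c i = c j.
  move=> cx cy i j; apply/eqP; apply: contraT => cij.
  have : (\dim (deg00 w1 w2 (@fullv F 'M_N)) + 2 <= \dim (cent2 x y (@fullv F 'M_N)))%N.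
    apply: (@dim_label _ _ _ 1 ltr01 w1 w2 x y x1 x2 y1 y2 xyC fullv (Uf x) (Uf y)
        c (c i - c j) (delta_mx i j) (delta_mx j i)) => //; rewrite ?memvf ?subr_eq0 //.
    - apply: subv_trans deg00_diag _; apply/subvP => X /mem_supp Xd.
      by apply/mem_supp => p q /Xd /= /eqP ->.
    - by apply/mem_supp => p q /delta_mx_neq0[-> ->] /=; rewrite addrC subrK.
    - by apply/mem_supp => p q /delta_mx_neq0[-> ->] /=; rewrite opprB addrC subrK.
    - by apply/eqP => /matrixP/(_ i j)/eqP; rewrite !mxE !eqxx oner_eq0.
    - by apply/eqP => /matrixP/(_ j i)/eqP; rewrite !mxE !eqxx oner_eq0.
  by rewrite cent2E dimZ; lia.
suff le_N : (\dim (cent x :&: cent y) <= N)%N.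
  by move: dimZ; lia.
have [N0|[i0 _]] : N = 0%N \/ exists i0 : 'I_N, true.
  by case: (N) => [|n]; [left|right; exists ord0].
  rewrite -[leqRHS]card_ord; apply: (@dim_le_entries _ _ _ (fun i => (i, i))) => X _ _.
  by apply/matrixP => -[k k_lt]; exfalso; move: k_lt; rewrite N0.
have [b1 b1E] : exists b1 : 'I_N -> int, forall k, w1 k - w1 i0 = (b1 k)%:~R.
  exists (fun k => Num.floor (w1 k - w1 i0)) => k; rewrite floorK //.
  have := conn0 _ (integral_part i0 (or_introl x1)) (integral_part i0 (or_intror y1)) k i0.
  by rewrite subrr rpred0; case: ifP.
have [b2 b2E] : exists b2 : 'I_N -> int, forall k, w2 k - w2 i0 = (b2 k)%:~R.
  exists (fun k => Num.floor (w2 k - w2 i0)) => k; rewrite floorK //.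
  have := conn0 _ (integral_part i0 (or_intror x2)) (integral_part i0 (or_introl y2)) k i0.
  by rewrite subrr rpred0; case: ifP.
have raise (w : 'I_N -> rat) (b : 'I_N -> int) a :
    (forall k, w k - w i0 = (b k)%:~R) -> raises 1 w a -> raises 1 b a.
  move=> wb wa i j /wa wij; apply: (@intr_inj rat).
  by rewrite -wb wij addrAC wb intrD.
have keep (w : 'I_N -> rat) (b : 'I_N -> int) a :
    (forall k, w k - w i0 = (b k)%:~R) -> keeps w a -> keeps b a.
  by move=> wb wa i j /wa wij; apply: (@intr_inj rat); rewrite -!wb wij.
have lt_b (w : 'I_N -> rat) (b : 'I_N -> int) i j :
    (forall k, w k - w i0 = (b k)%:~R) -> (b i < b j) = (w i < w j).
  by move=> wb; rewrite -(ltr_int rat) -!wb ltrD2r.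
have le_b (w : 'I_N -> rat) (b : 'I_N -> int) i j :
    (forall k, w k - w i0 = (b k)%:~R) -> (b i <= b j) = (w i <= w j).
  by move=> wb; rewrite -(ler_int rat) -!wb lerD2r.
have eq_b (w : 'I_N -> rat) (b : 'I_N -> int) i j :
    (forall k, w k - w i0 = (b k)%:~R) -> b i = b j -> w i = w j.
  by move=> wb bij; apply: (addIr (- w i0)); rewrite !wb bij.
have [noP|noQ] : 
    (forall X, X \in cent2 x y fullv -> X \in supp F (quadP w1 w2) -> X = 0) \/
    (forall X, X \in cent2 x y fullv -> X \in supp F (quadQ w1 w2) -> X = 0).
  apply: (quadP_or_quadQ ltr01 x1 x2 y1 y2 xyC (Uf x) (Uf y)).
  by rewrite cent2E dimZ; apply: leq_trans (leq_add diag_ge (leqnn 2)); rewrite addn2.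
- apply: (@dim_cent_gl_int _ _ x y b1 b2) => //.
  + exact: raise x1.
  + exact: keep x2.
  + exact: keep y1.
  + exact: raise y2.
  + by move=> i j /(eq_b _ _ _ _ b1E) e1 /(eq_b _ _ _ _ b2E) e2; apply: thin.
  move=> X xX /mem_supp XP.
  apply: (no_quadP ltr01 y1 y2 xyC (Uf y) noP) xX _; rewrite ?memvf //.
  apply/mem_supp => i j /XP.
  by rewrite /quadP /= (lt_b _ _ _ _ b1E) (le_b _ _ _ _ b2E).
rewrite capvC; apply: (@dim_cent_gl_int _ _ y x b2 b1) => //.
+ exact: raise y2.
+ exact: keep y1.
+ exact: keep x2.
+ exact: raise x1.
+ by move=> i j /(eq_b _ _ _ _ b2E) e2 /(eq_b _ _ _ _ b1E) e1; apply: thin.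
+ move=> X yX /mem_supp XP.
  apply: (@no_quadP _ _ _ 1 ltr01 w2 w1 y x x2 x1 _ fullv (Uf x)) yX _; rewrite ?memvf //.
    move=> Y; rewrite mem_cent2 => /and3P[YU yY xY]; apply: noQ.
    by rewrite mem_cent2 YU xY.
  apply/mem_supp => i j /XP.
  by rewrite /quadP /= (lt_b _ _ _ _ b2E) (le_b _ _ _ _ b1E).
+ by move=> c cy cx; apply: conn0.
Qed.

End TypeARational.

(** * The orthogonal Lie algebra *)

Section Orthogonal.

Variables (F : fieldType) (N n : nat) (st : 'I_N -> 'I_N).
Hypotheses (stK : involutive st) (st_neq : forall i, st i != i).
Hypotheses (N2n : N = n.*2) (two_neq0 : 2%:R != 0 :> F).
Implicit Types (X Y : 'M[F]_N) (u v : 'cV[F]_N).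

(* The adjoint with respect to the form pairing e_i with e_(st i). *)
Definition dag X : 'M[F]_N := \matrix_(i, j) X (st j) (st i).

Lemma dag_mul X Y : dag (X *m Y) = dag Y *m dag X.
Proof.
apply/matrixP => i j; rewrite !mxE (reindex_inj (inv_inj stK)).
by apply: eq_bigr => k _; rewrite !mxE mulrC.
Qed.

Lemma dagB X Y : dag (X - Y) = dag X - dag Y.
Proof. by apply/matrixP => i j; rewrite !mxE. Qed.

Lemma dagN X : dag (- X) = - dag X.
Proof. by apply/matrixP => i j; rewrite !mxE. Qed.

Definition dag_diff (e : F) X := dag X - e *: X.

Fact dag_diff_is_linear e : linear (dag_diff e).
Proof. by move=> c X Y; apply/matrixP => i j; rewrite !mxE; ring. Qed.
HB.instance Definition _ e :=
  GRing.isLinear.Build F 'M[F]_N 'M[F]_N *:%R (dag_diff e) (dag_diff_is_linear e).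

(** Both signs at once: -1 gives the orthogonal Lie algebra, 1 the symmetric matrices, which form a
    module over it. *)
Definition dagsub e : {vspace 'M[F]_N} :=
  locked_with subspace_key (lker (linfun (dag_diff e))).

Lemma mem_dagsub e X : (X \in dagsub e) = (dag X == e *: X).
Proof. by rewrite [dagsub e]unlock memv_ker lfunE /= subr_eq0. Qed.

Notation so := (dagsub (-1)).
Notation sym := (dagsub 1).

Lemma mem_so X : (X \in so) = (dag X == - X).
Proof. by rewrite mem_dagsub scaleN1r. Qed.

Lemma mem_sym X : (X \in sym) = (dag X == X).
Proof. by rewrite mem_dagsub scale1r. Qed.

Lemma brk_dagsub e a X : dag a = - a -> X \in dagsub e -> brk a X \in dagsub e.
Proof.
rewrite !mem_dagsub => aN /eqP dX.
rewrite /brk dagB !dag_mul aN dX scalerBr scalemxAr scalemxAl.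
by rewrite mulNmx mulmxN opprK addrC.
Qed.

Lemma so_st X i j : X \in so -> X i j = - X (st j) (st i).
Proof.
by rewrite mem_so => /eqP/matrixP/(_ (st j) (st i)); rewrite !mxE !stK => ->.
Qed.

Lemma dag_delta p q : dag (delta_mx p q) = delta_mx (st q) (st p).
Proof. by apply/matrixP => i j; rewrite !mxE !(can2_eq stK stK) andbC. Qed.

Lemma dagK X : dag (dag X) = X.
Proof. by apply/matrixP => i j; rewrite !mxE !stK. Qed.

Lemma skew_so X : X - dag X \in so.
Proof. by rewrite mem_so dagB dagK opprB. Qed.

Lemma skew_delta_supp (m : rel 'I_N) p q : m p q -> m (st q) (st p) ->
  delta_mx p q - dag (delta_mx p q) \in supp F m.
Proof.
move=> m1 m2; rewrite dag_delta.
by apply: rpredB; apply/mem_supp => i j /delta_mx_neq0[-> ->].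
Qed.

Lemma eq_opp_0 (a : F) : a = - a -> a = 0.
Proof.
move=> aN; apply/eqP; have : a + a == 0 by rewrite {1}aN addNr.
by rewrite -mulr2n -mulr_natl mulf_eq0 (negPf two_neq0).
Qed.

(** The position (st i, i) is its own mirror image. For this reason a pair o, st o of weight 0 adds
    nothing to the skew part of degree 0, but adds two dimensions to the symmetric part. *)
Lemma so_st_diag X i : X \in so -> X (st i) i = 0.
Proof. by move=> Xso; apply: eq_opp_0; rewrite {1}(so_st _ _ Xso) stK. Qed.

Lemma so_sym_disjoint X : X \in so -> X \in sym -> X = 0.
Proof.
rewrite mem_so mem_sym => /eqP -> /eqP/matrixP XN.
by apply/matrixP => i j; have := XN i j; rewrite !mxE => /esym/eq_opp_0.
Qed.

Definition halfset := [set i : 'I_N | (i < st i)%N].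

Lemma card_half : #|halfset| = n.
Proof.
have : (#|halfset| + #|~: halfset| = N)%N by rewrite cardsC card_ord.
have -> : ~: halfset = st @: halfset.
  apply/setP => i; rewrite -{2}[i]stK (mem_imset _ _ (inv_inj stK)) !inE stK.
  by rewrite -leqNgt leq_eqVlt (inj_eq val_inj) (negPf (st_neq i)).
rewrite card_imset; last exact: inv_inj.
by rewrite addnn; move: N2n; lia.
Qed.

(** The bivector of u and v, under the identification of the second exterior power of V with the
    orthogonal algebra: e_i and e_j give E_(i, st j) - E_(j, st i). *)
Definition wedge u v : 'M[F]_N :=
  \matrix_(i, j) (u i 0 * v (st j) 0 - v i 0 * u (st j) 0).

Lemma wedge_so u v : wedge u v \in so.
Proof. by rewrite mem_so; apply/eqP/matrixP=> i j; rewrite !mxE !stK; ring. Qed.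

Lemma brk_wedge a u v : dag a = - a ->
  brk a (wedge u v) = wedge (a *m u) v + wedge u (a *m v).
Proof.
move=> /matrixP aN; apply/matrixP => i j; rewrite !mxE.
have e1 : \sum_k a i k * wedge u v k j =
    (\sum_k a i k * u k 0) * v (st j) 0 - (\sum_k a i k * v k 0) * u (st j) 0.
  by rewrite !mulr_suml -sumrB; apply: eq_bigr => k _; rewrite !mxE; ring.
have e2 : \sum_k wedge u v i k * a k j =
    - (u i 0 * \sum_k a (st j) k * v k 0) + v i 0 * \sum_k a (st j) k * u k 0.
  rewrite !mulr_sumr -sumrN -big_split /= (reindex_inj (inv_inj stK)) /=.
  apply: eq_bigr => k _; rewrite !mxE stK.
  have := aN (st j) k; rewrite !mxE stK => ->; ring.
rewrite e1 e2; ring.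
Qed.

Lemma wedge_neq0 u v a b : u a 0 != 0 -> v b 0 != 0 ->
  u b 0 = 0 \/ v a 0 = 0 -> wedge u v != 0.
Proof.
move=> ua vb uv0; apply/eqP => /matrixP/(_ a (st b)); rewrite !mxE stK => /eqP.
have -> : v a 0 * u b 0 = 0 by case: uv0 => ->; rewrite ?mulr0 ?mul0r.
by rewrite subr0 mulf_eq0 (negPf ua) (negPf vb).
Qed.

Lemma dim_dag_diag e : e = 1 \/ e = -1 ->
  (n <= \dim (dagsub e :&: supp F [rel i j : 'I_N | i == j]))%N.
Proof.
move=> e1; have ee : e * e = 1 by case: e1 => ->; rewrite ?mulrNN mul1r.
rewrite -[leqLHS]card_half -[leqLHS]card_ord.
pose v (h : 'I_#|halfset|) := enum_val h.
apply: (@dim_ge_entries _ _ _ (fun h => (v h, v h)) _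
  (fun h => delta_mx (v h) (v h) + e *: delta_mx (st (v h)) (st (v h)))) => [h|h h'].
  rewrite memv_cap mem_dagsub; apply/andP; split.
    apply/eqP/matrixP => i j; rewrite !mxE !(can2_eq stK stK) !stK.
    by rewrite ![(j == _) && _]andbC mulrDr mulrA ee mul1r addrC.
  by apply: rpredD; last apply: rpredZ; apply/mem_supp => i j /delta_mx_neq0[-> ->] /=.
have hv : v h \in halfset := enum_valP h; have hv' : v h' \in halfset := enum_valP h'.
rewrite !mxE !andbb (inj_eq enum_val_inj) [h == h']eq_sym.
have -> : v h' == st (v h) = false.
  by apply/eqP => eh; move: hv hv'; rewrite !inE eh stK; lia.
by rewrite mulr0 addr0.
Qed.

Section Grading.

Variables (R : realDomainType) (s : R) (w1 w2 : 'I_N -> R) (x y : 'M[F]_N).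
Hypothesis s_gt0 : 0 < s.
Hypotheses (w1st : forall i, w1 (st i) = - w1 i) (w2st : forall i, w2 (st i) = - w2 i).
Hypotheses (x1 : raises s w1 x) (x2 : keeps w2 x).
Hypotheses (y1 : keeps w1 y) (y2 : raises s w2 y).
Hypotheses (xyC : x *m y = y *m x) (xN : dag x = - x) (yN : dag y = - y).
Hypothesis n_gt1 : (1 < n)%N.

Lemma dim_so_diag : (n <= \dim (so :&: supp F [rel i j : 'I_N | i == j]))%N.
Proof. by apply: dim_dag_diag; right. Qed.

Notation D00 := (deg00 w1 w2 so).
Notation Z := (cent2 x y so).

Lemma so_brk_x X : X \in so -> brk x X \in so. Proof. exact: brk_dagsub. Qed.
Lemma so_brk_y X : X \in so -> brk y X \in so. Proof. exact: brk_dagsub. Qed.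

Lemma diag_deg00 : (so :&: supp F [rel i j : 'I_N | i == j] <= D00)%VS.
Proof.
apply/subvP => X; rewrite /deg00 !memv_cap => /andP[-> /mem_supp Xd].
by apply/andP; split; apply/mem_supp => i j /Xd /eqP ->; rewrite /deg_eq /= subrr.
Qed.

Lemma so_dim_deg00 : (n <= \dim D00)%N.
Proof. exact: leq_trans dim_so_diag (dimvS diag_deg00). Qed.

Hypothesis small : (\dim Z < n.+2)%N.

(** Otherwise the skew parts of E_(i, j) and E_(j, i) are two further elements of degree 0. The case
    j = st i escapes, because the skew part of E_(i, st i) is 0. *)
Lemma so_thin i j : w1 i = w1 j -> w2 i = w2 j -> j = i \/ j = st i.
Proof.
move=> e1 e2; have [->|ji] := eqVneq j i; first by left.
have [->|jsi] := eqVneq j (st i); first by right.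
suff : (n + 2 <= \dim Z)%N by lia.
apply: leq_trans (leq_trans (leq_add dim_so_diag (leqnn 2)) _)
  (leq_trans (dim_quad_le s_gt0 x1 x2 y1 y2 xyC so_brk_x so_brk_y) _); last first.
  by apply: dimvS; apply/subvP => X; rewrite mem_quad => /and3P[].
have memd p q : w1 p = w1 q -> w2 p = w2 q ->
    delta_mx p q - dag (delta_mx p q) \in D00.
  move=> f1 f2; rewrite /deg00 !memv_cap skew_so /=.
  by apply/andP; split; apply: skew_delta_supp;
     rewrite /deg_eq /= ?w1st ?w2st ?f1 ?f2 subrr.
apply: (@dim_add2 _ _ _ _ (delta_mx i j - dag (delta_mx i j))
  (delta_mx j i - dag (delta_mx j i)) i j j i) => //.
- exact: diag_deg00.
- exact: memd.
- exact: memd.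
- move=> Y; rewrite memv_cap => /andP[_ /mem_supp Yd].
  split; apply/eqP; apply: contraT => /Yd /=; first by rewrite eq_sym (negPf ji).
  by rewrite (negPf ji).
- rewrite dag_delta !mxE !eqxx [i == st j]eq_sym (can2_eq stK stK) (negPf jsi).
  by rewrite subr0 oner_neq0.
- by rewrite dag_delta !mxE (negPf ji) [j == st j]eq_sym (negPf (st_neq j)) subr0.
- rewrite dag_delta !mxE !eqxx (negPf jsi) subr0 oner_neq0 //.
Qed.

Lemma so_deg00_diag : (D00 <= supp F [rel i j : 'I_N | i == j])%VS.
Proof.
apply/subvP => X; rewrite /deg00 !memv_cap => /andP[/andP[Xso /mem_supp X1] /mem_supp X2].
apply/mem_supp => i j Xij.
have [||->|e] := @so_thin i j; rewrite /= ?eqxx //.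
- by apply/eqP; rewrite -subr_eq0; apply: X1.
- by apply/eqP; rewrite -subr_eq0; apply: X2.
by move: Xij; rewrite e -{1}[i]stK so_st_diag ?eqxx.
Qed.

(** A nonzero value at i gives some k outside {i, st i}, possibly after replacing k by st k, with
    another label; the skew parts of E_(i, k) and E_(k, i) then have opposite nonzero label
    differences. Their adjoint terms have the same difference because [c] is odd. *)
Lemma so_label (c : 'I_N -> int) : (forall i, c (st i) = - c i) ->
  keeps c x -> keeps c y -> forall i, c i = 0.
Proof.
move=> cst cx cy i; apply/eqP; apply: contraT => ci.
have [k [ki ksi]] : exists k, k != i /\ k != st i.
  have : (2 < #|'I_N|)%N by rewrite card_ord; lia.
  move=> gt2; have : ~~ ([set: 'I_N] \subset [set i; st i]).
    apply: contraL gt2 => /subset_leq_card; rewrite cardsT cards2 -leqNgt.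
    by move=> /leq_trans; apply; case: (_ != _).
  by case/subsetPn => k _; rewrite !inE negb_or => /andP[? ?]; exists k.
wlog ck : k ki ksi / c i != c k.
  move=> hw; have [e|] := eqVneq (c i) (c k); last exact: hw.
  apply: (hw (st k)).
  - by rewrite (can2_eq stK stK).
  - by rewrite (inj_eq (inv_inj stK)).
  by rewrite cst -e; move: ci; lia.
have : (\dim D00 + 2 <= \dim Z)%N.
  apply: (dim_label s_gt0 x1 x2 y1 y2 xyC so_brk_x so_brk_y cx cy _ _
    (skew_so (delta_mx i k)) (skew_so (delta_mx k i)) (l := c i - c k)).
  - apply: subv_trans so_deg00_diag _; apply/subvP => X /mem_supp Xd.
    by apply/mem_supp => p q /Xd /= /eqP ->.
  - by rewrite subr_eq0.
  - by apply: skew_delta_supp => /=; rewrite ?cst; lia.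
  - by apply: skew_delta_supp => /=; rewrite ?cst; lia.
  - apply/eqP => /matrixP/(_ i k)/eqP; rewrite dag_delta !mxE !eqxx.
    by rewrite [i == st k]eq_sym (can2_eq stK stK) (negPf ksi) subr0 oner_eq0.
  - apply/eqP => /matrixP/(_ k i)/eqP; rewrite dag_delta !mxE !eqxx.
    by rewrite (negPf ksi) subr0 oner_eq0.
by have := so_dim_deg00; lia.
Qed.

Lemma so_cross (T : eqType) (c : 'I_N -> T) t X1 X2 i1 j1 i2 j2 :
  keeps c x -> keeps c y ->
  let K := (so :&: cent x :&: supp F [rel i j | c i != c j]
              :&: supp F (deg_eq w2 t))%VS in
  X1 \in K -> X2 \in K -> X1 i1 j1 != 0 -> X1 i2 j2 = 0 -> X2 i2 j2 != 0 -> False.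
Proof.
move=> cx cy K X1K X2K X11 X12 X22.
have : (\dim D00 + 2 <= \dim Z)%N.
  apply: (dim_cross s_gt0 x1 x2 y1 y2 xyC so_brk_x so_brk_y cx cy _ X1K X2K X11 X12 X22).
  apply: subv_trans so_deg00_diag _; apply/subvP => X /mem_supp Xd.
  by apply/mem_supp => p q /Xd /= /eqP ->.
by have := so_dim_deg00; lia.
Qed.

Lemma so_quadP_or_quadQ :
  (forall X, X \in Z -> X \in supp F (quadP w1 w2) -> X = 0) \/
  (forall X, X \in Z -> X \in supp F (quadQ w1 w2) -> X = 0).
Proof.
apply: (quadP_or_quadQ s_gt0 x1 x2 y1 y2 xyC so_brk_x so_brk_y).
by have := so_dim_deg00; lia.
Qed.

End Grading.
End Orthogonal.

(** * Orthogonal pairs with integral weights *)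

Section OrthogonalNoP.

Variables (F : fieldType) (N n : nat) (st : 'I_N -> 'I_N).
Hypotheses (stK : involutive st) (st_neq : forall i, st i != i).
Hypotheses (N2n : N = n.*2) (two_neq0 : 2%:R != 0 :> F) (n_gt1 : (1 < n)%N).
Implicit Types (X Y : 'M[F]_N) (u v : 'cV[F]_N).

Notation dag := (@dag F N st).
Notation so := (@dagsub F N st (-1)).
Notation sym := (@dagsub F N st 1).
Notation wedge := (@wedge F N st).

(* The weights are doubled, so that they are integers and x, y have degree 2. *)
Variables (d1 d2 : 'I_N -> int) (x y : 'M[F]_N).
Hypotheses (d1st : forall i, d1 (st i) = - d1 i) (d2st : forall i, d2 (st i) = - d2 i).
Hypotheses (x1 : raises 2 d1 x) (x2 : keeps d2 x).
Hypotheses (y1 : keeps d1 y) (y2 : raises 2 d2 y).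
Hypotheses (xyC : x *m y = y *m x) (xN : dag x = - x) (yN : dag y = - y).

Notation Z := (cent2 x y so).
Hypothesis small : (\dim Z < n.+2)%N.
Hypothesis noP : forall X, X \in Z -> X \in supp F (quadP d1 d2) -> X = 0.

Let two_gt0 : 0 < 2 :> int. Proof. by []. Qed.

Lemma thin_nz i j : d1 i != 0 \/ d2 i != 0 -> d1 i = d1 j -> d2 i = d2 j -> i = j.
Proof.
move=> nz e1 e2.
have [->|ji] // := so_thin stK st_neq N2n two_neq0 two_gt0 d1st d2st x1 x2 y1 y2
  xyC xN yN n_gt1 small e1 e2.
by move: e1 e2 nz; rewrite ji d1st d2st; lia.
Qed.

Lemma so_label0 (c : 'I_N -> int) : (forall i, c (st i) = - c i) ->
  keeps c x -> keeps c y -> forall i, c i = 0.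
Proof.
exact: (so_label stK st_neq N2n two_neq0 two_gt0 d1st d2st x1 x2 y1 y2 xyC xN yN
  n_gt1 small).
Qed.

Lemma so_noP X : X \in so -> brk x X = 0 -> X \in supp F (quadP d1 d2) -> X = 0.
Proof.
apply: (no_quadP two_gt0 y1 y2 xyC _ noP) => Y.
exact: brk_dagsub.
Qed.

(** A bivector of vectors of weights a and b has degree a + b, since passing to the column index
    dualizes a weight. So bivectors of degree (< 0, >= 0) commuting with x vanish; this is the main
    test in what follows. *)
Lemma wedge_vanish u v (a1 a2 b1 b2 : int) :
  (forall i, u i 0 != 0 -> d1 i = a1 /\ d2 i = a2) ->
  (forall i, v i 0 != 0 -> d1 i = b1 /\ d2 i = b2) ->
  a1 + b1 < 0 -> 0 <= a2 + b2 ->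
  wedge (x *m u) v + wedge u (x *m v) = 0 -> wedge u v = 0.
Proof.
move=> uw vw lt1 le2 xuv; apply: so_noP; first exact: wedge_so.
  by rewrite brk_wedge.
apply/mem_supp => i j; rewrite mxE => w0; rewrite /quadP /=.
have [uv0|] := eqVneq (u i 0 * v (st j) 0) 0.
  move: w0; rewrite uv0 sub0r oppr_eq0 mulf_eq0 negb_or.
  by case/andP => /vw[-> ->] /uw; rewrite d1st d2st; lia.
by rewrite mulf_eq0 negb_or => /andP[/uw[-> ->] /vw]; rewrite d1st d2st; lia.
Qed.

Lemma mul_col0 i : (forall k, x k i = 0) -> x *m delta_mx i (0 : 'I_1) = 0.
Proof.
move=> xi; apply/matrixP => k l; rewrite ord1 -[_ *m _]mul1mx mulmxA mul1mx mxE.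
rewrite (bigD1 i) //= big1 ?addr0 => [|m mi]; first by rewrite xi mul0r mxE.
by rewrite [X in _ * X]mxE (negPf mi) mulr0.
Qed.

Lemma wedge0l v : wedge 0 v = 0.
Proof. by apply/matrixP => i j; rewrite !mxE; ring. Qed.

Lemma wedge0r u : wedge u 0 = 0.
Proof. by apply/matrixP => i j; rewrite !mxE; ring. Qed.

Lemma delta_col_neq0 i k : (delta_mx i (0 : 'I_1) : 'cV[F]_N) k 0 != 0 -> k = i.
Proof. by rewrite mxE andbT; case: (eqVneq k i) => // _; rewrite eqxx. Qed.

(** Two basis vectors killed by x have a bivector that commutes with x. *)
Lemma soc_pair i j : i != j -> (forall k, x k i = 0) -> (forall k, x k j = 0) ->
  0 <= d2 i + d2 j -> 0 <= d1 i + d1 j.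
Proof.
move=> ij xi xj le2; rewrite leNgt; apply/negP => lt1.
have : wedge (delta_mx i (0 : 'I_1)) (delta_mx j 0) != 0.
  apply: (@wedge_neq0 _ _ _ stK _ _ i j); rewrite !mxE ?eqxx ?oner_neq0 //.
  by rewrite eq_sym (negPf ij); left.
rewrite (@wedge_vanish _ _ (d1 i) (d2 i) (d1 j) (d2 j)) ?eqxx //.
- by move=> k /delta_col_neq0 ->.
- by move=> k /delta_col_neq0 ->.
by rewrite !mul_col0 // wedge0l wedge0r addr0.
Qed.

Lemma x_st i j : x (st i) (st j) = - x j i.
Proof. by move: xN => /matrixP/(_ j i); rewrite !mxE. Qed.

Lemma y_st i j : y (st i) (st j) = - y j i.
Proof. by move: yN => /matrixP/(_ j i); rewrite !mxE. Qed.

(** If x kills e_i and k is the next vector of its row and parity, then x kills e_(st k) too: by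
    skewness an arrow out of st k is an arrow into k, which could only start at i. The bivector of
    e_i and e_(st k), of degree (< 0, 0), contradicts [soc_pair]. *)
Lemma row_connected i i' : d2 i != 0 -> d2 i = d2 i' -> d1 i < d1 i' ->
  (2 %| d1 i' - d1 i)%Z -> exists j, x j i != 0.
Proof.
move=> nz e2 lt1 par; apply/existsP; apply: contraT => /existsPn xi.
pose k := [arg min_(k < i' | [&& d2 k == d2 i, d1 i < d1 k & (2 %| d1 k - d1 i)%Z]) d1 k]%O.
have [/and3P[/eqP k2 k1 kpar] kmin] : [&& d2 k == d2 i, d1 i < d1 k & (2 %| d1 k - d1 i)%Z]
    /\ forall j, [&& d2 j == d2 i, d1 i < d1 j & (2 %| d1 j - d1 i)%Z] -> d1 k <= d1 j.
  by rewrite /k; case: arg_minP; rewrite ?e2 ?eqxx ?par ?andbT.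
have xi0 l : x l i = 0 by apply/eqP; rewrite -[_ == _]negbK xi.
have : 0 <= d1 i + d1 (st k).
  apply: soc_pair => //; last by rewrite d2st; lia.
    by apply/eqP => e; move: k2 nz; rewrite e d2st; lia.
  move=> l; rewrite -[l]stK x_st; apply/eqP; rewrite oppr_eq0.
  apply: contraT => xkl; have := x1 xkl; have := x2 xkl => kl2 kl1.
  have [e|ne] := eqVneq (d1 (st l)) (d1 i).
    have el : i = st l by apply: thin_nz; [right| |lia].
    by move: xkl; rewrite -el xi0 eqxx.
  by have := kmin (st l); rewrite -kl2 k2 eqxx; lia.
by rewrite d1st; lia.
Qed.

(** Two parities in a row would give two strings there and two in the dual row. The bivectors of
    string ends that mix parities commute with x, but their first degree has no known sign, so they
    are counted by [so_cross] instead of being excluded by [so_noP]. *)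
Lemma row_parity i j : d2 i != 0 -> d2 i = d2 j -> (2 %| d1 i - d1 j)%Z.
Proof.
move=> nz e2; apply: contraT => par.
pose P k := [pred l | (d2 l == d2 k) && (2 %| d1 l - d1 k)%Z].
have Pk k : P k k by rewrite /P /= eqxx subrr.
pose m k := [arg max_(l > k | P k l) d1 l]%O.
have mP k : [/\ d2 (m k) = d2 k, (2 %| d1 (m k) - d1 k)%Z & forall l, x l (m k) = 0].
  rewrite /m; case: arg_maxP => // l /andP[/eqP l2 lpar] lmax; split=> // p.
  apply/eqP; apply: contraT => xpl; have := x1 xpl; have := x2 xpl => pl2 pl1.
  by have := lmax p; rewrite /P /= pl2 l2 eqxx /=; lia.
have [i2 ipar xi] := mP i; have [j2 jpar xj] := mP j.
have [si2 sipar xsi] := mP (st i); have [sj2 sjpar xsj] := mP (st j).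
rewrite !d1st !d2st in si2 sipar sj2 sjpar.
have mem p q : (2 %| d1 p - d1 q)%Z = false -> d2 p = - d2 q ->
   (forall l, x l p = 0) -> (forall l, x l q = 0) ->
   wedge (delta_mx p (0 : 'I_1)) (delta_mx q 0) \in
   (so :&: cent x :&: supp F [rel i j | (2 %| d1 i)%Z != (2 %| d1 j)%Z]
              :&: supp F (deg_eq d2 0%R))%VS.
  move=> pq1 pq2 xp xq; rewrite !memv_cap wedge_so // mem_cent brk_wedge //.
  rewrite !mul_col0 // wedge0l wedge0r addr0 eqxx /=.
  apply/andP; split; apply/mem_supp => a b; rewrite mxE => w0;
  (have [uv0|] := eqVneq ((delta_mx p (0 : 'I_1) : 'cV[F]_N) a 0 *
     (delta_mx q (0 : 'I_1) : 'cV[F]_N) (st b) 0) 0;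
  [move: w0; rewrite uv0 sub0r oppr_eq0|];
  rewrite mulf_eq0 negb_or => /andP[/delta_col_neq0 -> /delta_col_neq0 eb];
  rewrite /deg_eq /= -[b]stK eb ?d1st ?d2st; lia).
have kx : keeps (fun k => (2 %| d1 k)%Z) x by move=> a b /x1 ->; lia.
have ky : keeps (fun k => (2 %| d1 k)%Z) y by move=> a b /y1 ->.
have cross := so_cross stK st_neq N2n two_neq0 two_gt0 d1st d2st x1 x2 y1 y2 xyC xN yN
  n_gt1 small kx ky.
exfalso; apply: (cross 0 _ _ (m j) (st (m (st i))) (m i) (st (m (st j)))
  (mem (m j) (m (st i)) _ _ xj xsi) (mem (m i) (m (st j)) _ _ xi xsj));
  rewrite ?si2 ?sj2 ?i2 ?j2 ?e2 //; try lia.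
- rewrite !mxE !stK !eqxx.
  have /negPf -> : m j != m (st i) by apply/eqP => e; move: si2; rewrite -e; lia.
  by rewrite mul0r subr0 mulr1 oner_neq0.
- rewrite !mxE !stK !eqxx.
  have /negPf -> : m i != m j by apply/eqP => e; move: ipar; rewrite e; lia.
  have /negPf -> : m i != m (st i) by apply/eqP => e; move: si2; rewrite -e; lia.
  by rewrite !mul0r subr0.
rewrite !mxE !stK !eqxx.
have /negPf -> : m i != m (st j) by apply/eqP => e; move: sj2; rewrite -e; lia.
by rewrite mul0r subr0 mulr1 oner_neq0.
Qed.

(** If no arrow of y enters the row, then by skewness none leaves the dual row. The odd labelling by
    1 on the rows of this parity from this height up, by -1 on their duals and by 0 elsewhere is
    then kept by y. *)
Lemma row_link i : 0 < d2 i -> exists j k, y k j != 0 /\ d2 k = d2 i.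
Proof.
move=> pos; have [/existsP[j /existsP[k /andP[ykj /eqP e]]]|/existsPn y0] :=
  boolP [exists j, exists k, (y k j != 0) && (d2 k == d2 i)]; first by exists j, k.
have no_link j k : y k j != 0 -> d2 k != d2 i.
  by move=> ykj; have /existsPn/(_ k) := y0 j; rewrite ykj.
pose c k : int := if (d2 i <= d2 k) && (2 %| d2 k - d2 i)%Z then 1
  else if (d2 k <= - d2 i) && (2 %| d2 k - d2 i)%Z then -1 else 0.
suff : c i = 0 by rewrite /c lexx subrr.
apply: so_label0 => [k|p q /x2 e|p q ypq]; rewrite /c; last 1 first.
- have := y2 ypq; have := no_link _ _ ypq.
  have ypq' : y (st q) (st p) != 0 by rewrite y_st oppr_eq0.
  have := no_link _ _ ypq'; rewrite d2st => n1 n2 e.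
  by repeat (case: ifP => ?); lia.
- rewrite d2st; by repeat (case: ifP => ?); lia.
by rewrite e.
Qed.

Lemma pow_neq0 k i j : d2 i != 0 -> d2 j = d2 i -> d1 j = d1 i + 2 * k%:Z ->
  mxpow x k j i != 0.
Proof.
move=> nz e2 e1.
pose b l := ((d1 l - d1 i) %/ 2)%Z.
apply: (@mxpow_neq0 _ _ x b [pred l | d2 l == d2 i]); rewrite /= ?e2 ?eqxx //.
- move=> p q xpq; rewrite (x2 xpq) /b (x1 xpq); split=> //; lia.
- move=> p q /eqP p2 /eqP q2 pq; have := @row_parity p i; have := @row_parity q i.
  rewrite p2 q2 => /(_ nz erefl) qp /(_ nz erefl) pp; apply: thin_nz; rewrite ?p2 ?q2 //.
    by right.
  by move: pq; rewrite /b; lia.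
- move=> p q /eqP p2 /eqP q2 pq; have := @row_parity q p; rewrite p2 q2.
  move=> /(_ nz erefl) par; apply: (@row_connected p q); rewrite ?p2 ?q2 //.
  by move: pq; rewrite /b; lia.
by rewrite /b e1; lia.
Qed.

Lemma dag_pow k : dag (mxpow x k) = (-1) ^+ k *: mxpow x k.
Proof.
elim: k => [|k IHk].
  by rewrite scale1r; apply/matrixP=> i j; rewrite !mxE (inj_eq (inv_inj stK)) eq_sym.
rewrite mxpowS {1}mxpow_comm (dag_mul stK) IHk xN mulNmx -scalemxAr.
by rewrite exprS mulN1r scaleNr.
Qed.

Lemma pow_st k i j : mxpow x k (st i) (st j) = (-1) ^+ k * mxpow x k j i.
Proof. by move: (dag_pow k) => /matrixP/(_ j i); rewrite !mxE. Qed.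

Lemma pow_supp k i j : mxpow x k i j != 0 -> d1 i = d1 j + 2 * k%:Z /\ d2 i = d2 j.
Proof.
move=> xk; rewrite (mxpow_keeps x2 xk); split=> //.
by rewrite (mxpow_raises x1 xk) pmulrn mulrzz.
Qed.

Definition rmin i := [arg min_(k < i | d2 k == d2 i) d1 k]%O.
Definition rmax i := [arg max_(k > i | d2 k == d2 i) d1 k]%O.

Lemma rminP i : d2 (rmin i) = d2 i /\ forall j, d2 j = d2 i -> d1 (rmin i) <= d1 j.
Proof.
by rewrite /rmin; case: arg_minP => // k /eqP -> kmin; split=> // j /eqP /kmin.
Qed.

Lemma rmaxP i : d2 (rmax i) = d2 i /\ forall j, d2 j = d2 i -> d1 j <= d1 (rmax i).
Proof.
by rewrite /rmax; case: arg_maxP => // k /eqP -> kmax; split=> // j /eqP /kmax.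
Qed.

Lemma rmin_st i : d1 (rmin (st i)) = - d1 (rmax i).
Proof.
have [m2 mmin] := rminP (st i); have [M2 Mmax] := rmaxP i.
have := mmin (st (rmax i)); have := Mmax (st (rmin (st i))).
rewrite !d1st !d2st m2 M2 d2st opprK => /(_ erefl) + /(_ erefl); lia.
Qed.

(* The string through [g] paired with the string through [h]: in coordinates
   this is the bivector [\sum_k (-1)^k x^k g /\ x^(m-k) h]. *)
Definition string_sum m g h : 'M[F]_N :=
  \sum_(k < m.+1) mxpow x k *m delta_mx g (st h) *m mxpow x (m - k).

Lemma string_sumE m g h a b : string_sum m g h a b =
  \sum_(k < m.+1) mxpow x k a g * mxpow x (m - k) (st h) b.
Proof. by rewrite summxE; apply: eq_bigr => k _; rewrite mul_delta_mul. Qed.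

(** The width bounds make both ends of the telescoping sum vanish, so the string map and its adjoint
    commute with x; both have first degree d1 (rmin i) + d1 (rmin j) + 2m and second degree d2 i +
    d2 j. *)
Lemma string_sum_vanish m i j : d2 i != 0 -> d2 j != 0 ->
  d1 (rmax i) - d1 (rmin i) <= 2 * m%:Z -> d1 (rmax j) - d1 (rmin j) <= 2 * m%:Z ->
  d1 (rmin i) + d1 (rmin j) + 2 * m%:Z < 0 -> 0 <= d2 i + d2 j ->
  let X := string_sum m (rmin i) (rmin j) in X - dag X = 0.
Proof.
move=> i0 j0 mi mj lt1 le2 X.
have [gi2 _] := rminP i; have [gj2 _] := rminP j.
have [_ si] := rmaxP i; have [_ sj] := rmaxP j.
have xX : brk x X = 0.
  apply: brk_pow_sum; apply/eqP; apply: contraT => /entry_neq0[a [b]].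
    rewrite -[_ *m _]mulmx1 mul_delta_mul mulf_eq0 negb_or => /andP[/pow_supp[a1 a2] _].
    by have := si a; rewrite a2 gi2 => /(_ erefl); lia.
  rewrite -[_ *m _]mul1mx mulmxA mul_delta_mul mulf_eq0 negb_or -{1}[b]stK pow_st.
  rewrite [in X in _ && X]mulf_eq0 negb_or => /and3P[_ _ /pow_supp[a1 a2]].
  by have := sj (st b); rewrite a2 gj2 => /(_ erefl); lia.
have xdX : brk x (dag X) = 0.
  have : dag (brk x X) = brk x (dag X).
    by rewrite /brk dagB !(dag_mul stK) xN mulmxN mulNmx opprK addrC.
  by rewrite xX => <-; apply/matrixP => a b; rewrite !mxE.
have deg a b : X a b != 0 -> d1 a - d1 b < 0 /\ d2 a - d2 b >= 0.
  rewrite string_sumE => /sum_neq0[k]; rewrite mulf_eq0 negb_or.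
  rewrite -{1}[b]stK pow_st [in X in _ && X]mulf_eq0 negb_or.
  move=> /and3P[/pow_supp[a1 a2] _ /pow_supp[b1 b2]].
  move: b1 b2; rewrite d1st d2st a1 a2 gi2 gj2; case: k {a1} => k /= kl b1 b2; lia.
apply: so_noP; first exact: skew_so.
  by rewrite linearB /= xX xdX subr0.
apply/mem_supp => a b Xab; rewrite /quadP /=.
have [X0|/deg] := eqVneq (X a b) 0; last lia.
move: Xab; rewrite mxE X0 add0r mxE oppr_eq0 mxE => /deg; rewrite !d1st !d2st; lia.
Qed.

Lemma row_width i : d2 i != 0 -> exists m : nat, d1 (rmax i) - d1 (rmin i) = 2 * m%:Z.
Proof.
move=> i0; have [g2 gmin] := rminP i; have [s2 _] := rmaxP i.
have := gmin _ s2; have := @row_parity (rmax i) (rmin i); rewrite s2 g2 => /(_ i0 erefl).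
by exists (`|d1 (rmax i) - d1 (rmin i)| %/ 2)%N; lia.
Qed.

Lemma row_exists_at i k : d2 i != 0 -> 2 * k%:Z <= d1 (rmax i) - d1 (rmin i) ->
  exists a, d2 a = d2 i /\ d1 a = d1 (rmin i) + 2 * k%:Z.
Proof.
move=> i0; have [g2 gmin] := rminP i; have [s2 smax] := rmaxP i.
elim: k => [|k IHk] le_k; first by exists (rmin i); rewrite g2; split=> //; lia.
have [|a [a2 a1]] := IHk; first lia.
have [||||b xba] := @row_connected a (rmax i); rewrite ?a2 ?s2 //; first lia.
  by apply: row_parity; rewrite s2 ?a2.
by exists b; rewrite (x2 xba) (x1 xba) a1; split=> //; lia.
Qed.

(* If both sums were negative, the string sum, taken with the longer of the two
   lengths, would have degree (< 0, >= 0). *)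
Lemma rows_nested i j : d2 i != 0 -> d2 j != 0 -> d2 i != d2 j -> 0 <= d2 i + d2 j ->
  0 <= d1 (rmin i) + d1 (rmax j) \/ 0 <= d1 (rmax i) + d1 (rmin j).
Proof.
move=> i0 j0 ij le2.
have [Di eDi] := row_width i0; have [Dj eDj] := row_width j0.
have [//|lt1] := leP 0 (d1 (rmin i) + d1 (rmax j)); first by left.
have [//|lt2] := leP 0 (d1 (rmax i) + d1 (rmin j)); first by right.
pose m := maxn Di Dj; exfalso.
(* [a] is the right end of row i and [c] lies m - Di steps into row j. At (a, st c) only the term k
   = Di survives, and the adjoint contributes nothing because the rows differ. *)
have [|a [a2 a1]] := @row_exists_at i Di i0; first lia.
have [|c [c2 c1]] := @row_exists_at j (m - Di) j0; first by rewrite /m; lia.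
have h := @string_sum_vanish m i j i0 j0.
suff : string_sum m (rmin i) (rmin j) - dag (string_sum m (rmin i) (rmin j)) != 0.
  by rewrite h ?eqxx //; lia.
have [gi2 _] := rminP i; have [gj2 _] := rminP j.
apply/eqP => /matrixP/(_ a (st c)); rewrite !mxE stK !string_sumE => /eqP.
have Di_lt : (Di < m.+1)%N by rewrite /m; lia.
rewrite [X in _ - X]big1 ?subr0 => [|k _]; last first.
  apply/eqP; rewrite mulf_eq0; apply/orP; left; apply: contraT => /pow_supp[_].
  by rewrite c2 gi2 => e; move: ij; rewrite e eqxx.
rewrite (bigD1 (Ordinal Di_lt)) //= big1 ?addr0 => [|k kD]; last first.
  apply/eqP; rewrite mulf_eq0; apply/orP; left; apply: contraNT kD => /pow_supp[e _].
  by apply/eqP/val_inj => /=; lia.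
rewrite pow_st mulf_eq0 mulf_eq0 signr_eq0 /=; apply/negP; rewrite negb_or.
by rewrite !pow_neq0 ?gi2 ?gj2 // a1 ?c1.
Qed.

(** A row is paired with itself. Exchanging k and m - k makes the bivector sum cancel for even m and
    double for odd m, so m is the half-width D rounded up to an odd number. The rounding costs a
    slack of 2 in the bound on the sum of the two ends. A positive width ensures m - D <= D, so that
    the entry tested exists. *)
Lemma row_leaning i : 0 < d2 i -> d1 (rmin i) != d1 (rmax i) ->
  exists m : nat, [/\ odd m, 2 * m%:Z <= d1 (rmax i) - d1 (rmin i) + 2,
    d1 (rmax i) - d1 (rmin i) <= 2 * m%:Z & 0 <= d1 (rmin i) + m%:Z].
Proof.
move=> pos ne; have i0 : d2 i != 0 by lia.
have [D eD] := row_width i0.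
pose m := (D + ~~ odd D)%N; exists m.
have mo : odd m by rewrite /m; case: (boolP (odd D)) => //=; lia.
split=> //; rewrite /m; try by (case: (odd D) => /=; lia).
rewrite leNgt; apply/negP => lt1.
have D0 : (0 < D)%N by have [_ /(_ _ (proj1 (rminP i)))] := rmaxP i; lia.
have Dm : (D < m.+1)%N by rewrite /m; lia.
have mD : (m - D < m.+1)%N by lia.
have mDD : (m - D <= D)%N by rewrite /m; case: (odd D) => /=; lia.
have [a [a2 a1]] : exists a, d2 a = d2 i /\ d1 a = d1 (rmin i) + 2 * D%:Z.
  by apply: row_exists_at => //; lia.
have [c [c2 c1]] : exists a, d2 a = d2 i /\ d1 a = d1 (rmin i) + 2 * (m - D)%N%:Z.
  by apply: row_exists_at => //; lia.
have [gi2 _] := rminP i.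
have : string_sum m (rmin i) (rmin i) - dag (string_sum m (rmin i) (rmin i)) = 0.
  by apply: string_sum_vanish => //; rewrite ?/m; lia.
move/matrixP/(_ a (st c)); rewrite !mxE stK !string_sumE.
rewrite (bigD1 (Ordinal Dm)) //= big1 ?addr0 => [|k kD]; last first.
  apply/eqP; rewrite mulf_eq0; apply/orP; left; apply: contraNT kD => /pow_supp[e _].
  by apply/eqP/val_inj => /=; lia.
rewrite (bigD1 (Ordinal mD)) //= big1 ?addr0 => [|k kD]; last first.
  apply/eqP; rewrite mulf_eq0; apply/orP; left; apply: contraNT kD => /pow_supp[e _].
  by apply/eqP/val_inj => /=; lia.
rewrite subKn ?pow_st; last by lia.
have -> : (-1) ^+ (m - D) = - (-1) ^+ D :> F.
  by rewrite -signr_odd oddB ?mo; [rewrite -[(-1) ^+ D]signr_odd; case: (odd D); rewrite /= ?expr0 ?expr1 ?opprK|lia].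
set p := mxpow x D a _; set q := mxpow x (m - D) c _.
have p0 : p != 0 by apply: pow_neq0; rewrite ?gi2.
have q0 : q != 0 by apply: pow_neq0; rewrite ?gi2.
have -> : p * (- (-1) ^+ D * q) - q * ((-1) ^+ D * p) = - (2%:R * (-1) ^+ D * (p * q)).
  by ring.
move/eqP; rewrite oppr_eq0 !mulf_eq0 (negPf two_neq0) signr_eq0.
by rewrite (negPf p0) (negPf q0).
Qed.

(** * Without weight 0, the middle row is empty *)

Section NoZeroWeight.

Hypothesis no0 : forall i, d1 i = 0 -> d2 i <> 0.

(** Let i0 have the least positive weight of row 0. From st i0, x could only reach i0, and that
    entry is 0 by skewness. If e_j is the next vector left of st i0, then x e_j is a multiple of
    e_(st i0), so the bivector of the two commutes with x in degree (< 0, 0). *)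
Lemma row0_minimal i : d2 i = 0 -> exists i0,
  [/\ d2 i0 = 0, 0 < d1 i0, forall k, x k (st i0) = 0 &
      forall k, d2 k = 0 -> k = i0 \/ k = st i0].
Proof.
move=> i2; have [i' i'2 i'1] : exists2 i', d2 i' = 0 & 0 < d1 i'.
  have := @no0 i; have [lt|gt|-> /(_ erefl)//] := ltgtP (d1 i) 0 => _.
    by exists (st i); rewrite ?d1st ?d2st; lia.
  by exists i.
pose i0 := [arg min_(k < i' | (d2 k == 0) && (0 < d1 k)) d1 k]%O.
have [i02 i01 i0min] : [/\ d2 i0 = 0, 0 < d1 i0 &
    forall k, d2 k = 0 -> d1 i0 <= d1 k \/ d1 k <= - d1 i0].
  rewrite /i0; case: arg_minP; rewrite ?i'2 ?i'1 ?eqxx // => j /andP[/eqP j2 j1] jmin.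
  split=> // k k2; have := jmin k; have := jmin (st k); rewrite d1st d2st k2 oppr0 eqxx /=.
  have := no0 (i := k); rewrite k2; lia.
have x0 k : x k (st i0) = 0.
  apply/eqP; apply: contraT => xk.
  have := x1 xk; have := x2 xk; rewrite d1st d2st i02 oppr0 => k2 k1.
  have := i0min k k2; rewrite k1 => hk.
  have ek : k = i0 by apply: thin_nz => [||]; lia.
  have : x i0 (st i0) = 0.
    by rewrite -{1}[i0]stK; apply: (so_st_diag stK two_neq0); rewrite mem_so xN.
  by move: xk; rewrite ek => /eqP.
exists i0; split=> // k.
wlog k1 : k / d1 k <= - d1 i0.
  move=> hw k2; case: (i0min k k2) => [ge|]; last by move=> le; apply: hw.
  have [||e|e] := hw (st k); first by rewrite d1st; lia.
  - by rewrite d2st k2.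
  - by right; rewrite -e stK.
  by left; rewrite -[k]stK e stK.
move=> k2; have [lt1|ge1] := ltP (d1 k) (- d1 i0); last first.
  by right; apply: thin_nz; rewrite ?d1st ?d2st; lia.
exfalso.
pose j := [arg max_(l > k | (d2 l == 0) && (d1 l < - d1 i0)) d1 l]%O.
have [j2 j1 jmax] : [/\ d2 j = 0, d1 j < - d1 i0 &
    forall l, d2 l = 0 -> d1 l < - d1 i0 -> d1 l <= d1 j].
  rewrite /j; case: arg_maxP; rewrite ?k2 ?lt1 ?eqxx // => l /andP[/eqP l2 l1] lmax.
  by split=> // p p2 p1; apply: lmax; rewrite p2 p1 eqxx.
have : wedge (delta_mx j (0 : 'I_1)) (delta_mx (st i0) 0) != 0.
  apply: (@wedge_neq0 _ _ _ stK _ _ j (st i0)); rewrite !mxE ?eqxx ?oner_neq0 //.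
  left; case: eqVneq => // e; move: j1; rewrite -e d1st; lia.
rewrite (@wedge_vanish _ _ (d1 j) (d2 j) (- d1 i0) 0) ?eqxx //.
- by move=> l /delta_col_neq0 ->.
- by move=> l /delta_col_neq0 ->; rewrite d1st d2st i02 oppr0.
- lia.
- by rewrite j2.
rewrite (mul_col0 x0) wedge0r addr0.
have xj l : l != st i0 -> (x *m delta_mx j (0 : 'I_1)) l 0 = 0.
  move=> ne; rewrite mxE big1 // => p _; apply/eqP; apply: contraNT ne.
  rewrite mulf_eq0 negb_or => /andP[xlp /delta_col_neq0 ep].
  rewrite ep in xlp; have := x1 xlp; have := x2 xlp; rewrite j2 => l2 l1.
  apply/eqP/thin_nz; rewrite ?d1st ?d2st; have := i0min l l2; have := jmax l l2; lia.
apply/matrixP => a b; rewrite [LHS]mxE [RHS]mxE.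
set u := x *m _ in xj *.
have [->|ae] := eqVneq a (st i0); have [->|be] := eqVneq (st b) (st i0).
- by rewrite mulrC subrr.
- by rewrite (xj _ be) [delta_mx _ _ (st b) 0]mxE (negPf be) !mulr0 subrr.
- by rewrite (xj _ ae) [delta_mx _ _ a 0]mxE (negPf ae) !mul0r subrr.
by rewrite (xj _ ae) (xj _ be) mulr0 mul0r subrr.
Qed.

Lemma row0_empty i : d2 i != 0.
Proof.
apply/eqP => i2; have [i0 [i02 i01 xsi0 row0]] := row0_minimal i2.
have xi0 k : x k i0 = 0.
  apply/eqP; apply: contraT => xk; have := x1 xk; have := x2 xk.
  by rewrite i02 => /row0[] ->; rewrite ?d1st; lia.
(* If no arrow of y leaves st a, then none enters a, and the labelling by 1 on a and the positive
   even rows, by -1 on their duals, is kept; it is nonzero at a. *)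
suff [a [a2 sa ya]] : exists a, [/\ d2 a = 0, forall k, d2 k = 0 -> k = a \/ k = st a &
    forall k, y k (st a) = 0].
  pose c k : int := if k == a then 1 else if k == st a then -1 else
    if (2 %| d2 k)%Z then (if 0 < d2 k then 1 else if d2 k < 0 then -1 else 0) else 0.
  have ca k : d2 k != 0 -> c k = if (2 %| d2 k)%Z then (if 0 < d2 k then 1 else -1) else 0.
    move=> k2; rewrite /c; case: eqP => [e|_]; first by move: k2; rewrite e a2.
    case: eqP => [e|_]; first by move: k2; rewrite e d2st a2.
    by repeat (case: ifP => ?) => //; lia.
  have csa : c (st a) = -1 by rewrite /c (negPf (st_neq a)) eqxx.
  have caa : c a = 1 by rewrite /c eqxx.
  have cst k : c (st k) = - c k.
    have [k2|k2] := eqVneq (d2 k) 0.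
      by case: (sa k k2) => ->; rewrite ?stK ?caa ?csa.
    rewrite !ca ?d2st ?oppr_eq0 //.
    by repeat (case: ifP => ?) => //; lia.
  suff : c a = 0 by rewrite caa.
  apply: so_label0 => // p q pq.
    have [q2|q2] := eqVneq (d2 q) 0; last by rewrite !ca ?(x2 pq).
    by move: pq; have [->|->] := row0 q q2; rewrite ?xi0 ?xsi0 eqxx.
  have := y2 pq; have [p2|p2] := eqVneq (d2 p) 0; have [q2|q2] := eqVneq (d2 q) 0.
  - by lia.
  - move=> e; rewrite (ca q) //; case: (sa p p2) => ep; rewrite ep ?csa.
      by move: pq; rewrite -[q]stK ep -[a]stK y_st ya oppr0 eqxx.
    by repeat (case: ifP => ?) => //; lia.
  - move=> e; rewrite (ca p) //; case: (sa q q2) => eq; rewrite eq ?caa.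
      by repeat (case: ifP => ?) => //; lia.
    by move: pq; rewrite eq ya eqxx.
  by move=> e; rewrite !ca //; repeat (case: ifP => ?) => //; lia.
have [/existsP[k1 y1k]|/existsPn y0] := boolP [exists k, y k i0 != 0]; last first.
  exists (st i0); rewrite stK d2st i02; split=> // [k k2|k].
    by case: (row0 k k2); [right|left].
  by apply/eqP; rewrite -[_ == _]negbK.
(* Otherwise y sends both vectors of row 0 into row 2. That row is connected by x, so x y e_(st i0)
   would be nonzero, while x kills e_(st i0). *)
exists i0; split=> // k; apply/eqP; apply: contraT => yk.
have := y1 yk; have := y2 yk; have := y1 y1k; have := y2 y1k.
rewrite d1st d2st i02 => k12 e1 k2 e2.
have [||||j xjk] := @row_connected k k1; rewrite ?k2 ?k12 ?e1 ?e2 //; first lia.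
  by lia.
have [|m [_ /negP[]]] := mulmx_swap xyC xjk yk; last by rewrite xsi0.
move=> m xjm ym; apply: thin_nz; have := y1 ym; have := y2 ym; rewrite ?d1st ?d2st; lia.
Qed.

(** Links descend by 2, so a nonempty even row would lead down to row 0. *)
Lemma odd_rows i : ~~ (2 %| d2 i)%Z.
Proof.
apply/negP => ev.
have [i' ev' ge'] : exists2 i', (2 %| d2 i')%Z & 0 <= d2 i'.
  have [ge|lt] := leP 0 (d2 i); first by exists i.
  by exists (st i); rewrite d2st; lia.
pose j := [arg min_(j < i' | (2 %| d2 j)%Z && (0 <= d2 j)) d2 j]%O.
have [j2 jge jmin] : [/\ (2 %| d2 j)%Z, 0 <= d2 j &
    forall k, (2 %| d2 k)%Z -> 0 <= d2 k -> d2 j <= d2 k].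
  rewrite /j; case: arg_minP; rewrite ?ev' ?ge' // => l /andP[l2 lge] lmin.
  by split=> // k k2 kge; apply: lmin; rewrite k2.
have := row0_empty j => j0.
have [|k [l [ykl e]]] := @row_link j; first by rewrite lt_neqAle eq_sym j0.
by have := y2 ykl; have := jmin k; lia.
Qed.

End NoZeroWeight.

(** x and y are homogeneous and the form pairs opposite weights, so homogeneous components of
    elements of Z stay in Z. This lets [noP] be applied to single entries. *)
Lemma restr_cent (e1 e2 : int) X : X \in Z ->
  restr [rel i j | (d1 i - d1 j == e1) && (d2 i - d2 j == e2)] X \in Z.
Proof.
set m := [rel i j | _]; set Y := restr m X.
have YE i j : Y i j = if m i j then X i j else 0 by rewrite mxE.
rewrite !mem_cent2 => /and3P[Xso /eqP/brk0_comm/matrixP xX /eqP/brk0_comm/matrixP yX].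
have shift (a : 'M[F]_N) f1 f2 : (forall i j, a i j != 0 -> d1 i = d1 j + f1 /\ d2 i = d2 j + f2) ->
    (forall i j, (a *m X) i j = (X *m a) i j) -> brk a Y == 0.
  move=> af aX; rewrite subr_eq0; apply/eqP/matrixP => i j.
  pose m' := (d1 i - d1 j == e1 + f1) && (d2 i - d2 j == e2 + f2).
  suff [-> ->] : (a *m Y) i j = (if m' then (a *m X) i j else 0) /\
                 (Y *m a) i j = (if m' then (X *m a) i j else 0) by rewrite aX.
  split; case: ifP => mm; rewrite !mxE; first [apply: eq_bigr|apply: big1] => k _.
  - have [->|/af[k1 k2]] := eqVneq (a i k) 0; first by rewrite !mul0r.
    by rewrite YE /= ifT //; move: mm; rewrite /m' k1 k2; lia.
  - have [->|/af[k1 k2]] := eqVneq (a i k) 0; first by rewrite mul0r.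
    by rewrite YE /= ifF ?mulr0 //; move: mm; rewrite /m' k1 k2; lia.
  - have [->|/af[k1 k2]] := eqVneq (a k j) 0; first by rewrite !mulr0.
    by rewrite YE /= ifT //; move: mm; rewrite /m'; lia.
  - have [->|/af[k1 k2]] := eqVneq (a k j) 0; first by rewrite mulr0.
    by rewrite YE /= ifF ?mul0r //; move: mm; rewrite /m'; lia.
apply/and3P; split.
- rewrite mem_so; apply/eqP/matrixP => i j.
  rewrite [LHS]mxE [RHS]mxE !YE /= [X (st j) _](so_st stK _ _ Xso) !stK !d1st !d2st !opprK.
  by rewrite ![- _ + _]addrC; case: ifP; rewrite ?oppr0.
- by apply: (@shift x 2 0) => // i j xij; rewrite (x1 xij) (x2 xij) addr0.
by apply: (@shift y 0 2) => // i j yij; rewrite (y1 yij) (y2 yij) addr0.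
Qed.

Lemma cent_notP X i j : X \in Z -> X i j != 0 -> d1 i < d1 j -> d2 j <= d2 i -> False.
Proof.
move=> XZ Xij lt1 le2; have := restr_cent (d1 i - d1 j) (d2 i - d2 j) XZ.
set m := [rel i j | _] => /noP Y0; move: Xij.
have -> : X i j = restr m X i j by rewrite mxE /= !eqxx.
rewrite Y0 ?mxE ?eqxx //; apply/mem_supp => k l; rewrite mxE; case: ifP; rewrite ?eqxx //=.
by rewrite /quadP /=; lia.
Qed.

(** * Odd rows: all weights form a skew shape *)

Section OddRows.

Hypothesis odd2 : forall i, ~~ (2 %| d2 i)%Z.

Lemma col_parity i j : (2 %| d1 i - d1 j)%Z.
Proof.
have h (m : nat) : forall i j, 0 < d2 j -> d2 j <= d2 i -> d2 i <= m%:Z ->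
    (2 %| d1 i - d1 j)%Z.
  elim: m => [|m IHm] {}i {}j j0 ji im; first lia.
  have [e|ne] := eqVneq (d2 i) (d2 j); first by apply: row_parity => //; lia.
  have [|k [l [ykl k2]]] := @row_link i; first lia.
  have e1 := y1 ykl; have e2 := y2 ykl; rewrite k2 in e2.
  have le_jk : d2 j <= d2 k by have := odd2 i; have := odd2 j; lia.
  have kj := IHm k j j0 le_jk _; have : d2 k <= m%:Z by lia.
  move=> /kj; have i0 : d2 i != 0 by lia.
  by have := row_parity i0 (esym k2); lia.
have hp k l : 0 < d2 k -> 0 < d2 l -> (2 %| d1 k - d1 l)%Z.
  move=> k0 l0; have [le|lt] := leP (d2 l) (d2 k).
    by apply: (h `|d2 k|%N) => //; lia.
  have hl : d2 l <= `|d2 l|%N by lia.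
  by have := h `|d2 l|%N l k k0 (ltW lt) hl; lia.
have hn k l : 0 < d2 k -> (2 %| d1 k - d1 l)%Z.
  move=> k0; have := odd2 l; have [l0|l0] := ltP 0 (d2 l); first by move=> _; apply: hp.
  move=> ol; have sl0 : 0 < d2 (st l) by rewrite d2st; lia.
  by have := hp k (st l) k0 sl0; rewrite d1st; lia.
have := odd2 i; have [i0|i0 oi] := ltP 0 (d2 i); first by move=> _; apply: hn.
have si0 : 0 < d2 (st i) by rewrite d2st; lia.
by have := hn (st i) j si0; rewrite d1st; lia.
Qed.

Variables (b1 b2 : 'I_N -> int) (o1 o2 : int).
Hypotheses (d1E : forall i, d1 i = 2 * b1 i + o1) (d2E : forall i, d2 i = 2 * b2 i + o2).

Let b_x1 : raises 1 b1 x.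
Proof. by move=> i j /x1; rewrite !d1E; lia. Qed.
Let b_x2 : keeps b2 x.
Proof. by move=> i j /x2; rewrite !d2E; lia. Qed.
Let b_y1 : keeps b1 y.
Proof. by move=> i j /y1; rewrite !d1E; lia. Qed.
Let b_y2 : raises 1 b2 y.
Proof. by move=> i j /y2; rewrite !d2E; lia. Qed.
Let b_nz i : d2 i != 0.
Proof. by have := odd2 i; lia. Qed.
Let b_thin i j : b1 i = b1 j -> b2 i = b2 j -> i = j.
Proof.
by move=> h1 h2; apply: thin_nz; rewrite ?d1E ?d2E ?h1 ?h2 // -d2E; right; apply: b_nz.
Qed.
Let b_conn i i' : b2 i = b2 i' -> b1 i < b1 i' -> exists j, x j i != 0.
Proof.
by move=> h2 h1; apply: (@row_connected i i'); rewrite ?col_parity // ?d2E ?h2 ?d1E //; lia.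
Qed.
Let b_link i j : b2 j < b2 i -> exists k l, y k l != 0 /\ b2 k = b2 i.
Proof.
move=> lt2; have [i0|i0] := ltP 0 (d2 i).
  have [l [k [ykl k2]]] := row_link i0; exists k, l; split=> //.
  by move: k2; rewrite !d2E; lia.
have [m em] : exists m : nat, d2 (st j) = 2 - d2 i + 2 * m%:Z.
  by exists `|(b2 i - b2 j - 1)%R|%N; rewrite d2st; move: i0; rewrite !d2E; lia.
have [p p2] : exists p, d2 p = 2 - d2 i.
  elim: m (st j) em => [|m IHm] p ep; first by exists p; rewrite ep mulr0 addr0.
  have [|l [k [ykl k2]]] := @row_link p; first by rewrite ep; lia.
  by apply: (IHm l); have := y2 ykl; lia.
have [|l [k [ykl k2]]] := @row_link p; first by rewrite p2; lia.
exists (st l), (st k); rewrite y_st oppr_eq0; split=> //.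
by have := y2 ykl; have := d2st l; rewrite k2 p2 !d2E; lia.
Qed.

(** Different rows contradict [rows_nested], and so does a row above, whose ends are further left by
    [row_mono]. Within one row the bounds miss [row_leaning] by exactly its slack of 2, which forces
    i and j to the left end. *)
Lemma corner i j : d1 (rmax i) < - d1 j -> d1 (rmax j) < - d1 i -> 0 <= d2 i + d2 j ->
  [/\ d1 i = d1 j, d2 i = d2 j & forall k, d2 k <= d2 i].
Proof.
move=> ij ji le2.
have [Li2 Li] := rminP i; have [Ri2 Ri] := rmaxP i.
have [Lj2 Lj] := rminP j; have [Rj2 Rj] := rmaxP j.
have e2 : d2 i = d2 j.
  apply/eqP; apply: contraT => ne; have := rows_nested (b_nz i) (b_nz j) ne le2.
  by have := Li _ erefl; have := Lj _ erefl; lia.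
have i0 : 0 < d2 i by have := odd2 i; lia.
have [L L'] := (Li _ erefl, Li _ (esym e2)).
have Rij := Rj _ (etrans Ri2 e2); have Rji := Ri _ (etrans Rj2 (esym e2)).
split=> //; last first.
  move=> k; rewrite leNgt; apply/negP => lt2.
  have [Lk2 Lk] := rminP k; have [Rk2 Rk] := rmaxP k.
  have [|[p [p2 p1]] _] := row_mono b_x1 b_x2 b_y1 b_y2 xyC b_thin b_conn b_link (i := rmin i) (j := k).
    by move: lt2; rewrite -Li2 !d2E; lia.
  have [|_ [q [q2 q1]]] := row_mono b_x1 b_x2 b_y1 b_y2 xyC b_thin b_conn b_link (i := i) (j := rmax k).
    by move: lt2; rewrite -Rk2 !d2E; lia.
  have p1' : d1 p <= d1 (rmin i) by rewrite !d1E; lia.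
  have q1' : d1 (rmax k) <= d1 q by rewrite !d1E; lia.
  have /Lk : d2 p = d2 k by rewrite !d2E p2.
  have /Ri : d2 q = d2 i by rewrite !d2E q2.
  have ne : d2 k != d2 i by lia.
  have le : 0 <= d2 k + d2 i by lia.
  by have := rows_nested (b_nz k) (b_nz i) ne le; have := Li _ erefl; lia.
have RP := @col_parity (rmax i) (st i); have RP' := @col_parity (rmax j) (st j).
rewrite !d1st in RP RP'.
have [eLR|ne] := eqVneq (d1 (rmin i)) (d1 (rmax i)).
  by have := Ri _ erefl; have := Ri _ (esym e2); lia.
by have [m [_ h1 h2 h3]] := row_leaning i0 ne; lia.
Qed.

(** The quadrant (< 0, >= 0) is excluded by [cent_notP], and (<= 0, < 0) by the shape. An entry in
    the remaining quadrant (> 0, < 0) slides along the columns of t and s; these then reach boxes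
    whose rows and their duals are too short for [corner], up to one degenerate position. *)
Lemma cent_upper X t s : X \in Z -> X t s != 0 -> b1 s <= b1 t /\ b2 s <= b2 t.
Proof.
move=> XZ Xts; have Xso : X \in so by move: XZ; rewrite mem_cent2 => /and3P[].
have [xX yX] : brk x X = 0 /\ brk y X = 0.
  by move: XZ; rewrite mem_cent2 => /and3P[_ /eqP ? /eqP].
have n1 := endo_not_lower b_x1 b_x2 b_y1 b_y2 xyC b_thin b_conn b_link xX.
have n2 := endo_not_lower' b_x1 b_x2 b_y1 b_y2 xyC b_thin b_conn b_link yX.
have conv := order_convex b_x1 b_x2 b_y1 b_y2 xyC b_thin b_conn b_link.
have gapf := row_gapfree b_x1 b_x2 b_conn.
have climb := endo_climb b_x1 b_x2 b_y1 b_y2 xyC b_thin b_conn b_link yX.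
have desc := endo_descend b_x1 b_x2 b_y1 b_y2 xyC b_thin b_conn b_link yX.
have [lt2|ge2] := ltP (b2 t) (b2 s); last first.
  split=> //; rewrite leNgt; apply/negP => lt1; apply: (cent_notP XZ Xts).
    by rewrite !d1E; lia.
  by rewrite !d2E; lia.
exfalso; have [le1|lt1] := leP (b1 t) (b1 s); first exact: n2 Xts le1 lt2.
have no_dual a : X (st a) a != 0 -> False by rewrite (so_st_diag stK two_neq0) ?eqxx.
pose T := col_top b1 b2 t.
have [T1 Ttop] : b1 T = b1 t /\ forall k, b1 k = b1 t -> b2 k <= b2 T.
  by rewrite /T /col_top; case: arg_maxP => // k /eqP -> kmax; split=> // j /eqP /kmax.
pose B := [arg min_(k < s | b1 k == b1 s) b2 k]%O.
have [B1 Bbot] : b1 B = b1 s /\ forall k, b1 k = b1 s -> b2 B <= b2 k.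
  by rewrite /B; case: arg_minP => // k /eqP -> kmin; split=> // j /eqP /kmin.
have Tt := Ttop t erefl; have Bs := Bbot s erefl.
have [|S [XTS S1 S2]] := climb t s T `|b2 T - b2 t|%N Xts T1; try lia.
have [|A [XAB A1 A2]] := desc t s B `|b2 s - b2 B|%N Xts B1; try lia.
(* The columns of t and s reach from A to T and from B to S. *)
have rmaxlt i l : d1 i < d1 l -> (forall k, d1 k = d1 l -> d2 k <> d2 i) ->
    d1 (rmax i) < d1 l.
  move=> lti no; rewrite ltNge; apply/negP => ge; have [Ri2 _] := rmaxP i.
  have [|||k [k1 k2]] := gapf i (rmax i) (b1 l).
  - by move: Ri2; rewrite !d2E; lia.
  - by move: lti; rewrite !d1E; lia.
  - by move: ge; rewrite !d1E; lia.
  by apply: (no k); rewrite ?d1E ?d2E ?k1 ?k2.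
(* The row of i misses the column of t, hence ends before it; j is the dual choice. [corner] leaves
   only i and j of equal weight in the top row, which [fin] excludes. *)
suff [i [j [[i1 j1] le2 iP jP fin]]] : exists i j, [/\ d1 i = d1 s /\ d1 j = - d1 t,
    0 <= d2 i + d2 j, (forall k, d1 k = d1 t -> d2 k <> d2 i),
    (forall k, d1 k = - d1 s -> d2 k <> d2 j) &
    (d1 s = - d1 t -> d2 i = d2 j -> (forall k, d2 k <= d2 i) -> False)].
  have lt1' : d1 s < d1 t by rewrite !d1E; lia.
  have [||//|e1' e2' top] := @corner i j.
  - by rewrite j1 opprK; apply: rmaxlt; rewrite ?i1.
  - rewrite i1 -d1st; apply: rmaxlt; first by rewrite d1st j1; lia.
    by move=> k; rewrite d1st => /jP.
  by apply: (fin _ e2' top); rewrite -i1 e1' j1.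
have col_t k : d1 k = d1 t -> b2 k <= b2 T by rewrite !d1E => e; apply: Ttop; lia.
have col_s k : d1 k = - d1 s -> b2 B <= b2 (st k).
  by have := d1st k; rewrite !d1E => e e'; apply: Bbot; lia.
have dT : d1 T = d1 t by rewrite !d1E T1.
have dB : d1 B = d1 s by rewrite !d1E B1.
(* If the columns overlap or adjoin in height, i is taken just above T in the column of s and l just
   below B in the column of t; otherwise B and T themselves will do. *)
have [ge|lt] := leP (b2 B) (b2 T + 1).
  have [||||i [i1 i2]] := conv B S (b1 s) (b2 T + 1); try lia.
  have [||||l [l1 l2]] := conv A T (b1 t) (b2 B - 1); try lia.
  have di : d1 i = d1 s by rewrite !d1E i1.
  have dl : d1 l = d1 t by rewrite !d1E l1.
  exists i, (st l); rewrite d1st d2st di dl; split=> //.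
  - by rewrite !d2E i2 l2; lia.
  - by move=> k /col_t; rewrite !d2E i2; lia.
  - by move=> k /col_s; have := d2st k; rewrite !d2E l2; lia.
  (* Now the columns of s and t are dual to each other. Halfway up, X has a nonzero entry between
     dual vectors, impossible for a skew matrix. *)
  move=> es e2 top; have := top S; move: (odd2 s) e2; rewrite !d2E i2 l2 => o2N e2 topS.
  have [||||k [k1 k2]] := conv A T (b1 t) ((b2 T + b2 B - 1) %/ 2)%Z; try lia.
  have [||s' [Xks s'1 s'2]] := climb A B k `|b2 k - b2 A|%N XAB; try lia.
  apply: (no_dual s'); suff <- : k = st s' by [].
  apply: thin_nz; [by right|rewrite d1st|rewrite d2st].
    by move: es; rewrite !d1E; lia.
  by rewrite !d2E; lia.
exists B, (st T); rewrite d1st d2st dB dT; split=> //.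
- by rewrite !d2E; lia.
- by move=> k /col_t; rewrite !d2E; lia.
- by move=> k /col_s; have := d2st k; rewrite !d2E; lia.
(* Here the entry of X at (T, B) is the one between dual vectors. *)
move=> es e2 top; have SB : S = B.
  by apply: b_thin; [lia|have := top S; have := Bbot S; rewrite !d2E; lia].
apply: (no_dual B); suff <- : T = st B by rewrite -SB.
by apply: thin_nz; rewrite ?d1st ?d2st; [right|lia|lia].
Qed.

Lemma dim_sym_quad : (n <= \dim (quad d1 d2 x y sym))%N.
Proof.
apply: leq_trans (dim_dag_diag stK st_neq N2n two_neq0 (or_introl (erefl 1))) _.
apply: leq_trans (dimvS _) (dim_quad_le two_gt0 x1 x2 y1 y2 xyC (U := sym) _ _).
- apply/subvP => X; rewrite /deg00 !memv_cap => /andP[-> /mem_supp Xd].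
  by apply/andP; split; apply/mem_supp => i j /Xd /eqP ->; rewrite /deg_eq /= subrr.
- by move=> X; apply: brk_dagsub.
- by move=> X; apply: brk_dagsub.
Qed.

Lemma dim_so_halved : (\dim Z <= n)%N.
Proof.
suff : (\dim Z + \dim (quad d1 d2 x y sym) <= N)%N by have := dim_sym_quad; lia.
apply: leq_trans (dim_sum_le (A := (Z + quad d1 d2 x y sym)%VS) _ _ _) _.
- exact: addvSl.
- exact: addvSr.
- move=> X; rewrite mem_quad !mem_cent2 => /and3P[Xso _ _] /and3P[/and3P[Xsym _ _] _ _].
  exact: (so_sym_disjoint two_neq0 Xso Xsym).
apply: (dim_endo_quad b_x1 b_x2 b_y1 b_y2 xyC b_thin b_conn b_link) => X.
case/memv_addP => Y YZ [W + ->]; rewrite mem_quad => /and3P[WZ /mem_supp W1 /mem_supp W2].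
move: (YZ) WZ; rewrite !mem_cent2 => /and3P[_ /eqP xY /eqP yY] /and3P[_ /eqP xW /eqP yW].
split=> [||t s]; [by rewrite linearD /= xY xW addr0|by rewrite linearD /= yY yW addr0|].
rewrite mxE.
have [Y0|Yts _] := eqVneq (Y t s) 0; last exact: cent_upper Yts.
rewrite Y0 add0r => Wts; have := W1 _ _ Wts; have := W2 _ _ Wts.
by rewrite /deg_ge /= !subr_ge0 !d1E !d2E; lia.
Qed.

End OddRows.

Lemma dim_so_no_zero : (forall i, d1 i = 0 -> d2 i <> 0) -> (\dim Z <= n)%N.
Proof.
move=> no0; have odd2 := odd_rows no0.
have [->//|[i0 _]] : \dim Z = 0%N \/ exists i0 : 'I_N, true.
  case: (posnP N) => [N0|N_gt0]; last by right; exists (Ordinal N_gt0).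
  by move: N2n n_gt1; lia.
pose e := (d1 i0 %% 2)%Z.
apply: (dim_so_halved odd2 (b1 := fun i => ((d1 i - e) %/ 2)%Z)
  (b2 := fun i => ((d2 i - 1) %/ 2)%Z) (o1 := e) (o2 := 1)) => i.
  by have := col_parity odd2 i i0; rewrite /e; lia.
by have := odd2 i; lia.
Qed.

(** * Orthogonal pairs with a weight 0 *)

Section ZeroWeight.

Variable o : 'I_N.
Hypotheses (o1 : d1 o = 0) (o2 : d2 o = 0).

Lemma zero_weight i : d1 i = 0 -> d2 i = 0 -> i = o \/ i = st o.
Proof.
move=> i1 i2; apply: (so_thin stK st_neq N2n two_neq0 two_gt0 d1st d2st x1 x2 y1 y2
  xyC xN yN n_gt1 small); by rewrite ?o1 ?o2 ?i1 ?i2.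
Qed.

Definition on_zero u := forall i, u i 0 != 0 -> i = o \/ i = st o.

Lemma on_zeroP u i : on_zero u -> u i 0 != 0 -> d1 i = 0 /\ d2 i = 0.
Proof. by move=> u0 /u0[] ->; rewrite ?d1st ?d2st o1 o2 ?oppr0. Qed.

Lemma mul_on_zero (a : 'M[F]_N) u k : on_zero u ->
  (a *m u) k 0 = a k o * u o 0 + a k (st o) * u (st o) 0.
Proof.
move=> u0; rewrite mxE (bigD1 o) //= (bigD1 (st o)) ?st_neq //= big1 ?addr0 // => i.
case/andP=> io iso; apply/eqP; rewrite mulf_eq0; apply/orP; right.
by apply: contraT => /u0[] e; rewrite e eqxx in io iso.
Qed.

(** The plane of weight 0 is mapped into the line of a single basis vector, so some nonzero vector
    of the plane is killed. *)
Lemma kernel_on_zero (a : 'M[F]_N) :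
  (forall k k', a k o != 0 \/ a k (st o) != 0 -> a k' o != 0 \/ a k' (st o) != 0 -> k = k') ->
  exists w, [/\ on_zero w, exists m, w m 0 != 0 & a *m w = 0].
Proof.
move=> a_line; pose v (b c : F) : 'cV[F]_N :=
  \matrix_(i, _) (if i == o then b else if i == st o then c else 0).
have v0 b c : on_zero (v b c).
  move=> i; rewrite mxE; case: (i =P o) => [->|_]; first by left.
  by case: (i =P st o) => [->|_]; [right|rewrite eqxx].
have vo b c : v b c o 0 = b by rewrite mxE eqxx.
have vso b c : v b c (st o) 0 = c by rewrite mxE (negPf (st_neq o)) eqxx.
have [/existsP[k ak]|/existsPn ao] := boolP [exists k, a k o != 0]; last first.
  exists (v 1 0); split=> //; first by exists o; rewrite vo oner_neq0.
  apply/matrixP => k l; rewrite ord1 mul_on_zero // vo vso mulr0 addr0 mxE.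
  by apply/eqP; rewrite mulr1 -[_ == _]negbK.
exists (v (- a k (st o)) (a k o)); split=> //; first by exists (st o); rewrite vso.
apply/matrixP => l j; rewrite ord1 mul_on_zero // vo vso [RHS]mxE.
have [->|lk] := eqVneq l k; first by ring.
have l0 c : (c = o \/ c = st o) -> a l c = 0.
  move=> cc; apply/eqP; apply: contraT => alc; case/eqP: lk; apply: a_line; last by left.
  by case: cc alc => ->; [left|right].
by rewrite !l0; [ring|right|left].
Qed.

Lemma kernel_x : exists w, [/\ on_zero w, exists m, w m 0 != 0 & x *m w = 0].
Proof.
have h k : x k o != 0 \/ x k (st o) != 0 -> d1 k = 2 /\ d2 k = 0.
  by case=> xk; rewrite (x1 xk) (x2 xk) ?d1st ?d2st o1 o2 ?oppr0 ?add0r.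
apply: kernel_on_zero => k k' /h[k1 k2] /h[k1' k2'].
by apply: thin_nz; rewrite ?k1 ?k1' ?k2 ?k2' //; left.
Qed.

Lemma kernel_y : exists w, [/\ on_zero w, exists m, w m 0 != 0 & y *m w = 0].
Proof.
have h k : y k o != 0 \/ y k (st o) != 0 -> d1 k = 0 /\ d2 k = 2.
  by case=> yk; rewrite (y1 yk) (y2 yk) ?d1st ?d2st o1 o2 ?oppr0 ?add0r.
apply: kernel_on_zero => k k' /h[k1 k2] /h[k1' k2'].
by apply: thin_nz; rewrite ?k1 ?k1' ?k2 ?k2' //; right.
Qed.

(** Let e_s be the rightmost vector of non-even weight; x kills it. Row 0 supplies two independent
    vectors of even weight killed by x: the plane of weight 0 itself, or one vector of it and the
    right end of the even part. Their bivectors with e_s have the same second degree and contradict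
    [so_cross]. *)
Lemma even_weights i : (2 %| d1 i)%Z && (2 %| d2 i)%Z.
Proof.
pose c k := (2 %| d1 k)%Z && (2 %| d2 k)%Z; apply: contraT; rewrite -/(c i) => ci.
pose s := [arg max_(k > i | ~~ c k) d1 k]%O.
have [cs smax] : ~~ c s /\ forall k, ~~ c k -> d1 k <= d1 s by rewrite /s; case: arg_maxP.
have cx : keeps c x by move=> p q pq; rewrite /c (x1 pq) (x2 pq); congr andb; lia.
have cy : keeps c y by move=> p q pq; rewrite /c (y1 pq) (y2 pq); congr andb; lia.
have cst k : c (st k) = c k by rewrite /c d1st d2st; congr andb; lia.
have xs k : x k s = 0.
  apply/eqP; apply: contraT => xk; have := smax k; rewrite (cx _ _ xk) (x1 xk) => /(_ cs).
  by lia.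
have mem u : (forall k, u k 0 != 0 -> c k /\ d2 k = 0) -> x *m u = 0 ->
   wedge u (delta_mx s (0 : 'I_1)) \in
   (so :&: cent x :&: supp F [rel i j | c i != c j] :&: supp F (deg_eq d2 (d2 s)))%VS.
  move=> uP xu; rewrite !memv_cap wedge_so // mem_cent brk_wedge //.
  rewrite (mul_col0 xs) xu wedge0l wedge0r addr0 eqxx /=.
  suff h a b : wedge u (delta_mx s (0 : 'I_1)) a b != 0 -> c a != c b /\ d2 a - d2 b = d2 s.
    by apply/andP; split; apply/mem_supp => a b /h[]; rewrite /deg_eq /= => // _ ->.
  rewrite mxE => w0.
  have [uv0|] := eqVneq (u a 0 * (delta_mx s (0 : 'I_1) : 'cV[F]_N) (st b) 0) 0.
    move: w0; rewrite uv0 sub0r oppr_eq0 mulf_eq0 negb_or.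
    case/andP => /delta_col_neq0 -> /uP[]; rewrite cst d2st => -> b2.
    by split; [rewrite (negPf cs)|lia].
  rewrite mulf_eq0 negb_or => /andP[/uP[ca a2] /delta_col_neq0 bs].
  by rewrite -(cst b) bs ca cs; split=> //; rewrite a2 -bs d2st; lia.
have [co cso] : c o /\ c (st o) by rewrite cst /c o1 o2.
have wE (u : 'cV[F]_N) m : c m -> wedge u (delta_mx s (0 : 'I_1)) m (st s) = u m 0.
  move=> cm; rewrite mxE stK [delta_mx s _ s 0]mxE eqxx mulr1 [delta_mx s _ m 0]mxE.
  by have /negPf -> : m != s by [apply: contraNneq cs => <-]; rewrite mul0r subr0.
have cross := so_cross stK st_neq N2n two_neq0 two_gt0 d1st d2st x1 x2 y1 y2 xyC xN yN
  n_gt1 small cx cy.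
have oc k : k = o \/ k = st o -> c k by case=> ->.
have oo k : k = o \/ k = st o -> d2 k = 0 by case=> ->; rewrite ?d2st o2 ?oppr0.
have [/existsP[p /and3P[cp /eqP p2 p1]]|/existsPn no] :=
  boolP [exists p, [&& c p, d2 p == 0 & 0 < d1 p]]; last first.
  have x0 k l : l = o \/ l = st o -> x k l = 0.
    move=> ll; apply/eqP; apply: contraT => xk; have := no k.
    rewrite (cx _ _ xk) (x2 xk) (x1 xk) oc // oo // eqxx /=.
    by case: ll => ->; rewrite ?d1st o1 ?oppr0.
  exfalso; apply: (cross _ _ _ o (st s) (st o) (st s)
    (mem (delta_mx o 0) _ (mul_col0 (fun k => x0 k o (or_introl erefl))))
    (mem (delta_mx (st o) 0) _ (mul_col0 (fun k => x0 k (st o) (or_intror erefl)))));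
    rewrite ?wE //; rewrite ?mxE ?eqxx ?oner_neq0 //.
  - by move=> k /delta_col_neq0 ->; rewrite o2.
  - by move=> k /delta_col_neq0 ->; rewrite d2st o2.
  - by rewrite (negPf (st_neq o)).
pose q := [arg max_(q > p | [&& c q, d2 q == 0 & 0 < d1 q]) d1 q]%O.
have [cq q2 q1 qmax] : [/\ c q, d2 q = 0, 0 < d1 q &
    forall k, c k -> d2 k = 0 -> 0 < d1 k -> d1 k <= d1 q].
  rewrite /q; case: arg_maxP => [|l /and3P[cl /eqP l2 l1] lmax]; first by rewrite cp p2 eqxx.
  by split=> // k ck k2 k1; apply: lmax; rewrite ck k2 eqxx.
have xq k : x k q = 0.
  apply/eqP; apply: contraT => xk; have := qmax k.
  by rewrite (cx _ _ xk) (x2 xk) (x1 xk) => /(_ cq q2); lia.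
have [w [w0 [m wm] xw]] := kernel_x.
exfalso; apply: (cross _ _ _ q (st s) m (st s) (mem (delta_mx q 0) _ (mul_col0 xq))
  (mem w _ xw)); rewrite ?wE ?(oc _ (w0 _ wm)) //.
- by move=> k /delta_col_neq0 ->.
- by move=> k /w0 kk; split; [apply: oc|apply: oo].
- by rewrite mxE !eqxx oner_neq0.
rewrite mxE andbT; case: eqP => // mq; have := on_zeroP w0 wm; rewrite mq; lia.
Qed.

(** If x killed e_i, so would it kill the bivector of e_i with a vector of weight 0 in the kernel of
    x. *)
Lemma row0_left i : d2 i = 0 -> d1 i < 0 -> exists k, x k i != 0.
Proof.
move=> i2 i1; apply/existsP; apply: contraT => /existsPn xi.
have [w [w0 [m wm] xw]] := kernel_x.
have xi0 k : x k i = 0 by apply/eqP; rewrite -[_ == _]negbK.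
have : wedge w (delta_mx i (0 : 'I_1)) != 0.
  apply: (@wedge_neq0 _ _ _ stK _ _ m i) => //; first by rewrite mxE !eqxx oner_neq0.
  left; apply/eqP; apply: contraT => /(on_zeroP w0); lia.
rewrite (@wedge_vanish _ _ 0 0 (d1 i) (d2 i)) ?eqxx ?i2 ?add0r //.
- by move=> k /(on_zeroP w0).
- by move=> k /delta_col_neq0 ->.
by rewrite (mul_col0 xi0) xw wedge0l wedge0r addr0.
Qed.

(** Even weights remove the slack in [row_leaning]. A row of one vector is instead paired with a
    vector of weight 0 killed by x. *)
Lemma row_heavy i : 0 < d2 i -> 0 <= d1 (rmin i) + d1 (rmax i).
Proof.
move=> i0; have [Ri2 Rmax] := rmaxP i; have [Li2 Lmin] := rminP i.
have [e|ne] := eqVneq (d1 (rmin i)) (d1 (rmax i)); last first.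
  have [m [mo h1 h2 h3]] := row_leaning i0 ne.
  by have /andP[] := even_weights (rmin i); have /andP[] := even_weights (rmax i); lia.
rewrite leNgt; apply/negP => lt1.
have xR k : x k (rmax i) = 0.
  apply/eqP; apply: contraT => xk; have := Rmax k; rewrite (x2 xk) (x1 xk) Ri2; lia.
have [w [w0 [m wm] xw]] := kernel_x.
have : wedge w (delta_mx (rmax i) (0 : 'I_1)) != 0.
  apply: (@wedge_neq0 _ _ _ stK _ _ m (rmax i)) => //; first by rewrite mxE !eqxx oner_neq0.
  left; apply/eqP; apply: contraT => /(on_zeroP w0); lia.
rewrite (@wedge_vanish _ _ 0 0 (d1 (rmax i)) (d2 i)) ?eqxx ?add0r //.
- by move=> k /(on_zeroP w0).
- by move=> k /delta_col_neq0 ->.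
- by lia.
- by lia.
by rewrite (mul_col0 xR) xw wedge0l wedge0r addr0.
Qed.

Notation e_ i := (delta_mx i (0 : 'I_1) : 'cV[F]_N).

Lemma mul_colE (a : 'M[F]_N) i k : (a *m e_ i) k 0 = a k i.
Proof.
rewrite mxE (bigD1 i) //= big1 ?addr0 => [|l li]; first by rewrite mxE !eqxx mulr1.
by rewrite mxE (negPf li) mulr0.
Qed.

(** If x^2 e_i = 0, the bivector of e_i and x e_i commutes with x, as x e_i paired with itself is 0.
    Its first degree 2 d1 i + 2 is negative because d1 i is even. *)
Lemma no_loop i : d1 i < 0 -> d2 i = 0 -> x *m (x *m e_ i) = 0 -> False.
Proof.
move=> i1 i2 xx0; have [k xki] := row0_left i2 i1.
have : wedge (e_ i) (x *m e_ i) != 0.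
  apply: (@wedge_neq0 _ _ _ stK _ _ i k); rewrite ?mul_colE ?mxE ?eqxx ?oner_neq0 //.
  by left; case: eqP => // e; have := x1 xki; rewrite e; lia.
rewrite (@wedge_vanish _ _ (d1 i) 0 (d1 i + 2) 0) ?eqxx //.
- by move=> l /delta_col_neq0 ->.
- by move=> l; rewrite mul_colE => xl; rewrite (x1 xl) (x2 xl).
- by have /andP[] := even_weights i; lia.
by rewrite xx0 wedge0r addr0; apply/matrixP => a b; rewrite !mxE mulrC subrr.
Qed.

Lemma rmin_stE r : d2 r != 0 -> rmin (st r) = st (rmax r).
Proof.
move=> r0; apply: thin_nz; rewrite ?rmin_st ?d1st //; last first.
  by rewrite (proj1 (rminP _)) !d2st (proj1 (rmaxP _)).
by right; rewrite (proj1 (rminP _)) d2st oppr_eq0.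
Qed.

(* Let u = y e_g, nonzero of weight (-R, 0), and f = x^k u its last nonzero
   multiple. If y u = 0 then x, y kill f and the form vanishes on the multiples
   of u, which is impossible whatever the sign of the weight of f. *)
Lemma y2_neq0 r : d2 r = 2 -> exists k, (y *m y) k (rmin (st r)) != 0.
Proof.
move=> r2; apply/existsP; apply: contraT => /existsPn yy.
have r0 : d2 r != 0 by rewrite r2.
have [g2 gmin] := rminP (st r); have g1 := rmin_st r; have gE := rmin_stE r0.
set g := rmin (st r) in yy g2 gmin g1 gE *; rewrite d2st r2 in g2.
have yyg k : (y *m y) k g = 0 by apply/eqP; rewrite -[_ == _]negbK.
pose M k := mxpow x k *m y.
have yC k : y *m mxpow x k = M k by apply: mxpow_commute.
have Mw k j : M k j g != 0 -> d1 j = d1 g + 2 * k%:Z /\ d2 j = 0.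
  case/mulmx_entry_neq0 => l [/pow_supp[-> ->] yl].
  by rewrite (y1 yl) (y2 yl) g2.
have MS k j : M k.+1 j g = (x *m M k) j g by rewrite /M mxpowS mulmxA.
have yM k j : (y *m M k) j g = 0.
  rewrite /M mulmxA yC -mulmxA mxE big1 // => l _.
  by rewrite yyg mulr0.
(* A link into row 2, dualized, starts at a multiple x^m e_g; hence x^m u is nonzero. The index [j]
   carries the last nonzero multiple of u, and [k] is its exponent. *)
have [j [k [Mj xM]]] : exists j k, M k j g != 0 /\ forall l, (x *m M k) l g = 0.
  have [|b [a [yab a2]]] := @row_link r; first by rewrite r2.
  have yab' : y (st b) (st a) != 0 by rewrite y_st oppr_eq0.
  pose P j := M `|((d1 j - d1 g) %/ 2)%Z|%N j g != 0.
  have PM k l : M k l g != 0 -> P l.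
    move=> Mk; have [l1 _] := Mw _ _ Mk; rewrite /P; suff -> : `|((d1 l - d1 g) %/ 2)%Z|%N = k by [].
    by rewrite l1; lia.
  have sag : d2 (st a) = d2 g by rewrite d2st a2 r2 g2.
  have par : (2 %| d1 (st a) - d1 g)%Z.
    have /andP[] := even_weights (st a); have /andP[] := even_weights g; lia.
  have ge : d1 g <= d1 (st a) by apply: gmin; rewrite sag g2 d2st r2.
  have [m em] : exists m : nat, d1 (st a) = d1 g + 2 * m%:Z.
    by exists `|((d1 (st a) - d1 g) %/ 2)%Z|%N; lia.
  have Pb : P (st b).
    apply: (PM m); rewrite -yC (@mulmx_entry _ _ _ _ _ _ _ _ (st a)); last first.
      move=> l yl /pow_supp[l1 l2]; apply: thin_nz; rewrite ?l1 ?l2 ?em ?sag //.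
      by right; rewrite g2.
    by apply: mulf_neq0 => //; apply: pow_neq0 => //; rewrite g2.
  pose j := [arg max_(j > st b | P j) d1 j]%O.
  have [Pj jmax] : P j /\ forall l, P l -> d1 l <= d1 j by rewrite /j; case: arg_maxP.
  exists j; move: Pj; rewrite /P; set k := absz _ => Mk; exists k; split=> // l.
  apply/eqP; apply: contraT; rewrite -MS => Ml.
  by have := jmax _ (PM _ _ Ml); have [-> _] := Mw _ _ Ml; have [-> _] := Mw _ _ Mk; lia.
have [j1 j2] := Mw _ _ Mj.
have R0 : d1 g <= 0.
  by have := row_heavy (i := r); have [_ /(_ _ (proj1 (rminP r)))] := rmaxP r; rewrite r2 g1; lia.
have [lt0|gt0|eq0] := ltgtP (d1 j) 0.
- have [l xlj] := row0_left j2 lt0.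
  have := xM l; rewrite (@mulmx_entry _ _ _ _ _ _ _ _ j) => [/eqP|m _ Mm].
    by rewrite mulf_eq0 (negPf xlj) (negPf Mj).
  by have [m1 m2] := Mw _ _ Mm; apply: thin_nz; rewrite ?m1 ?m2 ?j1 ?j2 //; left; lia.
- have le_j : d1 j <= - d1 g.
    move: Mj; rewrite -yC => /mulmx_entry_neq0[l [yl /pow_supp[l1 l2]]].
    have l2' : d2 (st l) = d2 r by rewrite d2st l2 g2 r2.
    have [_ /(_ _ l2')] := rminP r; have := row_heavy (i := r); rewrite r2 g1 d1st l1 -j1.
    by lia.
  (* The multiple x^k' u has the weight opposite to that of f, so the form pairs them nontrivially;
     but moving y across the form turns this pairing into one that involves y f = 0. *)
  have [k' ek] : exists k' : nat, - d1 j = d1 g + 2 * k'%:Z.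
    have /andP[] := even_weights j; have /andP[] := even_weights g.
    by exists `|((- d1 j - d1 g) %/ 2)%Z|%N; lia.
  have Mk' : M k' (st j) g != 0.
    have kk : (k = (k - k') + k')%N by lia.
    move: Mj; rewrite /M kk => Mj.
    have powD a b : mxpow x (a + b) = mxpow x a *m mxpow x b.
      by elim: a => [|a IHa]; rewrite ?mul1mx // addSn !mxpowS IHa mulmxA.
    move: Mj; rewrite powD -mulmxA => /mulmx_entry_neq0[l [_ Ml]].
    suff <- : l = st j by [].
    have [l1 l2] := Mw _ _ Ml; apply: thin_nz; rewrite ?l1 ?l2 ?d1st ?d2st ?j2 ?oppr0 //.
    by left; lia.
  have : ((y *m mxpow x k') *m M k) (st g) g = 0.
    by rewrite yC -mulmxA mxE big1 // => l _; rewrite yM mulr0.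
  rewrite (@mulmx_entry _ _ _ _ _ _ _ _ j); last first.
    move=> l _ Ml; have [l1 l2] := Mw _ _ Ml; apply: thin_nz; rewrite ?l1 ?l2 ?j1 ?j2 //.
    by left; lia.
  have -> : (y *m mxpow x k') (st g) j = - ((-1) ^+ k' * M k' (st j) g).
    have : dag (y *m mxpow x k') = - ((-1) ^+ k' *: M k').
      by rewrite (dag_mul stK) dag_pow yN mulmxN -scalemxAl.
    by move/matrixP/(_ (st j) g); rewrite [LHS]mxE stK => ->; rewrite mxE [X in - X]mxE.
  move/eqP; rewrite mulf_eq0 oppr_eq0 mulf_eq0 signr_eq0.
  by rewrite (negPf Mk') (negPf Mj).
(* For k > 0 the preceding multiple has weight (-2, 0) and is killed by x^2, against [no_loop]. *)
case: k => [|k] in Mj xM j1 *; last first.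
  move: Mj; rewrite MS => /mulmx_entry_neq0[l [xjl Ml]].
  have [l1 l2] := Mw _ _ Ml; have xjl1 := x1 xjl.
  exfalso; apply: (@no_loop l) => //; first lia.
  apply/matrixP => p q; rewrite ord1 [RHS]mxE mulmxA mul_colE; apply/eqP.
  have : (x *m M k.+1) p g == 0 by rewrite xM.
  rewrite /M mxpowS -mulmxA mulmxA -/(M k) (@mulmx_entry _ _ _ _ _ _ _ _ l).
    by rewrite mulf_eq0 (negPf Ml) orbF.
  move=> m _ Mm; have [m1 m2] := Mw _ _ Mm; apply: thin_nz; rewrite ?m1 ?m2 ?l1 ?l2 //.
  by left; lia.
have g10 : d1 g = 0 by lia.
have yg0 i : y i g != 0 -> i = o \/ i = st o.
  by move=> yi; apply: zero_weight; rewrite ?(y1 yi) ?(y2 yi) ?g10 ?g2.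
(* For k = 0, u lies in the plane of weight 0, and y^2 e_g = 0 says that it is isotropic, so it is a
   multiple of e_o or of e_(st o). *)
have [a [ao ya ysa]] : exists a, [/\ a = o \/ a = st o, y a g != 0 & y (st a) g = 0].
  have Mj' : y j g != 0 by move: Mj; rewrite /M mul1mx.
  have := yyg (st g); rewrite mxE (bigD1 o) //= (bigD1 (st o)) ?st_neq //= big1 => [|i].
    have -> : y (st g) o = - y (st o) g by rewrite -{1}[o]stK y_st.
    rewrite y_st addr0 mulNr mulNr [X in _ - X]mulrC -opprD -mulr2n => /eqP.
    rewrite oppr_eq0 -mulr_natl !mulf_eq0 (negPf two_neq0) /= => yo.
    have := yg0 j Mj'; case/orP: yo => /eqP yo [] ej; rewrite ej in Mj'.
    - by exists o; split=> //; [left].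
    - by rewrite yo eqxx in Mj'.
    - by rewrite yo eqxx in Mj'.
    - by exists (st o); rewrite stK; split=> //; [right].
  case/andP => io iso; apply/eqP; rewrite mulf_eq0; apply/orP; right.
  by apply: contraT => /yg0[] e; rewrite e eqxx in io iso.
have y_g i : y i g != 0 -> i = a.
  move=> yi; have := yg0 i yi; case: ao => ea [] ei; subst a; rewrite ei // in yi *.
    by rewrite ysa eqxx in yi.
  by rewrite stK in ysa; rewrite ysa eqxx in yi.
have uniq_a (A : 'M[F]_N) k : (A *m y) k g = A k a * y a g.
  by apply: mulmx_entry => m _ /y_g.
have y_a k : y k a = 0.
  by apply/eqP; have /eqP := yyg k; rewrite uniq_a mulf_eq0 (negPf ya) orbF.
have x_a k : x k a = 0.
  by apply/eqP; have /eqP := xM k; rewrite /M mul1mx uniq_a mulf_eq0 (negPf ya) orbF.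
have [a1 a2] : d1 a = 0 /\ d2 a = 0.
  by case: ao => ->; rewrite ?d1st ?d2st o1 o2.
have zero_a i : d1 i = 0 -> d2 i = 0 -> i = a \/ i = st a.
  move=> i1 i2; case: (zero_weight i1 i2) ao => -> [] ->; rewrite ?stK;
  by [left|right].
have x_sa k : x k (st a) = 0.
  apply/eqP; apply: contraT => xk; have := x1 xk; have := x2 xk.
  rewrite d1st d2st a1 a2 oppr0 add0r => k2 k1.
  exfalso; apply: (@no_loop (st k)); rewrite ?d1st ?d2st ?k1 ?k2 ?oppr0 //.
  apply/matrixP => p q; rewrite ord1 [RHS]mxE mulmxA mul_colE.
  rewrite (@mulmx_entry _ _ _ _ _ _ _ _ a) ?x_a ?mul0r // => m _ xm.
  have [||//|em] := @zero_a m; rewrite ?(x1 xm) ?(x2 xm) ?d1st ?d2st ?k1 ?k2 ?oppr0 //.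
  by move: xm; rewrite em x_st x_a oppr0 eqxx.
(* Row 0 splits off: x kills e_a and e_(st a), and the only arrows of y at these two are g -> a and
   st a -> st g. So a takes the label of the negative rows and st a that of the positive ones. *)
pose c k : int := if 0 < d2 k then 1 else if d2 k < 0 then -1
  else if k == st a then 1 else if k == a then -1 else 0.
have c0 k : d2 k = 0 -> c k = if k == st a then 1 else if k == a then -1 else 0.
  by rewrite /c => ->.
have c_pos k : 0 < d2 k -> c k = 1 by rewrite /c => ->.
have c_neg k : d2 k < 0 -> c k = -1 by rewrite /c => k0; rewrite k0 ltNge ltW.
suff : c r = 0 by rewrite c_pos ?r2.
have ev k : (2 %| d2 k)%Z by have /andP[] := even_weights k.
have sgE : st g = rmax r by rewrite gE stK.
have row2 p : d2 p = 2 -> p = st g.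
  move=> p2; have [_ Mx] := rmaxP r; have [_ Mn] := rminP r.
  have := Mx p; have := Mn p; rewrite p2 r2 => /(_ erefl) h1 /(_ erefl) h2.
  have := row_heavy (i := r); rewrite r2 => /(_ isT) h3.
  by apply: thin_nz; rewrite ?d1st ?d2st ?p2 ?g2 //; [right|lia].
apply: so_label0 => [k|p q pq|p q pq].
- have [k0|k0|k0] := ltgtP (d2 k) 0.
  + by rewrite (c_neg k) // c_pos ?d2st; lia.
  + by rewrite (c_pos k) // c_neg ?d2st; lia.
  rewrite !c0 ?d2st ?k0 // (inj_eq (inv_inj stK)) (can2_eq stK stK).
  case: (k =P a) => [->|_]; first by rewrite eq_sym (negPf (st_neq a)).
  by case: (k == st a).
- have e := x2 pq; have [q0|q0|q0] := ltgtP (d2 q) 0.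
  + by rewrite !c_neg ?e.
  + by rewrite !c_pos ?e.
  have nq b : b = a \/ b = st a -> q != b /\ p != b.
    move=> bb; split; apply: contraNneq pq => e'; rewrite e'.
      by case: bb => ->; rewrite ?x_a ?x_sa.
    by rewrite -[b]stK -[q]stK x_st; case: bb => ->; rewrite ?stK ?x_a ?x_sa oppr0.
  have [qa pa] := nq a (or_introl erefl); have [qsa psa] := nq _ (or_intror erefl).
  by rewrite !c0 ?e // (negPf qa) (negPf pa) (negPf qsa) (negPf psa).
have e := y2 pq; have [q0|q0|q0] := ltgtP (d2 q) 0.
- rewrite (c_neg q) //; have [p0|p0|p0] := ltgtP (d2 p) 0; first by rewrite c_neg.
    by have := ev q; lia.
  have eq : q = g by rewrite -[q]stK (row2 (st q)) ?stK // d2st; lia.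
  by rewrite c0 // (y_g p) -?eq // eqxx eq_sym (negPf (st_neq a)).
- by rewrite !c_pos ?e //; lia.
have ep : p = st g by apply: row2; lia.
have : y (st q) g != 0 by rewrite -[g]stK y_st -ep oppr_eq0.
by move/y_g => eq; rewrite (c0 q) // -[q]stK eq eqxx c_pos // e q0.
Qed.

Lemma row_below p (m : nat) q : d2 p = q + 2 * m%:Z -> 0 < q -> exists p', d2 p' = q.
Proof.
move=> + q0; elim: m p => [|m IHm] p ep; first by exists p; rewrite ep mulr0 addr0.
have [|l [k [ykl k2]]] := @row_link p; first by rewrite ep; lia.
by apply: (IHm l); have := y2 ykl; lia.
Qed.

Lemma row2_exists i : d2 i != 0 -> exists r, d2 r = 2.
Proof.
move=> i0; have /andP[_ ev] := even_weights i.
have [lt|ge] := ltP (d2 i) 0.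
  by apply: (@row_below (st i) `|(- d2 i - 2) %/ 2|%Z%N); rewrite ?d2st; lia.
by apply: (@row_below i `|(d2 i - 2) %/ 2|%Z%N); lia.
Qed.

Lemma row_rmin_eq i j : d2 i != 0 -> d2 i = d2 j -> rmin i = rmin j.
Proof.
move=> i0 e2; have [i2 imin] := rminP i; have [j2 jmin] := rminP j.
apply: thin_nz; rewrite ?i2 ?j2 //; first by right.
by have := imin _ (etrans j2 (esym e2)); have := jmin _ (etrans i2 e2); lia.
Qed.

Lemma rmax_st i : d1 (rmax (st i)) = - d1 (rmin i).
Proof. by rewrite -[i in RHS]stK rmin_st opprK. Qed.

Lemma row_rmax_eq i j : d2 i != 0 -> d2 i = d2 j -> rmax i = rmax j.
Proof.
move=> i0 e2; have [i2 imax] := rmaxP i; have [j2 jmax] := rmaxP j.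
apply: thin_nz; rewrite ?i2 ?j2 //; first by right.
by have := imax _ (etrans j2 (esym e2)); have := jmax _ (etrans i2 e2); lia.
Qed.

(** Applying x^m carries the arrow to the right end of the target row, and commuting with y yields a
    source at the same first weight. *)
Lemma link_rmax k j : y k j != 0 -> d2 k != 0 -> d1 (rmax k) <= d1 (rmax j).
Proof.
move=> ykj k0; have [R2 Rmax] := rmaxP k; have [_ Jmax] := rmaxP j.
have Rk := Rmax _ erefl; have e1 := y1 ykj; have e2 := y2 ykj.
have [m em] : exists m : nat, d1 (rmax k) = d1 k + 2 * m%:Z.
  exists `|((d1 (rmax k) - d1 k) %/ 2)%Z|%N.
  by have /andP[] := even_weights k; have /andP[] := even_weights (rmax k); lia.
have : (mxpow x m *m y) (rmax k) j != 0.
  rewrite (@mulmx_entry _ _ _ _ _ _ _ _ k); first by rewrite mulf_neq0 // pow_neq0.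
  move=> l _ yl; apply: thin_nz; rewrite ?(y1 yl) ?(y2 yl) ?e1 ?e2 //.
  by right; rewrite -e2.
rewrite -mxpow_commute // => /mulmx_entry_neq0[l [yl /pow_supp[l1 l2]]].
by have := Jmax l l2; rewrite -(y1 yl).
Qed.

(** If phi kills e_j, it kills p e_j, here a nonzero multiple of e_i. The generation of V is
    expressed through such steps. *)
Lemma kill_step (phi p : 'M[F]_N) i j : p *m phi = phi *m p ->
  (forall k, phi k j = 0) -> p i j != 0 -> (forall k, p k j != 0 -> k = i) ->
  forall k, phi k i = 0.
Proof.
move=> pC phij pij uniq_i k; apply/eqP.
have /eqP : (phi *m p) k j = 0 by rewrite -pC mxE big1 // => l _; rewrite phij mulr0.
rewrite (@mulmx_entry _ _ _ _ _ _ _ _ i) => [|l _ /uniq_i //].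
by rewrite mulf_eq0 (negPf pij) orbF.
Qed.

Lemma pow_phi (phi : 'M[F]_N) k : brk x phi = 0 -> mxpow x k *m phi = phi *m mxpow x k.
Proof. by move=> xphi; rewrite mxpow_commute //; apply/esym/brk0_comm. Qed.

(** * Nonzero rows are equal symmetric intervals *)

Section NonzeroRows.

Variable r : 'I_N.
Hypothesis r2 : d2 r = 2.
Let g := rmin (st r).

Let g2 : d2 g = -2.
Proof. by rewrite (proj1 (rminP _)) d2st r2. Qed.
Let g1 : d1 g = - d1 (rmax r).
Proof. exact: rmin_st. Qed.
Let r0 : d2 r != 0. Proof. by rewrite r2. Qed.

(** y^2 e_g is nonzero, so row 2 starts no later than g; [row_heavy] gives the opposite
    inequality. *)
Lemma row2_sym : d1 (rmin r) = d1 g.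
Proof.
have [k] := y2_neq0 r2; rewrite -/g => /mulmx_entry_neq0[l [ykl ylg]].
have [_ /(_ k)] := rminP r; rewrite (y1 ykl) (y2 ykl) (y1 ylg) (y2 ylg) g2 r2.
by move=> /(_ erefl); have := row_heavy (i := r); rewrite r2 g1 => /(_ isT); lia.
Qed.

Lemma y2_entry : (y *m y) (rmin r) g != 0.
Proof.
have [k] := y2_neq0 r2; rewrite -/g => yyk; suff <- : k = rmin r by [].
have := yyk => /mulmx_entry_neq0[l [ykl ylg]].
apply: thin_nz; rewrite ?(y1 ykl) ?(y2 ykl) ?(y1 ylg) ?(y2 ylg) ?g2 ?row2_sym //.
  by right.
by rewrite (proj1 (rminP _)) r2.
Qed.

(** Going up, the right end cannot increase by [link_rmax], nor the left end by its dual, while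
    [row_heavy] bounds their sum below. So neither moves. *)
Lemma row_sym i : d2 i != 0 -> d1 (rmin i) = d1 g /\ d1 (rmax i) = - d1 g.
Proof.
have pos (m : nat) k : d2 k = 2 + 2 * m%:Z -> d1 (rmin k) = d1 g /\ d1 (rmax k) = - d1 g.
  elim: m k => [|m IHm] k k2.
    have kr : d2 k = d2 r by rewrite k2 r2.
    by rewrite (@row_rmin_eq k r) ?(@row_rmax_eq k r) ?kr // row2_sym g1 opprK.
  have k0 : 0 < d2 k by rewrite k2; lia.
  have [j [l [ylj l2]]] := row_link k0.
  have j2 : d2 j = 2 + 2 * m%:Z by have := y2 ylj; lia.
  have [Lj Rj] := IHm j j2.
  have l0 : d2 l != 0 by rewrite l2; lia.
  have h1 := link_rmax ylj l0.
  have ylj' : y (st j) (st l) != 0 by rewrite y_st oppr_eq0.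
  have h2 : d1 (rmax (st j)) <= d1 (rmax (st l)).
    by apply: link_rmax ylj' _; rewrite d2st j2; lia.
  rewrite !rmax_st in h2; rewrite (row_rmin_eq l0 l2) in h2; rewrite (row_rmax_eq l0 l2) in h1.
  by have := row_heavy k0; lia.
move=> i0; have /andP[_ ev] := even_weights i; have [i_gt|i_le] := ltP 0 (d2 i).
  by apply: (pos `|((d2 i - 2) %/ 2)%Z|%N); lia.
have [|h1 h2] := (pos `|((- d2 i - 2) %/ 2)%Z|%N (st i)); first by rewrite d2st; lia.
by move: h1 h2; rewrite rmin_st rmax_st; lia.
Qed.

Lemma y_rmin i i' : d2 i != 0 -> d2 i' != 0 -> d2 i' = d2 i + 2 ->
  y (rmin i') (rmin i) != 0.
Proof.
move=> i0 i'0 e2.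
have [k [j [ykj k2]]] : exists k j, y k j != 0 /\ d2 k = d2 i'.
  have [i'_gt|i'_le] := ltP 0 (d2 i').
    by have [j [k [ykj k2]]] := row_link i'_gt; exists k, j.
  have [|j [k [ykj k2]]] := @row_link (st i); first by rewrite d2st; lia.
  exists (st j), (st k); rewrite y_st oppr_eq0 d2st; split=> //.
  by have := y2 ykj; rewrite k2 d2st; lia.
have e1 := y1 ykj; have j2 : d2 j = d2 i by have := y2 ykj; lia.
have [i2 imin] := rminP i; have [i'2 i'min] := rminP i'.
have [m em] : exists m : nat, d1 j = d1 (rmin i) + 2 * m%:Z.
  have := imin j j2; exists `|((d1 j - d1 (rmin i)) %/ 2)%Z|%N.
  by have /andP[] := even_weights j; have /andP[] := even_weights (rmin i); lia.
have : (y *m mxpow x m) k (rmin i) != 0.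
  rewrite (@mulmx_entry _ _ _ _ _ _ _ _ j); first by rewrite mulf_neq0 // pow_neq0 ?i2 ?j2.
  move=> l yl /pow_supp[l1 l2]; apply: thin_nz; rewrite ?l1 ?l2 ?em ?j2 ?i2 //.
  by right.
rewrite mxpow_commute // => /mulmx_entry_neq0[l [/pow_supp[l1 l2] yl]].
suff <- : l = rmin i' by [].
apply: thin_nz; rewrite ?(y1 yl) ?i'2 -?l2 ?k2 //; first by right.
by rewrite (row_sym i0).1 (row_sym i'0).1.
Qed.

Lemma pred_row b i : (forall k, d2 b <= d2 k) -> d2 b < d2 i ->
  exists i', d2 i' = d2 i - 2.
Proof.
move=> bmin bi; have [i_gt|i_le] := ltP 0 (d2 i).
  by have [j [l [ylj l2]]] := row_link i_gt; exists j; have := y2 ylj; lia.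
have /andP[_ ev] := even_weights i; have /andP[_ evb] := even_weights b.
have [||p p2] := @row_below (st b) `|((d2 i - d2 b - 2) %/ 2)%Z|%N (2 - d2 i);
  rewrite ?d2st; try lia.
by exists (st p); rewrite d2st p2; lia.
Qed.

Lemma hit_row b i : (forall k, d2 b <= d2 k) -> d2 i != 0 -> i != rmin b ->
  exists j, x i j != 0 \/ y i j != 0.
Proof.
move=> bmin i0 ib; have [L2 /(_ i erefl) Li] := rminP i.
have [eL|nL] := eqVneq (rmin i) i; last first.
  have [|||| j xj] := @row_connected (st i) (st (rmin i)).
  - by rewrite d2st oppr_eq0.
  - by rewrite !d2st L2.
  - rewrite !d1st ltrN2 lt_neqAle Li andbT; apply: contraNneq nL => e.
    by apply/eqP/thin_nz; rewrite ?L2 //; right.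
  - rewrite !d1st; have /andP[] := even_weights i; have /andP[] := even_weights (rmin i).
    by lia.
  by exists (st j); left; rewrite -[i]stK x_st oppr_eq0 -[j]stK stK.
have bi : d2 b < d2 i.
  rewrite lt_neqAle bmin andbT; apply: contraNneq ib => e.
  by rewrite -eL (@row_rmin_eq i b).
have [i2|i2] := eqVneq (d2 i) 2.
  have /mulmx_entry_neq0[l [yl _]] := y2_entry; exists l; right.
  by rewrite -eL (@row_rmin_eq i r) // r2.
have [i' i'2] := pred_row bmin bi; exists (rmin i'); right; rewrite -{1}eL.
by apply: y_rmin; rewrite ?i'2; lia.
Qed.

Section Kill.

Variable phi : 'M[F]_N.
Hypotheses (xphi : brk x phi = 0) (yphi : brk y phi = 0).

Lemma kill_row i : d2 i != 0 -> (forall k, phi k (rmin i) = 0) -> forall k, phi k i = 0.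
Proof.
move=> i0; have [L2 /(_ i erefl) Li] := rminP i.
have [m em] : exists m : nat, d1 i = d1 (rmin i) + 2 * m%:Z.
  exists `|((d1 i - d1 (rmin i)) %/ 2)%Z|%N.
  by have /andP[] := even_weights i; have /andP[] := even_weights (rmin i); lia.
move=> /(kill_step (pow_phi m xphi)); apply; first by apply: pow_neq0; rewrite ?L2.
by move=> k /pow_supp[k1 k2]; apply: thin_nz; rewrite ?k1 ?k2 ?L2 //; right.
Qed.

Lemma kill_up i i' : d2 i != 0 -> d2 i' != 0 -> d2 i' = d2 i + 2 ->
  (forall k, phi k (rmin i) = 0) -> forall k, phi k (rmin i') = 0.
Proof.
move=> i0 i'0 e2; have [i2 _] := rminP i; have [i'2 _] := rminP i'.
move=> /(kill_step (brk0_comm yphi)); apply; first exact: y_rmin.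
move=> k yk; apply: thin_nz; rewrite ?(y1 yk) ?(y2 yk) ?i2 ?i'2 ?e2 //.
  by right; rewrite -e2.
by rewrite (row_sym i0).1 (row_sym i'0).1.
Qed.

(** y^2 jumps over row 0, whose vectors need not be generated from below. *)
Lemma kill_across : (forall k, phi k g = 0) -> forall k, phi k (rmin r) = 0.
Proof.
have yyC : (y *m y) *m phi = phi *m (y *m y).
  by rewrite -mulmxA (brk0_comm yphi) !mulmxA (brk0_comm yphi).
move=> /(kill_step yyC); apply; first exact: y2_entry.
move=> k /mulmx_entry_neq0[l [ykl ylg]]; apply: thin_nz.
- by right; rewrite (y2 ykl) (y2 ylg) g2.
- by rewrite (y1 ykl) (y1 ylg) row2_sym.
by rewrite (y2 ykl) (y2 ylg) g2 (proj1 (rminP r)) r2.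
Qed.

Lemma kill_rows b : (forall k, d2 b <= d2 k) -> (forall k, phi k (rmin b) = 0) ->
  forall i, d2 i != 0 -> forall k, phi k i = 0.
Proof.
move=> bmin phib; have bst : d2 b <= -2 by have := bmin (st r); rewrite d2st r2.
have ev i : (2 %| d2 i)%Z by have /andP[] := even_weights i.
suff h (m : nat) i : d2 i = d2 b + 2 * m%:Z -> d2 i != 0 -> forall k, phi k (rmin i) = 0.
  move=> i i0; apply: kill_row => //; apply: (h `|((d2 i - d2 b) %/ 2)%Z|%N) => //.
  by have := bmin i; have := ev i; have := ev b; lia.
have [k ltmk] := ubnP m; elim: k => // k IHk in m i ltmk *.
case: m ltmk => [|m] ltmk e2 i0.
  by rewrite (@row_rmin_eq i b) // e2; lia.
have [i2|ni2] := eqVneq (d2 i) 2.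
  rewrite (@row_rmin_eq i r) ?i2 //; apply: kill_across.
  case: m ltmk e2 => [|m] ltmk e2; first by lia.
  by apply: (IHk m); rewrite ?d2st ?r2; lia.
have [|i' i'2] := pred_row bmin (i := i); first lia.
by apply: (@kill_up i'); [lia| |lia|apply: (IHk m); lia].
Qed.

End Kill.

End NonzeroRows.

Section RowZero.

Variable h : 'I_N.
Hypotheses (h2 : d2 h = 0) (h1 : d1 h < 0).
Hypothesis hmin : forall i, d2 i = 0 -> d1 h <= d1 i.

Lemma row0_thin i j : d1 i != 0 -> d2 i = 0 -> d1 i = d1 j -> d2 j = 0 -> i = j.
Proof. by move=> i1 i2 e1 j2; apply: thin_nz; [left| |rewrite i2 j2]. Qed.

Lemma chain_neg k : d1 h + 2 * k%:Z < 0 -> exists i, mxpow x k i h != 0.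
Proof.
elim: k => [|k IHk] k0; first by exists h; rewrite mxE eqxx oner_neq0.
have [|i xi] := IHk; first by lia.
have [i1 i2] := pow_supp xi; have [||l xl] := @row0_left i; rewrite ?i1 ?i2 //; first lia.
exists l; rewrite mxpowS (@mulmx_entry _ _ _ _ _ _ _ _ i) ?mulf_neq0 // => m _ /pow_supp[m1 m2].
by apply: row0_thin; rewrite ?m1 ?m2 ?i1 ?i2 //; lia.
Qed.

(** From weight -2, [no_loop] carries the string of e_h across the plane of weight 0. Beyond it, the
    arrows are the duals of those on the negative side. *)
Lemma row0_chain : exists K, [/\ on_zero (mxpow x K *m e_ h),
  x *m (mxpow x K *m e_ h) != 0 &
  forall i, d2 i = 0 -> d1 i != 0 -> exists k, mxpow x k i h != 0].
Proof.
have [K eK] : exists K : nat, d1 h = - (2 * K.+1%:Z).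
  by exists `|((- d1 h - 2) %/ 2)%Z|%N; have /andP[] := even_weights h; lia.
have [|i xi] := @chain_neg K; first by rewrite eK; lia.
have [i1 i2] := pow_supp xi; rewrite h2 eK in i1 i2.
have [p xxp] : exists p, (x *m x) p i != 0.
  have [/existsP[p xp]|/existsPn xx0] := boolP [exists p, (x *m x) p i != 0]; first by exists p.
  exfalso; apply: (@no_loop i) => //; first lia.
  by apply/matrixP => p q; rewrite ord1 mulmxA mul_colE [RHS]mxE; apply/eqP; rewrite -[_ == _]negbK.
have pow_p : mxpow x K.+2 p h != 0.
  rewrite !mxpowS mulmxA (@mulmx_entry _ _ _ _ _ _ _ _ i) ?mulf_neq0 // => m _ /pow_supp[m1 m2].
  by apply: row0_thin; rewrite ?m1 ?m2 ?i1 ?i2 ?h2 //; lia.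
exists K.+1; split=> [j|  |j j2 j1].
- rewrite mul_colE => /pow_supp[j1 j2].
  by apply: zero_weight; rewrite ?j1 ?j2 // eK; lia.
- apply: contraNneq pow_p => xx0; rewrite mxpowS -[_ *m _]mulmx1.
  by rewrite -mul_colE mulmx1 -mulmxA xx0 mxE.
have [lt0|gt0|e0] := ltgtP (d1 j) 0; last by rewrite e0 in j1.
  have [k ek] : exists k : nat, d1 j = d1 h + 2 * k%:Z.
    have := hmin j2; exists `|((d1 j - d1 h) %/ 2)%Z|%N.
    by have /andP[] := even_weights h; have /andP[] := even_weights j; lia.
  have [|l xl] := @chain_neg k; first by rewrite -ek.
  have [l1 l2] := pow_supp xl; exists k; suff -> : j = l by [].
  by apply: row0_thin; rewrite ?l1 ?l2.
have [m em] : exists m : nat, d1 j = 2 + 2 * m%:Z.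
  by exists `|((d1 j - 2) %/ 2)%Z|%N; have /andP[] := even_weights j; lia.
exists (K.+2 + m)%N; elim: m j j1 j2 em gt0 => [|m IHm] j j1 j2 em gt0.
  have [p1 p2] := pow_supp pow_p; rewrite addn0.
  by suff -> : j = p by []; apply: row0_thin; rewrite ?p1 ?p2 ?em ?eK //; lia.
have [||k xk] := @row0_left (st j); rewrite ?d1st ?d2st ?j2 ?oppr0 //; first lia.
have xjk : x j (st k) != 0 by rewrite -[j]stK x_st oppr_eq0.
have [e1 e2] := (x1 xjk, x2 xjk).
rewrite addnS mxpowS (@mulmx_entry _ _ _ _ _ _ _ _ (st k)).
  by rewrite mulf_neq0 // IHm //; lia.
by move=> l xl _; apply: row0_thin; rewrite -?(x2 xl) // -?e2 //; have := x1 xl; lia.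
Qed.

Lemma hit_row0 i : d2 i = 0 -> d1 i != 0 -> i != h -> exists j, x i j != 0.
Proof.
move=> i2 i1 ih; have [K [_ _ /(_ i i2 i1)[[|k]]]] := row0_chain.
  by rewrite mxE (negPf ih) eqxx.
by rewrite mxpowS => /mulmx_entry_neq0[j [xj _]]; exists j.
Qed.

Lemma kill_row0 phi : brk x phi = 0 -> (forall k, phi k h = 0) ->
  forall i, d2 i = 0 -> d1 i != 0 -> forall k, phi k i = 0.
Proof.
move=> xphi phih i i2 i1; have [K [_ _ /(_ i i2 i1)[k xk]]] := row0_chain.
apply: (kill_step (pow_phi k xphi) phih xk) => l /pow_supp[l1 l2].
have [e1 e2] := pow_supp xk.
by apply/esym/row0_thin; rewrite ?l1 ?l2.
Qed.

End RowZero.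

(** * Bounds on the centralizer in gl_N *)

Lemma kill_mul phi (p : 'M[F]_N) j : p *m phi = phi *m p ->
  (forall k, phi k j = 0) -> phi *m (p *m e_ j) = 0.
Proof.
move=> pC phij; rewrite mulmxA -pC -mulmxA; apply/matrixP => k l.
by rewrite ord1 mxE big1 ?mxE // => m _; rewrite mul_colE phij mulr0.
Qed.

Lemma mul_on_zero2 (a : 'M[F]_N) u k m : on_zero u -> m = o \/ m = st o ->
  (a *m u) k 0 = a k m * u m 0 + a k (st m) * u (st m) 0.
Proof. by move=> u0 [] ->; rewrite mul_on_zero // stK addrC. Qed.

(** The determinant of w and z in the plane spanned by e_o and e_(st o). *)
Definition zdet (w z : 'cV[F]_N) := w o 0 * z (st o) 0 - w (st o) 0 * z o 0.

Lemma zdet_neq0 (a : 'M[F]_N) w z m : on_zero w -> on_zero z -> w m 0 != 0 ->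
  a *m w = 0 -> a *m z != 0 -> zdet w z != 0.
Proof.
move=> w0 z0 wm aw; apply: contraNneq => D0.
apply/eqP/matrixP => k j; rewrite ord1 [RHS]mxE mul_on_zero //.
have /eqP := congr1 (fun v : 'cV_N => v k 0) aw.
rewrite mul_on_zero // [in X in _ == X]mxE => /eqP e.
have [f1 f2] : w o 0 * (a k o * z o 0 + a k (st o) * z (st o) 0) = 0 /\
    w (st o) 0 * (a k o * z o 0 + a k (st o) * z (st o) 0) = 0.
  split.
    have -> : w o 0 * (a k o * z o 0 + a k (st o) * z (st o) 0) =
      z o 0 * (a k o * w o 0 + a k (st o) * w (st o) 0) + a k (st o) * zdet w z.
      by rewrite /zdet; ring.
    by rewrite e D0 !mulr0 addr0.
  have -> : w (st o) 0 * (a k o * z o 0 + a k (st o) * z (st o) 0) =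
    z (st o) 0 * (a k o * w o 0 + a k (st o) * w (st o) 0) - a k o * zdet w z.
    by rewrite /zdet; ring.
  by rewrite e D0 !mulr0 subr0.
have : w m 0 * (a k o * z o 0 + a k (st o) * z (st o) 0) = 0.
  by case: (w0 m wm) => ->.
by move/eqP; rewrite mulf_eq0 (negPf wm) => /eqP.
Qed.

Lemma on_zero_ker (a : 'M[F]_N) w z v m : on_zero w -> on_zero z -> on_zero v ->
  a *m w = 0 -> a *m z != 0 -> a *m v = 0 -> w m 0 != 0 -> v m 0 = 0 -> v = 0.
Proof.
move=> w0 z0 v0 aw az av wm vm; have mo := w0 m wm.
have [vsm|vsm] := eqVneq (v (st m) 0) 0.
  apply/matrixP => i j; rewrite ord1 mxE; apply/eqP; apply: contraT => vi.
  have := v0 i vi; case: mo vi vm vsm => -> vi vm vsm [] ei; move: vi; rewrite ei ?stK in vm vsm *;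
  by rewrite ?vm ?vsm eqxx.
case/eqP: az; apply/matrixP => k j; rewrite ord1 [RHS]mxE (@mul_on_zero2 _ _ _ m) //.
have /eqP := congr1 (fun u : 'cV_N => u k 0) av.
rewrite (@mul_on_zero2 _ _ _ m) // [in X in _ == X]mxE vm mulr0 add0r.
rewrite mulf_eq0 (negPf vsm) orbF => /eqP asm.
have /eqP := congr1 (fun u : 'cV_N => u k 0) aw.
rewrite (@mul_on_zero2 _ _ _ m) // [in X in _ == X]mxE asm mul0r addr0.
by rewrite mulf_eq0 (negPf wm) orbF => /eqP ->; rewrite !mul0r addr0.
Qed.

Lemma zdet_kill (phi : 'M[F]_N) w z : on_zero w -> on_zero z -> zdet w z != 0 ->
  phi *m w = 0 -> phi *m z = 0 -> forall k, phi k o = 0 /\ phi k (st o) = 0.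
Proof.
move=> w0 z0 D0 pw pz k.
have /eqP := congr1 (fun u : 'cV_N => u k 0) pw.
have /eqP := congr1 (fun u : 'cV_N => u k 0) pz.
rewrite !mul_on_zero // [in X in _ == X]mxE => /eqP ez.
rewrite [in X in _ == X]mxE => /eqP ew.
split; apply: (mulfI D0); rewrite mulr0.
  have -> : zdet w z * phi k o = z (st o) 0 * (phi k o * w o 0 + phi k (st o) * w (st o) 0)
    - w (st o) 0 * (phi k o * z o 0 + phi k (st o) * z (st o) 0) by rewrite /zdet; ring.
  by rewrite ew ez !mulr0 subr0.
have -> : zdet w z * phi k (st o) = w o 0 * (phi k o * z o 0 + phi k (st o) * z (st o) 0)
  - z o 0 * (phi k o * w o 0 + phi k (st o) * w (st o) 0) by rewrite /zdet; ring.
by rewrite ew ez !mulr0 subr0.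
Qed.

Lemma ker_coord_x v k i : x *m v = 0 -> x k i != 0 -> d1 i != 0 \/ d2 i != 0 -> v i 0 = 0.
Proof.
move=> xv xki nz; have /eqP : (x *m v) k 0 = 0 by rewrite xv mxE.
rewrite (@mulmx_entry _ _ _ _ _ _ _ _ i).
  by rewrite mulf_eq0 (negPf xki) => /eqP.
by move=> l xkl _; apply/esym/thin_nz => //; [have := x1 xkl; have := x1 xki; lia|
  rewrite -(x2 xkl) (x2 xki)].
Qed.

Lemma ker_coord_y v k i : y *m v = 0 -> y k i != 0 -> d1 i != 0 \/ d2 i != 0 -> v i 0 = 0.
Proof.
move=> yv yki nz; have /eqP : (y *m v) k 0 = 0 by rewrite yv mxE.
rewrite (@mulmx_entry _ _ _ _ _ _ _ _ i).
  by rewrite mulf_eq0 (negPf yki) => /eqP.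
by move=> l ykl _; apply/esym/thin_nz => //; [rewrite -(y1 ykl) (y1 yki)|
  have := y2 ykl; have := y2 yki; lia].
Qed.

Notation Zgl := (cent x :&: cent y)%VS.

Lemma mem_Zgl X : (X \in Zgl) = (brk x X == 0) && (brk y X == 0).
Proof. by rewrite memv_cap !mem_cent. Qed.

Lemma zero_weightN i : i != o -> i != st o -> d1 i != 0 \/ d2 i != 0.
Proof.
move=> io iso; have [i1|] := eqVneq (d1 i) 0; last by left.
have [i2|] := eqVneq (d2 i) 0; last by right.
by case: (zero_weight i1 i2) => e; rewrite e eqxx in io iso.
Qed.

Lemma on_zero_intro v : (forall i, d1 i != 0 \/ d2 i != 0 -> v i 0 = 0) -> on_zero v.
Proof.
move=> v0 i vi; apply: zero_weight; apply/eqP; apply: contraNT vi => nz; rewrite v0 ?eqxx //.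
  by left.
by right.
Qed.

Lemma col_eq0 (phi : 'M[F]_N) j : phi *m e_ j = 0 -> forall k, phi k j = 0.
Proof. by move=> p0 k; rewrite -mul_colE p0 mxE. Qed.

Lemma eq0_zdet_kill (phi : 'M[F]_N) w z : on_zero w -> on_zero z -> zdet w z != 0 ->
  phi *m w = 0 -> phi *m z = 0 ->
  (forall i, d1 i != 0 \/ d2 i != 0 -> forall k, phi k i = 0) -> phi = 0.
Proof.
move=> w0 z0 D0 pw pz p0; apply/matrixP => k i; rewrite mxE.
have [po pso] := zdet_kill w0 z0 D0 pw pz k.
have [->//|io] := eqVneq i o; have [->//|iso] := eqVneq i (st o).
by apply: p0; apply: zero_weightN.
Qed.

(* Here V is generated by e_g and by a vector w killed by x and y, and the common
   kernel of x and y is spanned by w and e_top. *)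
Lemma dim_cyclic g top (a : 'M[F]_N) w z m :
  (forall phi, brk x phi = 0 -> brk y phi = 0 -> (forall k, phi k g = 0) ->
     (forall i, d1 i != 0 \/ d2 i != 0 -> forall k, phi k i = 0) /\ phi *m z = 0) ->
  on_zero z -> on_zero w -> w m 0 != 0 -> x *m w = 0 -> y *m w = 0 ->
  a = x \/ a = y -> a *m z != 0 ->
  (forall i, d1 i != 0 \/ d2 i != 0 -> i != top -> exists k, x k i != 0 \/ y k i != 0) ->
  (\dim Zgl <= N + 2)%N.
Proof.
move=> kill z0 w0 wm xw yw axy az soc.
have aw : a *m w = 0 by case: axy => ->.
have D0 := zdet_neq0 w0 z0 wm aw az.
(* Only basis vectors index columns, so w is replaced by e_m', chosen outside the line of z; [ep]
   times e_m' is then a combination of w and z. *)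
have [m' [mo zm']] : exists m', (m' = o \/ m' = st o) /\ z (st m') 0 != 0.
  have [zo|zo] := eqVneq (z o 0) 0; last by exists (st o); rewrite stK; split; [right|].
  exists o; split; first by left.
  by apply: contraNneq D0 => zso; rewrite /zdet zo zso !mulr0 subrr.
have -> : (N + 2 = #|{: 'I_N + bool}|)%N by rewrite card_sum card_ord card_bool.
(* Column g, and two coordinates of phi e_m', which lies in the common kernel once phi e_g = 0:
   those on e_top and on the line of w. *)
pose pos (k : 'I_N + bool) := match k with inl i => (i, g)
  | inr b => (if b then top else m, m') end.
apply: (@dim_le_entries _ _ _ pos) => phi; rewrite mem_Zgl => /andP[/eqP xp /eqP yp] p0.
have [killed pz] := kill phi xp yp (fun k => p0 (inl k)).
pose ep := z (st m') 0 * w m' 0 - w (st m') 0 * z m' 0.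
have eE : ep *: e_ m' = z (st m') 0 *: w - w (st m') 0 *: z.
  apply/matrixP => i j; rewrite ord1 !mxE andbT.
  have [->|im] := eqVneq i m'; first by rewrite mulr1 /ep.
  have [->|ism] := eqVneq i (st m'); first by rewrite mulr0; ring.
  have off u : on_zero u -> u i 0 = 0.
    move=> u0; apply/eqP; apply: contraT => /u0 ii; move: im ism.
    by case: mo => ->; case: ii => ->; rewrite ?stK eqxx.
  by rewrite !off // !mulr0 subrr.
have ep0 : ep != 0.
  apply: contraNneq wm => ep0; rewrite ep0 scale0r in eE.
  have wn : w (st m') 0 = 0.
    have /eqP : a *m (z (st m') 0 *: w - w (st m') 0 *: z) = 0 by rewrite -eE mulmx0.
    rewrite mulmxBr -!scalemxAr aw scaler0 sub0r oppr_eq0 scaler_eq0 (negPf az) orbF.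
    by move/eqP.
  move/esym/eqP: eE; rewrite wn scale0r subr0 scaler_eq0 (negPf zm') /= => /eqP ->.
  by rewrite mxE.
have phie (b : 'M[F]_N) : b *m phi = phi *m b -> b *m w = 0 -> b *m (phi *m e_ m') = 0.
  move=> bp bw; apply: (scalerI ep0); rewrite scaler0 scalemxAr scalemxAr eE.
  by rewrite mulmxBr -!scalemxAr pz scaler0 subr0 -scalemxAr mulmxA bp -mulmxA bw
    mulmx0 scaler0.
have xv := phie x (brk0_comm xp) xw; have yv := phie y (brk0_comm yp) yw.
have v0 : on_zero (phi *m e_ m').
  apply: on_zero_intro => i nz; have [->|ne] := eqVneq i top.
    by rewrite mul_colE; apply: (p0 (inr true)).
  by have [k [xk|yk]] := soc i nz ne; [apply: ker_coord_x xv xk nz|apply: ker_coord_y yv yk nz].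
have v_0 : phi *m e_ m' = 0.
  apply: (on_zero_ker w0 z0 v0 aw az _ wm).
    by case: axy => ->.
  by rewrite mul_colE; apply: (p0 (inr false)).
apply: (eq0_zdet_kill w0 z0 D0 _ pz killed).
apply: (scalerI zm'); rewrite scaler0 scalemxAr.
have -> : z (st m') 0 *: w = ep *: e_ m' + w (st m') 0 *: z by rewrite eE subrK.
by rewrite mulmxDr -!scalemxAr pz v_0 !scaler0 addr0.
Qed.

(* Here V is generated by e_g, which x kills, and e_h, which y kills. *)
Lemma dim_cent_cross g h tx ty z1 z2 m1 m2 :
  (forall phi, brk x phi = 0 -> brk y phi = 0 ->
     (forall k, phi k g = 0) -> (forall k, phi k h = 0) ->
     [/\ forall i, d1 i != 0 \/ d2 i != 0 -> forall k, phi k i = 0,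
         phi *m z1 = 0 & phi *m z2 = 0]) ->
  (forall k, x k g = 0) -> (forall k, y k h = 0) ->
  on_zero z1 -> on_zero z2 -> z1 m1 0 != 0 -> z2 m2 0 != 0 ->
  x *m z1 = 0 -> x *m z2 != 0 -> y *m z2 = 0 -> y *m z1 != 0 ->
  (forall i, d1 i = 0 \/ d2 i = 0) ->
  (forall i, d1 i != 0 -> i != tx -> exists k, x k i != 0) ->
  (forall i, d2 i != 0 -> i != ty -> exists k, y k i != 0) ->
  (\dim Zgl <= N + 2)%N.
Proof.
move=> kill xg yh z10 z20 z1m z2m xz1 xz2 yz2 yz1 wt socx socy.
have D0 := zdet_neq0 z10 z20 z1m xz1 xz2.
have -> : (N + 2 = #|{: 'I_N + bool}|)%N by rewrite card_sum card_ord card_bool.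
(* phi e_g lies in the kernel of x: its coordinates are those with d1 = 0 outside the plane, one on
   the line of z1 and one on [tx]. Likewise for phi e_h with y. The two lists share out the N
   indices and add [tx] and [ty]. *)
pose pos (k : 'I_N + bool) := match k with
  | inl i => if i == o then (m1, g) else if i == st o then (m2, h)
             else if d1 i == 0 then (i, g) else (i, h)
  | inr b => if b then (tx, g) else (ty, h) end.
apply: (@dim_le_entries _ _ _ pos) => phi; rewrite mem_Zgl => /andP[/eqP xp /eqP yp] p0.
have pos_o := p0 (inl o); have pos_so := p0 (inl (st o)).
rewrite /pos eqxx /= in pos_o; rewrite /pos (negPf (st_neq o)) eqxx /= in pos_so.
have pos_i i : d1 i != 0 \/ d2 i != 0 -> phi i (if d1 i == 0 then g else h) = 0.
  move=> nz; have := p0 (inl i); rewrite /pos.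
  have -> : i == o = false.
    by apply/eqP => e; move: nz; rewrite e o1 o2 eqxx => -[].
  have -> : i == st o = false.
    by apply/eqP => e; move: nz; rewrite e d1st d2st o1 o2 oppr0 eqxx => -[].
  by case: ifP.
have kerv (b : 'M[F]_N) j : b *m phi = phi *m b -> (forall k, b k j = 0) ->
    b *m (phi *m e_ j) = 0.
  by move=> bp bj; rewrite mulmxA bp -mulmxA; apply/matrixP => k l;
     rewrite mxE big1 ?mxE // => q _; rewrite ord1 mul_colE bj mulr0.
have xv := kerv _ _ (brk0_comm xp) xg; have yv := kerv _ _ (brk0_comm yp) yh.
have phig : phi *m e_ g = 0.
  apply: (on_zero_ker z10 z20 _ xz1 xz2 xv z1m); last by rewrite mul_colE.
  apply: on_zero_intro => i nz; have [i1|i1] := eqVneq (d1 i) 0.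
    by rewrite mul_colE; have := pos_i i nz; rewrite i1 eqxx.
  have [->|ne] := eqVneq i tx; first by rewrite mul_colE; apply: (p0 (inr true)).
  by have [k xk] := socx i i1 ne; apply: ker_coord_x xv xk nz.
have phih : phi *m e_ h = 0.
  apply: (on_zero_ker z20 z10 _ yz2 yz1 yv z2m); last by rewrite mul_colE.
  apply: on_zero_intro => i nz; have [i1|i1] := eqVneq (d1 i) 0; last first.
    by rewrite mul_colE; have := pos_i i nz; rewrite (negPf i1).
  have i2 : d2 i != 0 by case: nz => //; rewrite i1 eqxx.
  have [->|ne] := eqVneq i ty; first by rewrite mul_colE; apply: (p0 (inr false)).
  by have [k yk] := socy i i2 ne; apply: ker_coord_y yv yk nz.
have [killed p1 p2] := kill phi xp yp (col_eq0 phig) (col_eq0 phih).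
exact: (eq0_zdet_kill z10 z20 D0 p1 p2 killed).
Qed.

(** To the n diagonal elements are added E_(o, st o) and E_(st o, o), self-adjoint and of degree
    0. *)
Lemma dim_sym_cent : (n + 2 <= \dim (cent2 x y sym))%N.
Proof.
apply: (@leq_trans (\dim (deg00 d1 d2 sym))).
  apply: leq_trans (leq_add (dim_dag_diag stK st_neq N2n two_neq0 (or_introl (erefl 1)))
    (leqnn 2)) _.
  have memd i : d1 i = 0 -> d2 i = 0 -> delta_mx i (st i) \in deg00 d1 d2 sym.
    move=> i1 i2; rewrite /deg00 !memv_cap mem_sym (@dag_delta F _ _ stK) stK eqxx /=.
    by apply/andP; split; apply/mem_supp => a b /delta_mx_neq0[-> ->];
       rewrite /deg_eq /= ?d1st ?d2st ?i1 ?i2 subrr.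
  apply: (@dim_add2 _ _ _ _ (delta_mx o (st o)) (delta_mx (st o) o) o (st o) (st o) o).
  - apply/subvP => X; rewrite /deg00 !memv_cap => /andP[-> /mem_supp Xd].
    by apply/andP; split; apply/mem_supp => i j /Xd /eqP ->; rewrite /deg_eq /= subrr.
  - exact: memd.
  - by rewrite -{2}[o]stK; apply: memd; rewrite ?d1st ?d2st ?o1 ?o2 oppr0.
  - move=> Y; rewrite memv_cap => /andP[_ /mem_supp Yd].
    by split; apply/eqP; apply: contraT => /Yd /=; rewrite ?[o == _]eq_sym (negPf (st_neq o)).
  - by rewrite mxE !eqxx oner_neq0.
  - by rewrite mxE (negPf (st_neq o)).
  by rewrite mxE !eqxx oner_neq0.
apply: leq_trans (dim_quad_le two_gt0 x1 x2 y1 y2 xyC (U := sym) _ _) _.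
- by move=> X; apply: brk_dagsub.
- by move=> X; apply: brk_dagsub.
by apply: dimvS; apply/subvP => X; rewrite mem_quad => /and3P[].
Qed.

Lemma dim_so_gl : (\dim Zgl <= N + 2)%N -> (\dim Z <= n)%N.
Proof.
move=> le_gl; have : (\dim Z + \dim (cent2 x y sym) <= \dim Zgl)%N.
  apply: dim_sum_le.
  - by apply/subvP => X; rewrite mem_cent2 mem_Zgl => /andP[_].
  - by apply/subvP => X; rewrite mem_cent2 mem_Zgl => /andP[_].
  move=> X; rewrite !mem_cent2 => /andP[Xso _] /andP[Xsym _].
  exact: (so_sym_disjoint two_neq0 Xso Xsym).
by have := dim_sym_cent; lia.
Qed.

Lemma x_st_neq0 i j : x (st i) j != 0 -> x (st j) i != 0.
Proof. by rewrite -{2}[i]stK x_st oppr_eq0. Qed.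

Lemma y_st_neq0 i j : y (st i) j != 0 -> y (st j) i != 0.
Proof. by rewrite -{2}[i]stK y_st oppr_eq0. Qed.

Lemma soc_row0 h i : d2 h = 0 -> d1 h < 0 -> (forall i, d2 i = 0 -> d1 h <= d1 i) ->
  d2 i = 0 -> d1 i != 0 -> i != st h -> exists k, x k i != 0.
Proof.
move=> h2 h1 hmin i2 i1 ih.
have [|||j xj] := hit_row0 h2 h1 hmin (i := st i).
- by rewrite d2st i2 oppr0.
- by rewrite d1st oppr_eq0.
- by rewrite (can2_eq stK stK).
by exists (st j); apply: x_st_neq0.
Qed.

Lemma soc_rows r b i : d2 r = 2 -> (forall k, d2 b <= d2 k) ->
  d2 i != 0 -> i != st (rmin b) -> exists k, x k i != 0 \/ y k i != 0.
Proof.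
move=> r2 bmin i2 ib; have [||j xyj] := hit_row r2 bmin (i := st i).
- by rewrite d2st oppr_eq0.
- by rewrite (can2_eq stK stK).
by exists (st j); case: xyj => ?; [left; apply: x_st_neq0|right; apply: y_st_neq0].
Qed.

Lemma dim_gl_one_row : (forall i, d2 i = 0) -> (\dim Zgl <= N + 2)%N.
Proof.
move=> all0; pose h := rmin o.
have [h2 hmin] := rminP o; rewrite -/h o2 in h2 hmin.
have h1 : d1 h < 0.
  have [k [ko kso]] : exists k, k != o /\ k != st o.
    have : ~~ ([set: 'I_N] \subset [set o; st o]).
      apply: contraL n_gt1 => /subset_leq_card; rewrite cardsT card_ord cards2.
      by move: N2n; case: (_ != _) => /=; lia.
    by case/subsetPn => k _; rewrite !inE negb_or => /andP[? ?]; exists k.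
  have := hmin k (all0 k); have := hmin (st k) (all0 _); rewrite d1st.
  by have := zero_weightN ko kso; rewrite all0 eqxx => -[]//; lia.
have [K [z0 xz chain]] := row0_chain h2 h1 hmin.
have [w [w0 [m wm] xw]] := kernel_x.
have yE k l : y k l = 0.
  by apply/eqP; apply: contraT => /y2; rewrite !all0.
apply: (@dim_cyclic h (st h) x w _ m _ z0 w0 wm xw _ (or_introl erefl) xz) => [phi xp yp ph||i].
- split; last exact: kill_mul (pow_phi K xp) ph.
  by move=> i nz; apply: (kill_row0 h2 h1 hmin xp ph) => //; case: nz; rewrite ?all0 ?eqxx.
- by apply/matrixP => k l; rewrite !mxE big1 // => q _; rewrite yE mul0r.
rewrite all0 eqxx => -[]// i1 ih.
by have [k xk] := soc_row0 h2 h1 hmin (all0 i) i1 ih; exists k; left.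
Qed.

Section Rows.

Variables (r b : 'I_N).
Hypotheses (r2 : d2 r = 2) (bmin : forall k, d2 b <= d2 k).
Let g := rmin b.
Let g2 := rmin (st r).

Let b0 : d2 b != 0.
Proof. by have := bmin (st r); rewrite d2st r2; lia. Qed.
Let g22 : d2 g2 = -2.
Proof. by rewrite (proj1 (rminP _)) d2st r2. Qed.

Lemma kill_from_bottom phi : brk x phi = 0 -> brk y phi = 0 -> (forall k, phi k g = 0) ->
  (forall i, d2 i != 0 -> forall k, phi k i = 0) /\ phi *m (y *m e_ g2) = 0.
Proof.
move=> xp yp pg; have pr := kill_rows r2 xp yp bmin pg; split=> //.
by apply: kill_mul (brk0_comm yp) _; apply: pr; rewrite g22.
Qed.

(** The path of y^2 e_g2 goes through h in row 0, so e_g generates row 0 too, up to the plane of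
    weight 0, where w has to be added. *)
Lemma dim_gl_wide : d1 g2 < 0 -> (\dim Zgl <= N + 2)%N.
Proof.
move=> lt0; have /mulmx_entry_neq0[h [yrh yhg]] := y2_entry r2.
rewrite -/g2 in yhg.
have h1 : d1 h = d1 g2 := y1 yhg; have h2 : d2 h = 0 by rewrite (y2 yhg) g22.
have h_neg : d1 h < 0 by rewrite h1.
have ev i : (2 %| d1 i)%Z by have /andP[] := even_weights i.
have thin_h k : d1 k = d1 h -> d2 k = 0 -> k = h.
  by move=> k1 k2; apply: thin_nz; rewrite ?k1 ?k2 ?h2 //; left; lia.
have hmin i : d2 i = 0 -> d1 h <= d1 i.
  move=> i2; rewrite leNgt; apply/negP => lt_i.
  pose j := [arg max_(j > i | (d2 j == 0) && (d1 j < d1 h)) d1 j]%O.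
  have [j2 j1 jmax] : [/\ d2 j = 0, d1 j < d1 h &
      forall l, d2 l = 0 -> d1 l < d1 h -> d1 l <= d1 j].
    rewrite /j; case: arg_maxP; rewrite ?i2 ?lt_i ?eqxx // => l /andP[/eqP l2 l1] lmax.
    by split=> // p p2 p1; apply: lmax; rewrite p2 p1 eqxx.
  have [|k xkj] := row0_left j2; first by lia.
  have k1 := x1 xkj; have k2 := x2 xkj; rewrite j2 in k2.
  have ekh : k = h.
    by apply: thin_h => //; have := jmax k k2; have := ev h; have := ev j; lia.
  rewrite ekh in xkj k1.
  have : (y *m x) (rmin r) j != 0.
    rewrite (@mulmx_entry _ _ _ _ _ _ _ _ h) ?mulf_neq0 // => l _ xl.
    by apply: thin_h; [rewrite (x1 xl) k1|rewrite (x2 xl)].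
  rewrite -xyC => /mulmx_entry_neq0[l [xrl ylj]].
  have := x1 xrl; have := y1 ylj; have := row2_sym r2; rewrite -/g2; have := x1 xkj.
  have [_ /(_ l)] := rminP r; rewrite (y2 ylj) j2 r2 => /(_ erefl); lia.
have [K [z0 xz chain]] := row0_chain h2 h_neg hmin.
have [w [w0 [m wm] xw]] := kernel_x.
apply: (@dim_cyclic g (st g) x w _ m _ z0 w0 wm xw _ (or_introl erefl) xz) => [phi xp yp pg||i nz ig].
- have [prows pu] := kill_from_bottom xp yp pg.
  have ph : forall k, phi k h = 0.
    apply: (kill_step (brk0_comm yp) _ yhg); first by apply: prows; rewrite g22.
    by move=> k yk; apply: thin_h; rewrite ?(y1 yk) ?(y2 yk) ?g22 ?h1.
  split; last exact: kill_mul (pow_phi K xp) ph.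
  move=> i nz; have [i2|i2] := eqVneq (d2 i) 0; last exact: prows.
  by apply: (kill_row0 h2 h_neg hmin xp ph) => //; case: nz; rewrite ?i2 ?eqxx.
(* y w is killed by x and lies in row 2 at first weight 0, left of the right end, where x is
   injective; so it vanishes. *)
- apply/matrixP => k l; rewrite ord1 [RHS]mxE; apply/eqP; apply: contraT => ywk.
  have /mulmx_entry_neq0[q [ykq /(on_zeroP w0)[q1 q2]]] := ywk.
  have k1 := y1 ykq; have k2 := y2 ykq; rewrite q1 in k1; rewrite q2 in k2.
  have k0 : d2 k != 0 by rewrite k2.
  have [R2 _] := rmaxP k; have R1 := (row_sym r2 k0).2; rewrite -/g2 in R1.
  have [||j xjk] := row_connected k0 (esym R2).
  - by rewrite R1 k1; lia.
  - by have := ev g2; rewrite R1 k1; lia.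
  case/eqP: ywk; apply: (ker_coord_x _ xjk); last by right.
  by rewrite mulmxA xyC -mulmxA xw mulmx0.
have [i2|i2] := eqVneq (d2 i) 0; last exact: soc_rows r2 bmin i2 ig.
have i1 : d1 i != 0 by case: nz; rewrite ?i2 ?eqxx.
have [->|ih] := eqVneq i (st h).
  by exists (st g2); right; rewrite y_st oppr_eq0.
by have [k xk] := soc_row0 h2 h_neg hmin i2 i1 ih; exists k; left.
Qed.

(** The nonzero rows are single vectors with d1 = 0, so the weights lie on two axes. If row 0 is
    only the plane of weight 0, y alone gives the cyclic case; otherwise the two arms of a cross
    need one generator each. *)
Lemma dim_gl_narrow : d1 g2 = 0 -> (\dim Zgl <= N + 2)%N.
Proof.
move=> g21; have flat i : d2 i != 0 -> d1 i = 0.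
  move=> i0; have [_ /(_ i erefl)] := rminP i; have [_ /(_ i erefl)] := rmaxP i.
  by have := row_sym r2 i0; rewrite -/g2 g21; lia.
have flat_x k i : d2 i != 0 -> x k i = 0.
  move=> i2; apply/eqP; apply: contraT => xk.
  have := flat i i2; have := flat k; rewrite (x2 xk) => /(_ i2); have := x1 xk; lia.
have u0 : on_zero (y *m e_ g2).
  by move=> k; rewrite mul_colE => yk; apply: zero_weight; rewrite ?(y1 yk) ?(y2 yk) ?g21 ?g22.
have yu : y *m (y *m e_ g2) != 0.
  apply: contraTneq (y2_entry r2) => yyu; rewrite -/g2 -mul_colE -mulmxA yyu mxE eqxx //.
have [/existsP[i /andP[/eqP i2 i1]]|/existsPn no] :=
  boolP [exists i, (d2 i == 0) && (d1 i != 0)]; last first.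
  have row0 i : d2 i = 0 -> d1 i = 0.
    by move=> i2; have := no i; rewrite i2 eqxx /= negbK => /eqP.
  have [w [w0 [m wm] yw]] := kernel_y.
  apply: (@dim_cyclic g (st g) y w _ m _ u0 w0 wm _ yw (or_intror erefl) yu)
    => [phi xp yp pg||i nz ig].
  - have [prows pu] := kill_from_bottom xp yp pg; split=> // i nz; apply: prows.
    by case: nz => //; apply: contra_neq => /row0.
  - apply/matrixP => k l; rewrite ord1 [RHS]mxE; apply/eqP; apply: contraT.
    case/mulmx_entry_neq0 => q [xkq /(on_zeroP w0)[q1 q2]].
    by have := row0 k; rewrite (x2 xkq) (x1 xkq) q1 q2 => /(_ erefl).
  by apply: soc_rows r2 bmin _ ig; case: nz => //; apply: contra_neq => /row0.
pose h := rmin o; have [h2 hmin] := rminP o; rewrite -/h o2 in h2 hmin.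
have h1 : d1 h < 0.
  have := hmin i i2; have := hmin (st i); rewrite d1st d2st i2 oppr0 => /(_ erefl).
  by move: i1; lia.
have [K [z0 xz chain]] := row0_chain h2 h1 hmin.
have yh k : y k h = 0.
  apply/eqP; apply: contraT => yk; have := flat k; rewrite (y1 yk) (y2 yk) h2.
  by move=> /(_ isT); lia.
have [m1 um] : exists m, (y *m e_ g2) m 0 != 0.
  by apply: col_neq0; apply: contraNneq yu => ->; rewrite mulmx0.
have [m2 zm] : exists m, (mxpow x K *m e_ h) m 0 != 0.
  by apply: col_neq0; apply: contraNneq xz => ->; rewrite mulmx0.
apply: (@dim_cent_cross g h (st h) (st g) _ _ m1 m2 _ _ yh u0 z0 um zm _ xz _ yu).
- move=> phi xp yp pg ph; have [prows pu] := kill_from_bottom xp yp pg.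
  split=> //; last exact: kill_mul (pow_phi K xp) ph.
  move=> j nz; have [j2|j2] := eqVneq (d2 j) 0; last exact: prows.
  by apply: (kill_row0 h2 h1 hmin xp ph) => //; case: nz; rewrite ?j2 ?eqxx.
- by move=> k; apply: flat_x; rewrite (proj1 (rminP b)).
- by rewrite mulmxA xyC -mulmxA mul_col0 ?mulmx0 // => k; apply: flat_x; rewrite g22.
- by rewrite mulmxA mxpow_commute // -mulmxA; apply/matrixP => k l;
     rewrite ord1 [RHS]mxE mxE big1 // => q _; rewrite mul_colE yh mulr0.
- by move=> j; have [|/flat] := eqVneq (d2 j) 0; [right|left].
- move=> j j1; apply: (soc_row0 h2 h1 hmin) => //.
  by apply/eqP; apply: contraNT j1 => /flat ->.
move=> j j2 jg; have [k [xk|yk]] := soc_rows r2 bmin j2 jg; last by exists k.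
by rewrite flat_x ?eqxx in xk.
Qed.

End Rows.

Lemma dim_so_zero : (\dim Z <= n)%N.
Proof.
apply: dim_so_gl.
have [/existsP[i i2]|/existsPn no] := boolP [exists i, d2 i != 0]; last first.
  by apply: dim_gl_one_row => i; apply/eqP; rewrite -[_ == _]negbK.
have [r r2] := row2_exists i2.
pose b := [arg min_(b < o) d2 b]%O.
have bmin k : d2 b <= d2 k by rewrite /b; case: arg_minP => // l _; apply.
have [lt0|gt0|e0] := ltgtP (d1 (rmin (st r))) 0.
- exact: dim_gl_wide r2 bmin lt0.
- have r0 : d2 r != 0 by rewrite r2.
  have := row_sym r2 r0; have [_ /(_ r erefl)] := rminP r; have [_ /(_ r erefl)] := rmaxP r.
  by lia.
exact: dim_gl_narrow r2 bmin e0.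
Qed.

End ZeroWeight.

Lemma dim_so_le : (\dim Z <= n)%N.
Proof.
have [/existsP[o /andP[/eqP o1 /eqP o2]]|/existsPn no] :=
  boolP [exists o, (d1 o == 0) && (d2 o == 0)]; first exact: dim_so_zero o1 o2.
apply: dim_so_no_zero => i i1 i2; have := no i; by rewrite i1 i2 eqxx.
Qed.

End OrthogonalNoP.

(** * Orthogonal pairs with rational weights *)

Lemma dim_cent_so (F : fieldType) (N n : nat) (st : 'I_N -> 'I_N) (x y : 'M[F]_N)
    (w1 w2 : 'I_N -> rat) :
  involutive st -> (forall i, st i != i) -> N = n.*2 -> 2%:R != 0 :> F -> (1 < n)%N ->
  (forall i, w1 (st i) = - w1 i) -> (forall i, w2 (st i) = - w2 i) ->
  raises 1 w1 x -> keeps w2 x -> keeps w1 y -> raises 1 w2 y ->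
  x *m y = y *m x -> dag st x = - x -> dag st y = - y ->
  \dim (cent2 x y (dagsub st (-1))) <> n.+1.
Proof.
move=> stK st_neq N2n two_neq0 n_gt1 w1st w2st x1 x2 y1 y2 xyC xN yN dimZ.
have small : (\dim (cent2 x y (dagsub st (-1))) < n.+2)%N by rewrite dimZ.
have label0 := so_label stK st_neq N2n two_neq0 ltr01 w1st w2st x1 x2 y1 y2 xyC xN yN
  n_gt1 small.
have half (w : 'I_N -> rat) : (forall i, w (st i) = - w i) ->
    raises 1 w x \/ keeps w x -> raises 1 w y \/ keeps w y ->
    exists2 d : 'I_N -> int, (forall i, d (st i) = - d i) & forall i, (d i)%:~R = 2 * w i.
  move=> wst wx wy; have int_w i : 2 * w i \is a Num.int.
    apply: contraT => wi.
    (* If 2 w i were not an integer, the classes of w i and - w i modulo integers would be disjoint,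
       and this odd labelling would be well defined and nonzero. *)
    pose c k : int := if w k - w i \is a Num.int then 1
      else if w k + w i \is a Num.int then -1 else 0.
    have int1 (u : rat) : (u + 1 \is a Num.int) = (u \is a Num.int).
      by rewrite rpredDr ?int_num1.
    have cx a : raises 1 w a \/ keeps w a -> keeps c a.
      move=> wa p q apq; rewrite /c; case: wa => /(_ _ _ apq) -> //.
      by rewrite ![w q + 1 + _]addrAC !int1.
    suff : c i = 0 by rewrite /c subrr rpred0.
    apply: label0 => [k||]; [|exact: cx wx|exact: cx wy].
    rewrite /c wst -opprD rpredN.
    rewrite [- w k + w i]addrC -[w i - w k]opprB rpredN.
    have [wD|//] := boolP (w k + w i \is a Num.int); last by case: ifP.
    have -> : w k - w i \is a Num.int = false; last by [].
    apply: contraNF wi => wB; have -> : 2 * w i = (w k + w i) - (w k - w i) by ring.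
    by rewrite rpredB.
  have wE i : (Num.floor (2 * w i))%:~R = 2 * w i by rewrite floorK.
  exists (fun i => Num.floor (2 * w i)) => // i; apply: (@intr_inj rat).
  by rewrite rmorphN /= !wE wst mulrN.
have [d1 d1st d1E] := half w1 w1st (or_introl x1) (or_intror y1).
have [d2 d2st d2E] := half w2 w2st (or_intror x2) (or_introl y2).
have raise (w : 'I_N -> rat) (d : 'I_N -> int) a :
    (forall k, (d k)%:~R = 2 * w k) -> raises 1 w a -> raises 2 d a.
  by move=> wd wa i j /wa wij; apply: (@intr_inj rat); rewrite intrD !wd wij mulrDr mulr1.
have keep (w : 'I_N -> rat) (d : 'I_N -> int) a :
    (forall k, (d k)%:~R = 2 * w k) -> keeps w a -> keeps d a.
  by move=> wd wa i j /wa wij; apply: (@intr_inj rat); rewrite !wd wij.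
have lt_d (w : 'I_N -> rat) (d : 'I_N -> int) i j :
    (forall k, (d k)%:~R = 2 * w k) -> (d i < d j) = (w i < w j).
  by move=> wd; rewrite -(ltr_int rat) !wd ltr_pM2l.
have le_d (w : 'I_N -> rat) (d : 'I_N -> int) i j :
    (forall k, (d k)%:~R = 2 * w k) -> (d i <= d j) = (w i <= w j).
  by move=> wd; rewrite -(ler_int rat) !wd ler_pM2l.
suff : (\dim (cent2 x y (dagsub st (-1))) <= n)%N by rewrite dimZ ltnn.
have [noP|noQ] := so_quadP_or_quadQ stK st_neq N2n two_neq0 ltr01 x1 x2 y1 y2 xyC xN yN
  n_gt1 small.
- apply: (dim_so_le stK st_neq N2n two_neq0 n_gt1 d1st d2st) => //.
  + exact: raise x1.
  + exact: keep x2.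
  + exact: keep y1.
  + exact: raise y2.
  move=> X XZ /mem_supp XP; apply: noP => //; apply/mem_supp => i j /XP.
  by rewrite /quadP /= (lt_d _ _ _ _ d1E) (le_d _ _ _ _ d2E).
have swap X : (X \in cent2 y x (dagsub st (-1))) = (X \in cent2 x y (dagsub st (-1))).
  by rewrite !mem_cent2 [X in _ && X]andbC.
have dim_swap : \dim (cent2 y x (dagsub st (-1))) = \dim (cent2 x y (dagsub st (-1))).
  by congr (\dim _); apply/vspaceP.
rewrite -dim_swap; apply: (dim_so_le stK st_neq N2n two_neq0 n_gt1 d2st d1st) => //.
+ exact: raise y2.
+ exact: keep y1.
+ exact: keep x2.
+ exact: raise x1.
+ by rewrite dim_swap.
move=> X; rewrite swap => XZ /mem_supp XP; apply: noQ => //; apply/mem_supp => i j /XP.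
by rewrite /quadP /= (lt_d _ _ _ _ d2E) (le_d _ _ _ _ d1E).
Qed.

(** * Matrix realizations *)

Section CharacteristicZero.

Variables (F : fieldType) (F_char0 : [pchar F] =i pred0).

Lemma natr_eq0 k : (k%:R == 0 :> F) = (k == 0)%N.
Proof. exact: (pcharf0P F).1. Qed.

Lemma intr_eq0_char0 (k : int) : (k%:~R == 0 :> F) = (k == 0).
Proof. by case: k => k; rewrite ?NegzE ?mulrNz ?oppr_eq0 -pmulrn natr_eq0. Qed.

(** Denominators stay nonzero in characteristic 0, so a fraction may be evaluated unreduced; the
    arithmetic of [ratr] in F follows. *)
Lemma ratr_frac (a b : int) : b != 0 -> ratr (a%:~R / b%:~R) = a%:~R / b%:~R :> F.
Proof.
move=> b0; set q := _ / _; rewrite /ratr.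
have dF : (denq q)%:~R != 0 :> F by rewrite intr_eq0_char0 denq_neq0.
have bF : b%:~R != 0 :> F by rewrite intr_eq0_char0.
apply/eqP; rewrite eqr_div // -!intrM; apply/eqP; congr (_%:~R).
apply: (@intr_inj rat); rewrite !intrM; apply/eqP.
by rewrite -eqr_div ?intr_eq0 ?denq_neq0 // divq_num_den.
Qed.

Lemma ratrB_char0 p q : ratr (p - q) = ratr p - ratr q :> F.
Proof.
rewrite -[p in LHS]divq_num_den -[q in LHS]divq_num_den.
have := denq_neq0 p; have := denq_neq0 q.
have -> : ratr p = (numq p)%:~R / (denq p)%:~R :> F by [].
have -> : ratr q = (numq q)%:~R / (denq q)%:~R :> F by [].
move: (numq p) (denq p) (numq q) (denq q) => a b c d d0 b0.
have -> : a%:~R / b%:~R - c%:~R / d%:~R = (a * d - c * b)%:~R / (b * d)%:~R :> rat.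
  by rewrite -mulNr addf_div ?intr_eq0 // !rmorphB !rmorphM /= mulNr.
rewrite ratr_frac ?mulf_neq0 // -[- (c%:~R / _)]mulNr addf_div ?intr_eq0_char0 //.
by rewrite !rmorphB !rmorphM /= mulNr.
Qed.

Lemma ratrM_char0 p q : ratr (p * q) = ratr p * ratr q :> F.
Proof.
rewrite -[p in LHS]divq_num_den -[q in LHS]divq_num_den.
have := denq_neq0 p; have := denq_neq0 q.
have -> : ratr p = (numq p)%:~R / (denq p)%:~R :> F by [].
have -> : ratr q = (numq q)%:~R / (denq q)%:~R :> F by [].
move: (numq p) (denq p) (numq q) (denq q) => a b c d d0 b0.
by rewrite mulf_div -!rmorphM /= ratr_frac ?mulf_neq0 // !rmorphM /= mulf_div.
Qed.

Lemma ratr_inj_char0 : injective (@ratr F).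
Proof.
move=> p q pq; apply/eqP; rewrite -subr_eq0 -numq_eq0 -intr_eq0_char0.
have := ratrB_char0 p q; rewrite pq subrr /ratr => /eqP.
by rewrite mulf_eq0 invr_eq0 !intr_eq0_char0 denq_eq0 orbF.
Qed.

End CharacteristicZero.

Section Realization.

Variables (F : fieldType) (g : lieAlgType F) (N : nat).
Implicit Types (psi : 'Hom(g, 'M[F]_N)) (U : {vspace 'M[F]_N}) (h x y : g).

(** [U] is a parameter because a change of basis moves the matrix algebra, in type D from
    skew-symmetric matrices to the form of a hyperbolic basis. *)
Definition realizes psi U :=
  [/\ injective psi, forall x y, psi (bracket x y) = brk (psi x) (psi y) &
      limg psi = U].

Variables (psi : 'Hom(g, 'M[F]_N)) (U : {vspace 'M[F]_N}).
Hypothesis psiU : realizes psi U.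

Let psi_inj : injective psi. Proof. by case: psiU. Qed.
Let psi_brk x y : psi (bracket x y) = brk (psi x) (psi y). Proof. by case: psiU. Qed.

Lemma mem_realizes x : psi x \in U.
Proof. by case: psiU => _ _ <-; rewrite memv_img ?memvf. Qed.

Lemma realizesP A : A \in U -> exists x, psi x = A.
Proof. by case: psiU => _ _ <- /memv_imgP[x _ ->]; exists x. Qed.

Lemma dim_realizes (W : {vspace g}) : \dim (psi @: W) = \dim W.
Proof.
apply: limg_dim_eq; apply/eqP; rewrite -subv0; apply/subvP => x.
rewrite memv_cap memv_ker memv0 => /andP[_ /eqP px]; apply/eqP/psi_inj.
by rewrite px linear0.
Qed.

Definition spans (I : finType) (v : I -> 'M[F]_N) :=
  forall A, A \in U -> exists c, A = \sum_i c i *: v i.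

Lemma basis_in_seq (vT : vectType F) (s : seq vT) :
  exists2 b, {subset b <= s} & basis_of <<s>>%VS b.
Proof.
elim: s => [|x s [b bs bb]]; first by exists [::] => //; rewrite /basis_of eqxx nil_free.
have [sb fb] := andP bb; have eb : <<b>>%VS = <<s>>%VS := eqP sb.
have [xs|xs] := boolP (x \in <<s>>%VS).
  exists b; first by move=> y /bs; rewrite inE orbC => ->.
  by rewrite /basis_of fb span_cons eb andbT; apply/eqP/esym/addv_idPr; rewrite -memvE.
exists (x :: b); first by move=> y; rewrite !inE => /predU1P[->|/bs ->]; rewrite ?eqxx ?orbT.
by rewrite /basis_of !span_cons eb eqxx free_cons fb eb xs.
Qed.

Lemma realizes_semisimple (I : finType) (v : I -> 'M[F]_N) h :
  (forall i, v i \in U) -> spans v ->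
  (forall i, exists a, brk (psi h) (v i) = a *: v i) -> lie_semisimple h.
Proof.
move=> vU vspan veig; have /fin_all_exists[s sE] i : exists x, psi x = v i by apply: realizesP.
have [b bs bb] := basis_in_seq [seq s i | i <- enum I].
exists b; last first.
  move=> y /bs /mapP[i _ ->]; have [a ea] := veig i; exists a.
  by apply: psi_inj; rewrite psi_brk sE linearZ /= sE.
suff <- : <<[seq s i | i <- enum I]>>%VS = fullv by [].
apply/eqP; rewrite eqEsubv subvf; apply/subvP => x _.
have [c ec] := vspan _ (mem_realizes x).
have -> : x = \sum_i c i *: s i.
  apply: psi_inj; rewrite ec linear_sum; apply: eq_bigr => i _.
  by rewrite linearZ /= sE.
by apply: rpred_sum => i _; apply/rpredZ/memv_span/map_f; rewrite mem_enum.
Qed.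

Lemma semisimple_realizes h : lie_semisimple h ->
  exists m (v : 'I_m -> 'M[F]_N), [/\ forall i, v i \in U, spans v &
    forall i, exists a, brk (psi h) (v i) = a *: v i].
Proof.
case=> b bb beig; exists (size b), (fun i => psi b`_i); split=> [i||i].
- exact: mem_realizes.
- move=> A /realizesP[x <-]; exists (fun i => coord (in_tuple b) i x).
  have xb : x \in <<in_tuple b>>%VS by rewrite (eqP (proj1 (andP bb))) memvf.
  rewrite {1}(coord_span xb) linear_sum; apply: eq_bigr => i _.
  by rewrite linearZ.
have [a ea] := beig _ (mem_nth 0 (ltn_ord i)); exists a.
by rewrite -psi_brk ea linearZ.
Qed.

Lemma dim_pair_centralizer (e : g * g) :
  \dim (pair_centralizer e) = \dim (cent2 (psi e.1) (psi e.2) U).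
Proof.
rewrite -dim_realizes; congr (\dim _); apply/vspaceP => A.
have cent_of x y : (x \in lker (ad y)) = (brk (psi y) (psi x) == 0).
  by rewrite memv_ker adE -psi_brk -(inj_eq psi_inj) linear0.
rewrite mem_cent2; apply/memv_imgP/and3P => [[x + ->]|[/realizesP[x <-] xe ye]].
  by rewrite memv_cap !cent_of => /andP[]; rewrite mem_realizes.
by exists x => //; rewrite memv_cap !cent_of xe.
Qed.

Lemma realizes_rational h A a : rational_eigenvalues h -> A \in U -> A != 0 ->
  brk (psi h) A = a *: A -> exists q : rat, a = ratr q.
Proof.
move=> hq /realizesP[x <-] x0 hx; apply: hq; apply/negP => /eqP e0.
have : x \in passmx.leigenspace (ad h) a.
  rewrite /passmx.leigenspace memv_ker !lfunE /= !lfunE /= lfunE /= id_lfunE subr_eq0.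
  by apply/eqP/psi_inj; rewrite psi_brk hx linearZ.
by rewrite e0 memv0 => /eqP x00; rewrite x00 linear0 eqxx in x0.
Qed.

Notation diag := (supp F [rel i j : 'I_N | i == j]).

(** The preimage of the diagonal matrices contains H and is toral, since the family [v] is an
    eigenfamily for all of them; maximality makes it equal to H. *)
Lemma cartan_dim (H : {vspace g}) (I : finType) (v : I -> 'M[F]_N) :
  cartan_subalgebra H -> (forall h, h \in H -> psi h \in diag) ->
  (forall i, v i \in U) -> spans v ->
  (forall D i, D \in U -> D \in diag -> exists a, brk D (v i) = a *: v i) ->
  \dim H = \dim (U :&: diag)%VS.
Proof.
case=> _ Hmax Hdiag vU vspan veig; pose T := (psi @^-1: diag)%VS.
have memT x : (x \in T) = (psi x \in diag) by rewrite -memv_preim.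
have -> : H = T.
  apply/esym/Hmax; last by apply/subvP => x /Hdiag; rewrite memT.
  split=> [x y + +|x]; rewrite !memT => xT; last first.
    by apply: (realizes_semisimple vU vspan) => i; apply: veig xT; apply: mem_realizes.
  move=> yT; apply: psi_inj; rewrite psi_brk linear0; apply/matrixP => i j.
  have off X k l : X \in diag -> k != l -> X k l = 0.
    by move=> /mem_supp Xd; apply: contraNeq => /Xd.
  rewrite !mxE (bigD1 i) //= big1 ?addr0 => [|k ki]; last by rewrite (off _ _ _ xT) ?mul0r // eq_sym.
  rewrite (bigD1 j) //= big1 ?addr0 => [|k kj]; last by rewrite (off _ _ _ xT) ?mulr0.
  have [->|ij] := eqVneq i j; first by rewrite mulrC subrr.
  by rewrite !(off _ i j) // mulr0 mul0r subrr.
rewrite -dim_realizes; congr (\dim _); apply/vspaceP => A; rewrite memv_cap.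
apply/memv_imgP/andP => [[x + ->]|[/realizesP[x <-] xd]]; last by exists x; rewrite ?memT.
by rewrite memT mem_realizes.
Qed.

End Realization.

(** * Type A *)

Section Conjugation.

Variables (F : fieldType) (N : nat).
Implicit Types (A P X : 'M[F]_N).

Notation diag := (supp F [rel i j : 'I_N | i == j]).

Definition conjug P X := P *m X *m invmx P.

Fact conj_is_linear P : linear (conjug P).
Proof. by move=> c X Y; rewrite /conjug mulmxDr mulmxDl -scalemxAr -scalemxAl. Qed.
HB.instance Definition _ P :=
  GRing.isLinear.Build F 'M[F]_N 'M[F]_N *:%R (conjug P) (conj_is_linear P).

Lemma conjM P X A : P \in unitmx -> conjug P (X *m A) = conjug P X *m conjug P A.
Proof. by move=> Pu; rewrite /conjug !mulmxA mulmxKV. Qed.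

Lemma conj_brk P A X : P \in unitmx -> conjug P (brk A X) = brk (conjug P A) (conjug P X).
Proof. by move=> Pu; rewrite /brk linearB /= !conjM. Qed.

Lemma conjK P : P \in unitmx -> cancel (conjug P) (conjug (invmx P)).
Proof. by move=> Pu X; rewrite /conjug invmxK !mulmxA mulVmx // mul1mx mulmxKV. Qed.

Lemma conjKV P : P \in unitmx -> cancel (conjug (invmx P)) (conjug P).
Proof. by move=> Pu X; rewrite /conjug invmxK !mulmxA mulmxV // mul1mx mulmxK. Qed.

Lemma realizes_conj (g : lieAlgType F) (psi : 'Hom(g, 'M[F]_N)) (U : {vspace 'M[F]_N}) P :
  P \in unitmx -> realizes psi U ->
  realizes (linfun (conjug P) \o psi)%VF (linfun (conjug P) @: U)%VS.
Proof.
move=> Pu [psi_inj psi_brk psiU]; split=> [x y|x y|].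
- by rewrite !comp_lfunE !lfunE /= => /(can_inj (conjK Pu)) /psi_inj.
- by rewrite !comp_lfunE !lfunE /= psi_brk conj_brk.
by rewrite limg_comp psiU.
Qed.

Lemma mem_conj P (U : {vspace 'M[F]_N}) X : P \in unitmx ->
  (X \in (linfun (conjug P) @: U)%VS) = (conjug (invmx P) X \in U).
Proof.
move=> Pu; apply/memv_imgP/idP => [[Y YU ->]|XU]; first by rewrite lfunE /= conjK.
by exists (conjug (invmx P) X); rewrite // lfunE /= conjKV.
Qed.

Lemma codiag_seq (As : seq 'M[F]_N) :
  {in As &, forall A B, A *m B = B *m A} -> {in As, forall A, diagonalizable A} ->
  exists2 P, P \in unitmx & {in As, forall A, conjug P A \in diag}.
Proof.
move=> AsC Asd; have [P Pu /allP Pd] := proj1 (codiagonalizableP As) (conj AsC Asd).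
exists P => // A /Pd /(diagonalizable_forP _ Pu) Ad.
by apply/mem_supp => i j; apply: contraNT => ij; apply/eqP/Ad.
Qed.

End Conjugation.

Section Diagonalization.

Variables (F : fieldType) (N : nat).
Implicit Types (A D X : 'M[F]_N).

Notation diag := (supp F [rel i j : 'I_N | i == j]).

Lemma codiag_toral (g : lieAlgType F) (psi : 'Hom(g, 'M[F]_N)) U (H : {vspace g}) :
  realizes psi U -> {in H &, forall h k, lie_commute h k} ->
  (forall h, h \in H -> diagonalizable (psi h)) ->
  exists2 P, P \in unitmx & forall h, h \in H -> conjug P (psi h) \in diag.
Proof.
case=> psi_inj psi_brk _ Hc Hd.
have [||P Pu Pd] := @codiag_seq _ _ [seq psi h | h <- vbasis H].
- move=> _ _ /mapP[h /vbasis_mem hH ->] /mapP[k /vbasis_mem kH ->].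
  by apply: brk0_comm; rewrite -psi_brk (Hc h k hH kH) linear0.
- by move=> _ /mapP[h /vbasis_mem hH ->]; apply: Hd.
exists P => // h /coord_vbasis ->; rewrite !linear_sum; apply: rpred_sum => i _.
rewrite !linearZ; apply/rpredZ/Pd/map_f/mem_nth; rewrite size_tuple //.
Qed.

Lemma diagonalizable_span A (I : finType) (r : I -> 'rV[F]_N) (a : I -> F) :
  (forall i, r i *m A = a i *: r i) ->
  (forall u, exists c, u = \sum_i c i *: r i) -> diagonalizable A.
Proof.
move=> rA rspan; apply/diagonalizablePeigen.
exists (undup [seq a i | i <- enum I]); first exact: undup_uniq.
apply/eqmxP; rewrite submx1 /=; apply/row_subP => k.
have [c ->] := rspan (row k 1%:M); apply: summx_sub => i _; apply: scalemx_sub.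
apply: (@submx_trans _ _ _ _ _ _ (eigenspace A (a i))); first by apply/eigenspaceP.
rewrite (big_rem (a i)) /= ?addsmxSl // mem_undup; apply: map_f; exact: mem_enum.
Qed.

(** For a left eigenvector r, (r v_i) A = r A v_i - a_i r v_i, so r v_i is again an eigenvector or
    0. This transfers semisimplicity from ad A to A. *)
Lemma row_act_span A (U : {vspace 'M[F]_N}) (I : finType) (v : I -> 'M[F]_N)
    (r : 'rV[F]_N) al :
  spans U v -> (forall i, exists a, brk A (v i) = a *: v i) -> r *m A = al *: r ->
  exists a, (forall i, (r *m v i) *m A = a i *: (r *m v i)) /\
    forall X, X \in U -> exists c, r *m X = \sum_i c i *: (r *m v i).
Proof.
move=> vspan /fin_all_exists[a va] rA; exists (fun i => al - a i); split=> [i|X].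
  have -> : r *m v i *m A = r *m (A *m v i - a i *: v i).
    by rewrite -va /brk opprB addrC subrK mulmxA.
  by rewrite mulmxBr mulmxA rA -scalemxAl -scalemxAr scalerBl.
case/vspan => c ->; exists c; rewrite mulmx_sumr; apply: eq_bigr => i _.
by rewrite scalemxAr.
Qed.

Lemma brk_diag_delta D i j : D \in diag ->
  brk D (delta_mx i j) = (D i i - D j j) *: delta_mx i j.
Proof.
move=> /mem_supp Dd; have off k l : k != l -> D k l = 0 by apply: contraNeq => /Dd.
apply/matrixP => k l; rewrite !mxE (bigD1 i) //= big1 ?addr0 => [|p pi]; last first.
  by rewrite mxE (negPf pi) mulr0.
rewrite (bigD1 j) //= big1 ?addr0 => [|p pj]; last by rewrite mxE (negPf pj) andbF mul0r.
rewrite !mxE !eqxx andbT /=; have [->|ki] := eqVneq k i; last first.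
  by rewrite off // mul0r mul0r sub0r mulr0 oppr0.
have [->|lj] := eqVneq l j; first by rewrite !mulr1 mul1r.
by rewrite [D j l]off 1?eq_sym // !mulr0 subrr.
Qed.

Lemma diag_raise (D X : 'M[F]_N) c : D \in diag -> brk D X = c *: X ->
  forall i j, X i j != 0 -> D i i - D j j = c.
Proof.
move=> /mem_supp Dd /matrixP DX i j Xij.
have off k l : k != l -> D k l = 0 by apply: contraNeq => /Dd.
have := DX i j; rewrite !mxE (bigD1 i) //= big1 ?addr0 => [|k ki]; last first.
  by rewrite off ?mul0r // eq_sym.
rewrite (bigD1 j) //= big1 ?addr0 => [|k kj]; last by rewrite off ?mulr0.
by rewrite [X i j * _]mulrC -mulrBl => /(mulIf Xij).
Qed.

Lemma diag_raises (F_char0 : [pchar F] =i pred0) D X (w : 'I_N -> rat) : D \in diag ->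
  (forall i j, D i i - D j j = ratr (w i - w j)) -> brk D X = X -> raises 1 w X.
Proof.
move=> Dd wE DX i j Xij; have := diag_raise (c := 1) Dd _ Xij.
have ratr1 : ratr 1 = 1 :> F by rewrite -[1 in LHS]/(1%:~R) ratr_int.
rewrite DX scale1r wE -ratr1 => /(_ erefl) /(ratr_inj_char0 F_char0).
by move/eqP; rewrite subr_eq addrC => /eqP.
Qed.

Lemma diag_keeps (F_char0 : [pchar F] =i pred0) D X (w : 'I_N -> rat) : D \in diag ->
  (forall i j, D i i - D j j = ratr (w i - w j)) -> brk D X = 0 -> keeps w X.
Proof.
move=> Dd wE DX i j Xij; have := diag_raise (c := 0) Dd _ Xij.
have ratr0 : ratr 0 = 0 :> F by rewrite -[0 in LHS]/(0%:~R) ratr_int.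
rewrite DX scale0r wE -ratr0 => /(_ erefl) /(ratr_inj_char0 F_char0).
by move/eqP; rewrite subr_eq0 => /eqP.
Qed.

End Diagonalization.

Lemma exists_eigenvector (F : closedFieldType) n (A : 'M[F]_n.+1) :
  exists r al, r != 0 :> 'rV[F]_n.+1 /\ r *m A = al *: r.
Proof.
have /closed_rootP[al] : size (char_poly A) != 1%N by rewrite size_char_poly.
by rewrite -eigenvalue_root_char => /eigenvalueP[r rA r0]; exists r, al.
Qed.

Section TypeA.

Variables (F : closedFieldType) (F_char0 : [pchar F] =i pred0) (n : nat).
Notation N := n.+1.
Hypothesis n_gt0 : (0 < n)%N.
Implicit Types (A X : 'M[F]_N).

Notation diag := (supp F [rel i j : 'I_N | i == j]).

Definition sl : {vspace 'M[F]_N} :=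
  locked_with subspace_key (lker (linfun (mxtrace : 'M[F]_N -> F^o))).

Lemma mem_sl A : (A \in sl) = (\tr A == 0).
Proof. by rewrite [sl]unlock memv_ker lfunE. Qed.

Lemma dim_sl (W : {vspace 'M[F]_N}) : 1%:M \in W -> \dim W = (\dim (sl :&: W)).+1.
Proof.
move=> W1; have tr1 : \tr (1%:M : 'M[F]_N) != 0 by rewrite mxtrace1 natr_eq0.
have one_neq0 : (1%:M : 'M[F]_N) != 0 by apply: contraNneq tr1 => ->; rewrite linear0.
have dim1 : \dim <[1%:M : 'M[F]_N]> = 1%N by rewrite dim_vline one_neq0.
have -> : W = (sl :&: W + <[1%:M]>)%VS.
  apply/eqP; rewrite eqEsubv; apply/andP; split; last first.
    by rewrite subv_add capvSr -memvE.
  apply/subvP => A AW; apply/memv_addP.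
  exists (A - (\tr A / \tr (1%:M : 'M[F]_N)) *: 1%:M).
    by rewrite memv_cap mem_sl linearB /= linearZ /= divfK // subrr eqxx rpredB ?rpredZ.
  exists ((\tr A / \tr (1%:M : 'M[F]_N)) *: 1%:M); last by rewrite subrK.
  by rewrite rpredZ ?memv_line.
rewrite dimv_disjoint_sum ?dim1 ?addn1; last first.
  apply/eqP; rewrite -subv0; apply/subvP => A; rewrite memv_cap => /andP[].
  rewrite memv_cap mem_sl => /andP[/eqP trA _] /vlineP[c eA]; move/eqP: trA.
  by rewrite eA linearZ /= mulf_eq0 (negPf tr1) orbF => /eqP ->; rewrite scale0r mem0v.
congr (_.+1); congr (\dim _); apply/vspaceP => A; rewrite !memv_cap.
have [As|//] := boolP (A \in sl); rewrite /=.
apply/idP/memv_addP => [AW|[B + [C /vlineP[c ->]]]].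
  exists A; first by rewrite memv_cap As.
  by exists 0; rewrite ?mem0v ?addr0.
by rewrite memv_cap => /andP[_ BW] ->; rewrite rpredD ?rpredZ.
Qed.

Lemma diag_id : (1%:M : 'M[F]_N) \in diag.
Proof. by apply/mem_supp => i j; rewrite mxE /=; case: (i == j) => //; rewrite eqxx. Qed.

Lemma dim_sl_diag : \dim (sl :&: diag) = n.
Proof.
suff : (\dim diag <= N)%N.
  move=> le_N; apply/eqP; rewrite -eqSS -(dim_sl diag_id) eqn_leq le_N.
  exact: dim_diag_ge.
rewrite -[leqRHS]card_ord; apply: (@dim_le_entries _ _ _ (fun i => (i, i))) => X.
move=> /mem_supp Xd X0; apply/matrixP => i j; rewrite mxE.
have [<-|ij] := eqVneq i j; first exact: X0.
by apply/eqP; apply: contraNT ij => /Xd.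
Qed.

Definition sl_gen (p : 'I_N * 'I_N) : 'M[F]_N :=
  if p.1 == p.2 then delta_mx p.1 p.1 - delta_mx 0 0 else delta_mx p.1 p.2.

Lemma sl_gen_sl p : sl_gen p \in sl.
Proof.
have trd i j : \tr (delta_mx i j : 'M[F]_N) = (i == j)%:R.
  rewrite /mxtrace (bigD1 i) //= big1 ?addr0 => [|k ki]; rewrite mxE ?eqxx ?(negPf ki) //.
rewrite mem_sl /sl_gen; case: ifPn => [_|ij].
  by rewrite linearB /= !trd !eqxx subrr.
by rewrite trd (negPf ij).
Qed.

Lemma sl_gen_spans : spans sl sl_gen.
Proof.
move=> A; rewrite mem_sl => /eqP trA; exists (fun p => A p.1 p.2).
rewrite {1}[A]matrix_sum_delta pair_big /=.
apply/eqP; rewrite -subr_eq0 -sumrB.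
rewrite (eq_bigr (fun p : 'I_N * 'I_N => (if p.1 == p.2 then A p.1 p.2 else 0) *: delta_mx 0 0)).
  rewrite -scaler_suml -(pair_big xpredT xpredT (fun i j => if i == j then A i j else 0)) /=.
  rewrite (eq_bigr (fun i => A i i)) => [|i _]; first by rewrite -/(\tr A) trA scale0r.
  by rewrite (bigD1 i) //= eqxx big1 ?addr0 // => j ji; rewrite eq_sym (negPf ji).
case=> i j _ /=; rewrite /sl_gen /=; case: eqP => [<-|_]; last by rewrite subrr scale0r.
by rewrite -scalerBr opprB addrC subrK.
Qed.

Lemma sl_gen_eigen (D : 'M[F]_N) p : D \in sl -> D \in diag ->
  exists a, brk D (sl_gen p) = a *: sl_gen p.
Proof.
move=> _ Dd; rewrite /sl_gen; case: ifP => _; last by exists (D p.1 p.1 - D p.2 p.2); exact: brk_diag_delta.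
by exists 0; rewrite linearB /= !brk_diag_delta // !subrr !scale0r subrr.
Qed.

Lemma sl_act_row (r u : 'rV[F]_N) : r != 0 -> exists2 X, X \in sl & r *m X = u.
Proof.
move=> r0; have [j rj] := row_neq0 r0.
have [k kj] : exists k : 'I_N, k != j.
  have [j0|j0] := eqVneq j 0; last by exists 0; rewrite eq_sym.
  by exists ord_max; rewrite j0; apply/eqP => /(congr1 val) /= n0; move: n_gt0; rewrite n0.
pose X0 : 'M[F]_N := \matrix_(p, q) ((p == j)%:R * (u 0 q / r 0 j)).
pose Y : 'M[F]_N := delta_mx k k - (r 0 k / r 0 j) *: delta_mx j k.
have rX0 : r *m X0 = u.
  apply/rowP => q; rewrite mxE (bigD1 j) //= big1 ?addr0 => [|p pj].
    by rewrite mxE eqxx mul1r mulrC divfK.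
  by rewrite mxE (negPf pj) mul0r mulr0.
have rdel p q : r *m delta_mx p q = r 0 p *: delta_mx 0 q.
  apply/rowP => l; rewrite mxE (bigD1 p) //= big1 ?addr0 => [|s sp].
    by rewrite !mxE !eqxx.
  by rewrite mxE (negPf sp) mulr0.
have rY : r *m Y = 0.
  by rewrite mulmxBr -scalemxAr !rdel scalerA divfK // subrr.
have trd p q : \tr (delta_mx p q : 'M[F]_N) = (p == q)%:R.
  rewrite /mxtrace (bigD1 p) //= big1 ?addr0 => [|s sp]; rewrite mxE ?eqxx ?(negPf sp) //.
exists (X0 - \tr X0 *: Y); last by rewrite mulmxBr -scalemxAr rY scaler0 subr0.
by rewrite mem_sl /Y !(linearB, linearZ) /= !trd eqxx [j == k]eq_sym (negPf kj) mulr0 subr0 mulr1 subrr.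
Qed.

Lemma ad_diagonalizable_sl (I : finType) (v : I -> 'M[F]_N) A :
  spans sl v -> (forall i, exists a, brk A (v i) = a *: v i) -> diagonalizable A.
Proof.
move=> vspan va; have [r [al [r0 rA]]] := exists_eigenvector A.
have [a [ra rspan]] := row_act_span vspan va rA.
apply: diagonalizable_span ra _ => u.
by have [X XU <-] := sl_act_row u r0; apply: rspan.
Qed.

Lemma sl_conj P : P \in unitmx -> (linfun (conjug P) @: sl)%VS = sl.
Proof.
move=> Pu; apply/vspaceP => A; rewrite mem_conj // !mem_sl /conjug mxtrace_mulC.
by rewrite invmxK mulmxA mulmxV // mul1mx.
Qed.

Variable g : lieAlgType F.

Lemma semisimple_diag_sl (psi : 'Hom(g, 'M[F]_N)) h :
  realizes psi sl -> lie_semisimple h -> diagonalizable (psi h).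
Proof.
move=> R /(semisimple_realizes R)[m [v [_ vs ve]]].
exact: ad_diagonalizable_sl vs ve.
Qed.

Lemma no_almost_principal_sl (psi : 'Hom(g, 'M[F]_N)) : realizes psi sl ->
  ~ exists e : g * g, almost_principal e.
Proof.
move=> R [[e1 e2] [[_ _ ec [[h1 h2] /= [hc [s1 q1] [s2 q2] [h11 h12] [h21 h22]]]] [r [H Hcart rH] dimZ]]].
have rn : r = n.
  have [[Hc Hs] _] := Hcart.
  have [|P Pu Pd] := codiag_toral R Hc.
    by move=> h /Hs; apply: semisimple_diag_sl.
  have R' := realizes_conj Pu R; rewrite sl_conj // in R'.
  rewrite -rH -dim_sl_diag; apply: (cartan_dim R' Hcart _ sl_gen_sl sl_gen_spans).
    by move=> h hH; rewrite comp_lfunE lfunE; apply: Pd.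
  by move=> D p; apply: sl_gen_eigen.
have [psi_inj psi_brk _] := R.
have [||P Pu Pd] := @codiag_seq _ _ [:: psi h1; psi h2].
- have hcm : psi h1 *m psi h2 = psi h2 *m psi h1.
    by apply: brk0_comm; rewrite -psi_brk hc linear0.
  by move=> A B; rewrite !inE => /orP[] /eqP -> /orP[] /eqP ->.
- by move=> A; rewrite !inE => /orP[] /eqP ->; apply: semisimple_diag_sl.
have R' := realizes_conj Pu R; rewrite sl_conj // in R'.
set psi' := (_ \o _)%VF in R'; have [psi'_inj psi'_brk _] := R'.
have D1 : psi' h1 \in diag by rewrite comp_lfunE lfunE; apply: Pd; rewrite inE eqxx.
have D2 : psi' h2 \in diag by rewrite comp_lfunE lfunE; apply: Pd; rewrite !inE eqxx orbT.
(* Only differences of diagonal entries are eigenvalues of ad h, so the weights are taken relative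
   to index 0. *)
have wt h : rational_eigenvalues h -> psi' h \in diag ->
    exists w : 'I_N -> rat, forall i j, psi' h i i - psi' h j j = ratr (w i - w j).
  move=> hq Dh; have /fin_all_exists[w wE] i :
      exists q : rat, psi' h i i - psi' h 0 0 = ratr q.
    have [->|i0] := eqVneq i 0; first by exists 0; rewrite subrr -[0 in RHS]subr0 ratrB_char0 // subrr.
    apply: (realizes_rational R' hq (A := delta_mx i 0)); last exact: brk_diag_delta.
      by have := sl_gen_sl (i, 0); rewrite /sl_gen /= (negPf i0).
    by apply/eqP => /matrixP/(_ i 0)/eqP; rewrite !mxE !eqxx oner_eq0.
  exists w => i j; rewrite ratrB_char0 // -!wE opprB addrA subrK //.
have [w1 w1E] := wt h1 q1 D1; have [w2 w2E] := wt h2 q2 D2.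
apply: (dim_cent_gl (x := psi' e1) (y := psi' e2) (w1 := w1) (w2 := w2)).
- by apply: (diag_raises F_char0 D1 w1E); rewrite -psi'_brk h11.
- by apply: (diag_keeps F_char0 D2 w2E); rewrite -psi'_brk h21 linear0.
- by apply: (diag_keeps F_char0 D1 w1E); rewrite -psi'_brk h12 linear0.
- by apply: (diag_raises F_char0 D2 w2E); rewrite -psi'_brk h22.
- by apply: brk0_comm; rewrite -psi'_brk ec linear0.
have one a : (1%:M : 'M[F]_N) \in cent a.
  by rewrite mem_cent /brk mulmx1 mul1mx subrr.
rewrite dim_sl; last by rewrite memv_cap !one.
by rewrite capvA -/(cent2 _ _ sl) -(dim_pair_centralizer R' (e1, e2)) dimZ rn.
Qed.

End TypeA.

(** * Hyperbolic bases *)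

Section Hyperbolic.

Variables (F : closedFieldType) (N : nat) (T : zmodType) (wt : 'I_N -> T).
Hypothesis two_neq0 : 2%:R != 0 :> F.
Hypothesis wt_torsion : forall i, wt i + wt i = 0 -> wt i = 0.
Implicit Types (G H E : 'M[F]_N) (u v : 'rV[F]_N).

Notation e_ i := (delta_mx (0 : 'I_1) i : 'rV[F]_N).

Definition bil G u v := (u *m G *m v^T) 0 0.

Lemma bilDl G u v w : bil G (u + v) w = bil G u w + bil G v w.
Proof. by rewrite /bil !mulmxDl mxE. Qed.

Lemma bilZl G a u v : bil G (a *: u) v = a * bil G u v.
Proof. by rewrite /bil -!scalemxAl mxE. Qed.

Lemma bilDr G u v w : bil G u (v + w) = bil G u v + bil G u w.
Proof. by rewrite /bil linearD /= mulmxDr mxE. Qed.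

Lemma bilZr G a u v : bil G u (a *: v) = a * bil G u v.
Proof. by rewrite /bil linearZ /= -scalemxAr mxE. Qed.

Lemma bil_delta G i j : bil G (e_ i) (e_ j) = G i j.
Proof. by rewrite /bil -rowE trmx_delta -colE !mxE. Qed.

Definition bilE := (bilDl, bilZl, bilDr, bilZr, bil_delta).

(** A change of basis within weight spaces: the rows of E are the new vectors, G and H the Gram
    matrices. *)
Definition congruent G H := exists E, [/\ E \in unitmx,
  forall i j, E i j != 0 -> wt i = wt j & E *m G *m E^T = H].

Lemma congruent_refl G : congruent G G.
Proof.
exists 1%:M; split; rewrite ?unitmx1 ?mul1mx ?trmx1 ?mulmx1 // => i j.
by rewrite mxE; case: (i =P j) => [->//|_]; rewrite eqxx.
Qed.

Lemma congruent_trans G H K : congruent G H -> congruent H K -> congruent G K.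
Proof.
move=> [E1 [u1 g1 <-]] [E2 [u2 g2 <-]]; exists (E2 *m E1).
split; rewrite ?unitmx_mul ?u1 ?u2 ?trmx_mul ?mulmxA // => i j.
by rewrite mxE => /sum_neq0[k]; rewrite mulf_eq0 negb_or => /andP[/g2 -> /g1].
Qed.

Lemma congruent_rows G (r : 'I_N -> 'rV[F]_N) :
  (forall k l, r k 0 l != 0 -> wt k = wt l) ->
  (forall c : 'rV[F]_N, \sum_k c 0 k *: r k = 0 -> c = 0) ->
  congruent G (\matrix_(k, l) bil G (r k) (r l)).
Proof.
move=> rg rfree; pose E : 'M[F]_N := \matrix_k r k; exists E; split.
- rewrite -row_free_unit -kermx_eq0; apply/eqP/row_matrixP => i; rewrite row0.
  apply: rfree; have : row i (kermx E) *m E = 0 by rewrite -row_mul mulmx_ker row0.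
  by rewrite mulmx_sum_row; under eq_bigr => k _ do rewrite rowK.
- by move=> i j; rewrite mxE; apply: rg.
apply/matrixP => k l; rewrite [RHS]mxE /bil -(rowK r k) -(rowK r l) -/E.
by rewrite -row_mul tr_row -mulmxA [in LHS]mulmxA !mxE; apply: eq_bigr => p _; rewrite !mxE.
Qed.

Definition inv_mx (tau : 'I_N -> 'I_N) : 'M[F]_N := \matrix_(i, j) (j == tau i)%:R.

(** Invariant of the orthogonalization: vectors in [done] are normalized and pair with [tau] of
    themselves only; the others are still free. *)
Definition reduced G (tau : 'I_N -> 'I_N) (done : {set 'I_N}) :=
  [/\ involutive tau, forall i, i \notin done -> tau i = i &
      forall i j, i \in done -> G i j = (j == tau i)%:R].

Definition graded_form G := [/\ G^T = G, G \in unitmx & forall i j, G i j != 0 -> wt i + wt j = 0].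

Lemma congruent_form G H : congruent G H -> graded_form G -> graded_form H.
Proof.
move=> [E [Eu Eg <-]] [Gs Gu Gg]; split.
- by rewrite !trmx_mul trmxK Gs mulmxA.
- by rewrite !unitmx_mul Eu Gu unitmx_tr.
move=> i j; rewrite mxE => /sum_neq0[k]; rewrite mulf_eq0 negb_or => /andP[+ /[!mxE] /Eg ->].
rewrite mxE => /sum_neq0[l]; rewrite mulf_eq0 negb_or => /andP[/Eg -> /Gg //].
Qed.

Lemma closed_sqrt (a : F) : exists b, b * b = a.
Proof.
have /closed_rootP[b] : size ('X^2 - a%:P : {poly F}) != 1%N by rewrite size_XnsubC.
rewrite /root !hornerE => /eqP e; exists b.
by apply/eqP; rewrite -subr_eq0 -e expr2.
Qed.

Lemma sum_fun2 (c : 'rV[F]_N) (r : 'I_N -> 'rV[F]_N) l :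
  (\sum_k c 0 k *: r k) 0 l = \sum_k c 0 k * r k 0 l.
Proof. by rewrite summxE; apply: eq_bigr => k _; rewrite mxE. Qed.

Lemma e_E i j : (e_ i) 0 j = (j == i)%:R.
Proof. by rewrite mxE. Qed.

(** Gram-Schmidt at a non-isotropic vector, scaled by a square root of the inverse of its norm.
    Vectors of other weights are unchanged, since such a vector pairs only with the weight opposite
    to its own. *)
Lemma reduce_single G tau done i : graded_form G -> reduced G tau done ->
  i \notin done -> G i i != 0 ->
  exists2 H, congruent G H & reduced H tau (i |: done).
Proof.
move=> [Gs _ Gg] [tauK tau_id Gd] i_done Gii.
have Gsym k l : G k l = G l k by rewrite -[in LHS]Gs mxE.
have [c cc] := closed_sqrt (G i i)^-1.
have c0 : c != 0.
  by apply: contraNneq Gii => c0; move: cc; rewrite c0 mul0r => /esym/eqP; rewrite invr_eq0.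
pose a k := - (G k i / G i i).
pose r k := if k == i then c *: e_ i else e_ k + a k *: e_ i.
have Gdi k : k \in done -> G k i = 0.
  have ti := tau_id _ i_done; move=> kd; rewrite Gd //; case: eqP => // e.
  by rewrite -ti e tauK kd in i_done.
have rr : congruent G (\matrix_(k, l) bil G (r k) (r l)).
  apply: congruent_rows => [k l|cc' c'0].
    rewrite /r; case: (k =P i) => [->|_].
      by rewrite mxE e_E; case: (l =P i) => [->//|_]; rewrite mulr0 eqxx.
    rewrite !mxE /=; case: (eqVneq l k) => [->//|_]; case: (eqVneq l i) => [->|_].
      rewrite add0r mulr1 oppr_eq0 mulf_eq0 negb_or => /andP[/Gg ki _].
      by apply: (addIr (wt i)); rewrite ki (Gg i i).
    by rewrite mulr0 addr0 eqxx.
  have ck k : k != i -> cc' 0 k = 0.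
    move=> ki; have := congr1 (fun u : 'rV[F]_N => u 0 k) c'0; rewrite sum_fun2 [RHS]mxE.
    rewrite (bigD1 k) //= big1 ?addr0 => [|l lk].
      by rewrite /r (negPf ki) !mxE !eqxx (negPf ki) mulr0 addr0 mulr1.
    rewrite /r; case: (l =P i) => [_|_]; rewrite !mxE (negPf ki) ?mulr0 ?addr0 ?mulr0 //.
    by rewrite eq_sym (negPf lk) mulr0.
  apply/rowP => k; rewrite [RHS]mxE; have [->|/ck//] := eqVneq k i.
  have := congr1 (fun u : 'rV[F]_N => u 0 i) c'0; rewrite sum_fun2 [RHS]mxE.
  rewrite (bigD1 i) //= big1 ?addr0 => [|l li]; last by rewrite ck // mul0r.
  by rewrite /r eqxx !mxE !eqxx mulr1 => /eqP; rewrite mulf_eq0 (negPf c0) orbF => /eqP.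
exists (\matrix_(k, l) bil G (r k) (r l)) => //; split=> // [k|k l].
  by rewrite !inE negb_or => /andP[_ /tau_id].
rewrite mxE !inE /r; have [->|ki] := eqVneq k i; have [->|li] := eqVneq l i.
- by rewrite tau_id // eqxx !bilE mulrA cc mulVf.
- by move=> _; rewrite tau_id // (negPf li) !bilE /a mulNr divfK // (Gsym l i) subrr mulr0.
- by move=> /= kd; rewrite -(Gd _ _ kd) !bilE /a (Gdi _ kd) !mul0r oppr0; ring.
by move=> /= kd; rewrite -(Gd _ _ kd) !bilE /a (Gsym i l) (Gdi _ kd) mul0r oppr0; ring.
Qed.

(** Splitting off a hyperbolic pair: the others are corrected to be orthogonal to both e_i and
    e_j. *)
Lemma reduce_pair G tau done i j : graded_form G -> reduced G tau done ->
  i \notin done -> j \notin done -> i != j -> G i j != 0 -> G i i = 0 -> G j j = 0 ->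
  exists2 H, congruent G H &
    reduced H (fun k => if k == i then j else if k == j then i else tau k)
      (i |: (j |: done)).
Proof.
move=> [Gs _ Gg] [tauK tau_id Gd] i_done j_done ij Gij Gii Gjj.
have ji : (j == i) = false by rewrite eq_sym (negPf ij).
have Gsym k l : G k l = G l k by rewrite -[in LHS]Gs mxE.
pose a k := - (G k j / G i j); pose b k := - (G k i / G i j).
pose r k := if k == i then (G i j)^-1 *: e_ i else if k == j then e_ j
  else e_ k + a k *: e_ i + b k *: e_ j.
have Gd0 p k : p \notin done -> k \in done -> G k p = 0.
  move=> pd; have tp := tau_id _ pd; move=> kd; rewrite Gd //; case: eqP => // e.
  by rewrite -tp e tauK kd in pd.
have rE k l : k != i -> k != j -> r k 0 l = (l == k)%:R + a k * (l == i)%:R + b k * (l == j)%:R.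
  by move=> ki kj; rewrite /r (negPf ki) (negPf kj) !mxE.
have rj l : r j 0 l = (l == j)%:R by rewrite /r ji eqxx mxE.
have ri l : r i 0 l = (G i j)^-1 * (l == i)%:R by rewrite /r eqxx !mxE.
have rr : congruent G (\matrix_(k, l) bil G (r k) (r l)).
  apply: congruent_rows => [k l|c c0].
    have [->|ki] := eqVneq k i.
      by rewrite ri; case: (l =P i) => [->//|_]; rewrite mulr0 eqxx.
    have [->|kj] := eqVneq k j.
      by rewrite rj; case: (l =P j) => [->//|_]; rewrite eqxx.
    rewrite rE //; have [->//|lk] := eqVneq l k; have [->|li] := eqVneq l i.
      rewrite (negPf ij) mulr0 addr0 add0r mulr1 oppr_eq0 mulf_eq0 negb_or => /andP[/Gg kj0 _].
      by apply: (addIr (wt j)); rewrite kj0 (Gg i j).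
    have [->|lj] := eqVneq l j; last by rewrite !mulr0 !addr0 eqxx.
    rewrite mulr0 addr0 add0r mulr1 oppr_eq0 mulf_eq0 negb_or => /andP[/Gg ki0 _].
    by apply: (addIr (wt i)); rewrite ki0 [wt j + _]addrC (Gg i j).
  have coord l : \sum_k c 0 k * r k 0 l = 0 by rewrite -sum_fun2 c0 mxE.
  have ck k : k != i -> k != j -> c 0 k = 0.
    move=> ki kj; have := coord k; rewrite (bigD1 k) //= big1 ?addr0 => [|l lk].
      by rewrite rE // eqxx (negPf ki) (negPf kj) !mulr0 !addr0 mulr1.
    have [->|li] := eqVneq l i; first by rewrite ri (negPf ki) !mulr0.
    have [->|lj] := eqVneq l j; first by rewrite rj (negPf kj) mulr0.
    by rewrite rE // eq_sym (negPf lk) (negPf ki) (negPf kj) !mulr0 !addr0 mulr0.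
  have cj : c 0 j = 0.
    have := coord j; rewrite (bigD1 j) //= big1 ?addr0 => [|l lj].
      by rewrite rj eqxx mulr1.
    have [->|li] := eqVneq l i; first by rewrite ri ji !mulr0.
    by rewrite ck ?mul0r.
  have ci : c 0 i = 0.
    have := coord i; rewrite (bigD1 i) //= big1 ?addr0 => [|l li].
      by rewrite ri eqxx mulr1 => /eqP; rewrite mulf_eq0 invr_eq0 (negPf Gij) orbF => /eqP.
    by have [->|lj] := eqVneq l j; rewrite ?cj ?ck ?mul0r.
  apply/rowP => k; rewrite [RHS]mxE; have [->//|ki] := eqVneq k i.
  by have [->//|kj] := eqVneq k j; apply: ck.
exists (\matrix_(k, l) bil G (r k) (r l)) => //; split=> [k|k|k l].
- have [->|ki] := eqVneq k i; first by rewrite ji eqxx.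
  have [->|kj] := eqVneq k j; first by rewrite eqxx.
  have [ti tj] := (tau_id i i_done, tau_id j j_done).
  have /negPf -> : tau k != i by apply: contraNneq ki => e; rewrite -[k]tauK e ti.
  by have /negPf -> : tau k != j by apply: contraNneq kj => e; rewrite -[k]tauK e tj.
- by rewrite !inE !negb_or => /and3P[/negPf -> /negPf -> /tau_id].
rewrite mxE !inE; have [->|ki] := eqVneq k i.
  move=> _; have [->|li] := eqVneq l i.
    by rewrite eq_sym ji /r eqxx !bilE Gii !mulr0.
  have [->|lj] := eqVneq l j; first by rewrite /r eqxx ji eqxx !bilE mulVf.
  rewrite /r eqxx (negPf li) (negPf lj) !bilE Gii /b (Gsym l i) /=.
  by field.
have [->|kj] := eqVneq k j.
  move=> _; have [->|li] := eqVneq l i.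
    by rewrite /r ji !eqxx !bilE (Gsym j i) mulVf.
  have [->|lj] := eqVneq l j; first by rewrite /r ji eqxx !bilE Gjj.
  rewrite /r ji eqxx (negPf li) (negPf lj) !bilE Gjj /a (Gsym j i) (Gsym l j) /=.
  by field.
move=> /= kd; rewrite -(Gd _ _ kd); have [Gki Gkj] := (Gd0 i k i_done kd, Gd0 j k j_done kd).
have rk : r k = e_ k.
  by rewrite /r (negPf ki) (negPf kj) /a /b Gki Gkj !mul0r !oppr0 !scale0r !addr0.
rewrite rk; have [->|li] := eqVneq l i; first by rewrite /r eqxx !bilE Gki mulr0.
have [->|lj] := eqVneq l j; first by rewrite /r ji eqxx !bilE.
by rewrite /r (negPf li) (negPf lj) !bilE Gki Gkj !mulr0 !addr0.
Qed.

Lemma congruent_involution G : graded_form G ->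
  exists2 tau, involutive tau & congruent G (inv_mx tau).
Proof.
move=> gG; have red0 : reduced G id set0 by split=> // i j; rewrite inE.
have [m] := ubnP #|~: (set0 : {set 'I_N})|.
elim: m G id (set0 : {set 'I_N}) gG red0 => // m IHm G tau done gG red ltm.
have [tauK tau_id Gd] := red.
have ltC (D : {set 'I_N}) i : i \notin done -> i \in D -> done \subset D -> (#|~: D| < m)%N.
  move=> i_done iD dD; rewrite ltnS in ltm; apply: leq_trans ltm; apply: proper_card.
  apply/properP; split; first by rewrite setCS.
  by exists i; rewrite !inE ?iD // i_done.
have [/subsetP dT|/subsetPn[i _ i_done]] := boolP ([set: 'I_N] \subset done).
  exists tau => //; suff <- : G = inv_mx tau by apply: congruent_refl.
  by apply/matrixP => k l; rewrite Gd ?dT // mxE.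
have [/existsP[k /andP[k_done Gkk]]|/existsPn Gdiag] :=
    boolP [exists k, (k \notin done) && (G k k != 0)].
  have [H GH redH] := reduce_single gG red k_done Gkk.
  have [|t tK Ht] := IHm H tau _ (congruent_form GH gG) redH.
    by apply: (ltC _ k) => //; rewrite ?setU11 ?subsetUr.
  by exists t => //; apply: congruent_trans GH Ht.
have G0 k : k \notin done -> G k k = 0.
  by move=> kd; have := Gdiag k; rewrite kd /= negbK => /eqP.
have [Gs Gu _] := gG; have Gsym k l : G k l = G l k by rewrite -[in LHS]Gs mxE.
have [j Gij] : exists j, G i j != 0.
  have [/existsP[j Gij]|/existsPn Gi] := boolP [exists j, G i j != 0]; first by exists j.
  have /rowP/(_ i)/eqP : e_ i = 0.
    rewrite -[e_ i](mulmxK Gu) -rowE.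
    have -> : row i G = 0 by apply/rowP => j; rewrite !mxE; apply/eqP; rewrite -[_ == _]negbK.
    by rewrite mul0mx.
  by rewrite !mxE !eqxx oner_eq0.
have ij : i != j by apply: contraNneq Gij => <-; rewrite G0.
have j_done : j \notin done.
  apply: contraNN Gij => jd; rewrite Gsym Gd //; have ti := tau_id i i_done.
  by case: (i =P tau j) => // e; rewrite -ti e tauK jd in i_done.
have [H GH redH] := reduce_pair gG red i_done j_done ij Gij (G0 i i_done) (G0 j j_done).
have [|t tK Ht] := IHm H _ _ (congruent_form GH gG) redH.
  by apply: (ltC _ i) => //; rewrite ?setU11 // setUA subsetUr.
by exists t => //; apply: congruent_trans GH Ht.
Qed.

Lemma odd_fixed (tau : 'I_N -> 'I_N) : involutive tau -> odd #|[set i | tau i == i]| = odd N.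
Proof.
move=> tauK; pose A := [set i : 'I_N | (i < tau i)%N].
have imA i : (i \in tau @: A) = (tau i < i)%N.
  by rewrite -{1}[i]tauK (mem_imset _ _ (inv_inj tauK)) inE tauK.
have : (#|[set i | tau i == i]| + #|~: [set i | tau i == i]| = N)%N by rewrite cardsC card_ord.
have -> : ~: [set i | tau i == i] = A :|: tau @: A.
  apply/setP => i; rewrite in_setU imA !inE.
  by rewrite -(inj_eq val_inj) /= neq_ltn orbC.
rewrite cardsU card_imset; last exact: inv_inj.
have -> : A :&: tau @: A = set0.
  by apply/setP => i; rewrite in_setI imA !inE; lia.
by rewrite cards0; lia.
Qed.

(** Fixed points are unit vectors of weight 0, so two of them may be mixed: with io^2 = -1, the
    vectors e_i + io e_j and (e_i - io e_j) / 2 are isotropic with pairing 1. *)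
Lemma pair_fixed (tau : 'I_N -> 'I_N) i j : graded_form (inv_mx tau) -> involutive tau ->
  tau i = i -> tau j = j -> i != j ->
  congruent (inv_mx tau) (inv_mx (fun k => if k == i then j else if k == j then i else tau k)).
Proof.
move=> [Gs _ Gg] tauK ti tj ij; set G := inv_mx tau.
have ji : (j == i) = false by rewrite eq_sym (negPf ij).
have wt0 p : tau p = p -> wt p = 0.
  by move=> tp; apply/wt_torsion/Gg; rewrite mxE tp eqxx oner_neq0.
have [io io2] := closed_sqrt (-1).
pose r k := if k == i then e_ i + io *: e_ j else if k == j then 2^-1 *: (e_ i + (- io) *: e_ j)
  else e_ k.
have io0 : io != 0.
  by apply/eqP => e; move/eqP: io2; rewrite e mul0r eq_sym oppr_eq0 oner_eq0.
have ri l : r i 0 l = (l == i)%:R + io * (l == j)%:R by rewrite /r eqxx !mxE.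
have rj l : r j 0 l = 2^-1 * ((l == i)%:R - io * (l == j)%:R).
  by rewrite /r ji eqxx !mxE mulNr.
have rk k l : k != i -> k != j -> r k 0 l = (l == k)%:R.
  by move=> /negPf ki /negPf kj; rewrite /r ki kj mxE.
suff <- : \matrix_(k, l) bil G (r k) (r l) =
    inv_mx (fun k => if k == i then j else if k == j then i else tau k).
  apply: congruent_rows => [k l|c c0].
    have [->|ki] := eqVneq k i.
      rewrite ri; have [->//|li] := eqVneq l i; have [->|lj] := eqVneq l j.
        by rewrite !wt0.
      by rewrite mulr0 addr0 eqxx.
    have [->|kj] := eqVneq k j.
      rewrite rj; have [->|li] := eqVneq l i; first by rewrite !wt0.
      by have [->//|lj] := eqVneq l j; rewrite mulr0 subr0 mulr0 eqxx.
    by rewrite rk //; have [->//|_] := eqVneq l k; rewrite eqxx.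
  have coord l : \sum_k c 0 k * r k 0 l = 0 by rewrite -sum_fun2 c0 mxE.
  have ck k : k != i -> k != j -> c 0 k = 0.
    move=> ki kj; have := coord k; rewrite (bigD1 k) //= big1 ?addr0 => [|l lk].
      by rewrite rk // eqxx mulr1.
    have [->|li] := eqVneq l i; first by rewrite ri (negPf ki) (negPf kj) mulr0 addr0 mulr0.
    have [->|lj] := eqVneq l j; first by rewrite rj (negPf ki) (negPf kj) mulr0 subr0 !mulr0.
    by rewrite rk // eq_sym (negPf lk) mulr0.
  have two l : c 0 i * r i 0 l + c 0 j * r j 0 l = 0.
    have := coord l; rewrite (bigD1 i) //= (bigD1 j) ?ji //= big1 ?addr0 // => k.
    by case/andP => ki kj; rewrite ck // mul0r.
  have := two i; have := two j; rewrite !ri !rj !eqxx ji (negPf ij) /=.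
  rewrite !mulr0 !mulr1 sub0r subr0 add0r addr0 mulr1 => e1 e2.
  have e3 : c 0 i * io - c 0 j * 2^-1 * io = 0 by rewrite -e1; ring.
  have e4 : c 0 i = c 0 j * 2^-1.
    by apply/eqP; rewrite -subr_eq0 -(mulIr_eq0 _ (mulIf io0)) mulrBl e3.
  have ci : c 0 i = 0.
    have : c 0 i + c 0 j * 2^-1 = 0 by rewrite -[RHS]e2; ring.
    by move/eqP; rewrite -e4 -mulr2n -mulr_natl mulf_eq0 (negPf two_neq0) => /eqP.
  have cj : c 0 j = 0.
    by apply/eqP; move/eqP: e4; rewrite ci eq_sym mulf_eq0 invr_eq0 (negPf two_neq0) orbF.
  apply/rowP => k; rewrite [RHS]mxE; have [->//|ki] := eqVneq k i.
  by have [->//|kj] := eqVneq k j; apply: ck.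
have GE k l : G k l = (l == tau k)%:R by rewrite mxE.
have G0 p k : tau p = p -> k != p -> G k p = 0 /\ G p k = 0.
  move=> tp kp; rewrite !GE tp (negPf kp); split=> //.
  by case: eqP => // e; case/eqP: kp; rewrite -[k]tauK -e tp.
have Gii : G i i = 1 by rewrite GE ti eqxx.
have Gjj : G j j = 1 by rewrite GE tj eqxx.
have [Gji Gij] := G0 i j ti (negbT ji).
apply/matrixP => k l; rewrite !mxE.
have [->|ki] := eqVneq k i.
  have [->|li] := eqVneq l i.
    by rewrite (negPf ij) /r eqxx !bilE Gii Gjj Gij Gji mulr1 !mulr0 !addr0 add0r io2 subrr.
  have [->|lj] := eqVneq l j.
    transitivity (2^-1 * (1 - io * io)); last by rewrite io2 opprK -[1 + 1]/(2%:R) mulVf.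
    by rewrite /r ji !eqxx !bilE Gii Gjj Gij Gji; ring.
  rewrite /r eqxx (negPf li) (negPf lj) !bilE.
  by rewrite (G0 i l ti li).2 (G0 j l tj lj).2 mulr0 addr0.
have [->|kj] := eqVneq k j.
  have [->|li] := eqVneq l i.
    transitivity (2^-1 * (1 - io * io)); last by rewrite io2 opprK -[1 + 1]/(2%:R) mulVf.
    by rewrite /r ji !eqxx !bilE Gii Gjj Gij Gji; ring.
  have [->|lj] := eqVneq l j.
    transitivity (2^-1 * (2^-1 * (1 + io * io))).
      by rewrite /r ji !eqxx !bilE Gii Gjj Gij Gji; ring.
    by rewrite io2 subrr !mulr0.
  rewrite /r ji eqxx (negPf li) (negPf lj) !bilE.
  by rewrite (G0 i l ti li).2 (G0 j l tj lj).2 !mulr0 addr0 mulr0.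
rewrite {1}/r (negPf ki) (negPf kj) -GE.
have [->|li] := eqVneq l i; first by rewrite /r eqxx !bilE (G0 i k ti ki).1 (G0 j k tj kj).1 mulr0 addr0.
have [->|lj] := eqVneq l j.
  by rewrite /r ji eqxx !bilE (G0 i k ti ki).1 (G0 j k tj kj).1 !mulr0 addr0 mulr0.
by rewrite /r (negPf li) (negPf lj) bil_delta.
Qed.

(** As N is even, the involution has an even number of fixed points, and [pair_fixed] removes them
    two at a time. *)
Lemma congruent_hyperbolic G : graded_form G -> ~~ odd N ->
  exists st, [/\ involutive st, forall i, st i != i & congruent G (inv_mx st)].
Proof.
move=> gG evN; have [tau tauK Gt] := congruent_involution gG.
have [m] := ubnP #|[set i | tau i == i]|.
elim: m tau tauK Gt => // m IHm tau tauK Gt ltm.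
have [f0|[i]] := set_0Vmem [set i | tau i == i].
  by exists tau; split=> // i; have := in_set0 i; rewrite -f0 inE => ->.
rewrite inE => /eqP ti.
have [j] : exists j, j \in [set i | tau i == i] :\ i.
  apply/set0Pn; rewrite -card_gt0; have := cardsD1 i [set i | tau i == i].
  by rewrite inE ti eqxx; have := odd_fixed tauK; move: evN; lia.
rewrite !inE => /andP[ji /eqP tj].
have ij : i != j by rewrite eq_sym.
have Gt' := congruent_trans Gt (pair_fixed (congruent_form Gt gG) tauK ti tj ij).
move: Gt'; set t := (fun k => _) => Gt'.
have t_neq k : k != i -> k != j -> tau k != i /\ tau k != j.
  by move=> ki kj; split; [apply: contraNneq ki|apply: contraNneq kj] => e;
     rewrite -[k]tauK e ?ti ?tj.
apply: (IHm t) Gt' _ => [k|].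
  rewrite /t; have [->|ki] := eqVneq k i; first by rewrite (negPf ji) eqxx.
  have [->|kj] := eqVneq k j; first by rewrite eqxx.
  by have [/negPf -> /negPf ->] := t_neq k ki kj.
rewrite ltnS in ltm; apply: leq_trans ltm; apply: proper_card; apply/properP; split.
  apply/subsetP => k; rewrite !inE /t; case: (k =P i) => [->|_]; first by rewrite (negPf ji).
  by case: (k =P j) => [->|//]; rewrite (negPf ij).
by exists i; rewrite !inE ?ti ?eqxx // /t eqxx (negPf ji).
Qed.

End Hyperbolic.

(** * Type D *)

Section TypeD.

Variables (F : closedFieldType) (F_char0 : [pchar F] =i pred0) (n : nat).
Hypothesis n_gt1 : (1 < n)%N.
Notation N := n.*2.
Implicit Types (A X Q : 'M[F]_N) (r u w : 'rV[F]_N).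

Notation diag := (supp F [rel i j : 'I_N | i == j]).

Let two_neq0 : 2%:R != 0 :> F. Proof. by rewrite natr_eq0. Qed.

Definition tr_add A := A^T + A.

Fact tr_add_is_linear : linear tr_add.
Proof. by move=> c X Y; apply/matrixP => i j; rewrite !mxE; ring. Qed.
HB.instance Definition _ :=
  GRing.isLinear.Build F 'M[F]_N 'M[F]_N *:%R tr_add tr_add_is_linear.

Definition asym : {vspace 'M[F]_N} := locked_with subspace_key (lker (linfun tr_add)).

Lemma mem_asym A : (A \in asym) = (A^T == - A).
Proof. by rewrite [asym]unlock memv_ker lfunE /= addr_eq0. Qed.

(** With r w^T = 1, the matrix w^T u - u^T w sends r to u, its second term dying because u is
    orthogonal to r. *)
Lemma asym_act_row r u : r != 0 -> u *m r^T = 0 -> exists2 X, X \in asym & r *m X = u.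
Proof.
move=> r0 ur; have [j rj] := row_neq0 r0.
pose w : 'rV[F]_N := (r 0 j)^-1 *: delta_mx 0 j.
have rw : r *m w^T = 1%:M.
  apply/matrixP => a b; rewrite !ord1 linearZ /= trmx_delta -scalemxAr -colE !mxE.
  by rewrite mulVf.
have ru : r *m u^T = 0 by apply: trmx_inj; rewrite trmx_mul trmxK ur trmx0.
exists (w^T *m u - u^T *m w).
  by rewrite mem_asym linearB /= !trmx_mul !trmxK opprB.
by rewrite mulmxBr !mulmxA rw ru mul1mx mul0mx subr0.
Qed.

Lemma row_proportional r r' j : r 0 j != 0 ->
  (forall p, r' 0 p * r 0 j = r' 0 j * r 0 p) -> r' = (r' 0 j / r 0 j) *: r.
Proof.
move=> rj h; apply/rowP => p; rewrite mxE; apply: (mulIf rj); rewrite h.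
by rewrite mulrAC divfK.
Qed.

(* The rows [r X] fill the orthogonal of an eigenvector [r]; when [r] is isotropic
   a second eigenvector, not proportional to it, supplies the missing dimension. *)
Lemma ad_diagonalizable_asym (I : finType) (v : I -> 'M[F]_N) A :
  spans asym v -> (forall i, exists a, brk A (v i) = a *: v i) -> diagonalizable A.
Proof.
move=> vspan va.
have [r [al [r0 rA]]] : exists r al, r != 0 :> 'rV[F]_N /\ r *m A = al *: r.
  by move: A va {vspan} => /=; case: (n) n_gt1 v => // m _ v A _; apply: exists_eigenvector.
have perp q : q != 0 :> 'rV[F]_N -> (exists b, q *m A = b *: q) ->
    exists a, (forall i, (q *m v i) *m A = a i *: (q *m v i)) /\
    forall u, u *m q^T = 0 -> exists c, u = \sum_i c i *: (q *m v i).
  move=> q0 [b qA]; have [a [qa qspan]] := row_act_span vspan va qA.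
  exists a; split=> // u uq; have [X XU <-] := asym_act_row q0 uq; exact: qspan.
have [a [ra rspan]] := perp r r0 (ex_intro _ al rA).
have [rr|rr] := eqVneq ((r *m r^T) 0 0) 0; last first.
  pose q (k : I + 'I_1) := if k is inl i then r *m v i else r.
  apply: (@diagonalizable_span _ _ _ _ q (fun k => if k is inl i then a i else al)).
    by case=> [i|]; rewrite /= ?ra.
  move=> u.
  have [|c ec] := rspan (u - ((u *m r^T) 0 0 / (r *m r^T) 0 0) *: r).
    apply/matrixP => k l; rewrite !ord1 [RHS]mxE mulmxBl -scalemxAl !mxE.
    by set z := \sum_j _; set z' := \sum_j _; rewrite divfK ?subrr //; move: rr; rewrite mxE.
  exists (fun k => if k is inl i then c i else (u *m r^T) 0 0 / (r *m r^T) 0 0).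
  by rewrite big_sumType big_ord1 /= -ec subrK.
have [j rj] := row_neq0 r0.
(* If all r v_i were multiples of r, the orthogonal of r would be contained in a line, which two
   indices besides j refute. *)
have [i [p hp]] : exists i p, (r *m v i) 0 p * r 0 j != (r *m v i) 0 j * r 0 p.
  have [/existsP[i /existsP[p hp]]|/existsPn h] :=
    boolP [exists i, exists p, (r *m v i) 0 p * r 0 j != (r *m v i) 0 j * r 0 p].
    by exists i, p.
  exfalso; have line u : u *m r^T = 0 -> exists c, u = c *: r.
    case/rspan => c ->; exists (\sum_i c i * ((r *m v i) 0 j / r 0 j)).
    rewrite scaler_suml; apply: eq_bigr => i _; rewrite -scalerA; congr (_ *: _).
    apply: row_proportional => // p; apply/eqP; rewrite -[_ == _]negbK.
    by have /existsPn/(_ p) := h i.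
  have [k [l [kj lj kl]]] : exists k l : 'I_N, [/\ k != j, l != j & k != l].
    have : (1 < #|[set~ j]|)%N by rewrite cardsC1 card_ord; move: n_gt1; lia.
    by case/card_gt1P => k [l []]; rewrite !inE => kj lj kl; exists k, l.
  have test k' : k' != j -> r 0 k' != 0 /\ forall l', l' != j -> l' != k' -> r 0 l' = 0.
    move=> k'j; have [|c ec] := line (r 0 j *: delta_mx 0 k' - r 0 k' *: delta_mx 0 j).
      apply/matrixP => s t; rewrite !ord1 mulmxBl -!scalemxAl -!rowE !mxE mulrC subrr //.
    have := congr1 (fun u : 'rV[F]_N => u 0 k') ec; rewrite !mxE !eqxx (negPf k'j) mulr0 subr0 mulr1.
    move=> rc; have rc0 : c * r 0 k' != 0 by rewrite -rc.
    move: (rc0); rewrite mulf_eq0 negb_or => /andP[c0 rk0]; split=> // l' l'j l'k.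
    have := congr1 (fun u : 'rV[F]_N => u 0 l') ec; rewrite !mxE !eqxx (negPf l'j) (negPf l'k).
    by rewrite !mulr0 subrr => /esym/eqP; rewrite mulf_eq0 (negPf c0) => /eqP.
  have [rk _] := test k kj; have [_ /(_ k kj kl) rk0] := test l lj.
  by rewrite rk0 eqxx in rk.
pose r' := r *m v i.
have r'0 : r' != 0.
  by apply: contraNneq hp => e; rewrite -/r' e !mxE !mul0r.
have [a' [r'a r'span]] := perp r' r'0 (ex_intro _ (a i) (ra i)).
pose q (k : I + I) := match k with inl s => r *m v s | inr s => r' *m v s end.
apply: (@diagonalizable_span _ _ _ _ q (fun k => match k with inl s => a s | inr s => a' s end)).
  by case=> s; rewrite /= ?ra ?r'a.
move=> u.
(* [w] is orthogonal to r' but not to r, so the orthogonals of r and r' together span everything. *)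
pose w : 'rV[F]_N := r' 0 p *: delta_mx 0 j - r' 0 j *: delta_mx 0 p.
have wq s : (w *m s^T) 0 0 = r' 0 p * s 0 j - r' 0 j * s 0 p.
  by rewrite mulmxBl -!scalemxAl -!rowE !mxE.
have wr : (w *m r^T) 0 0 != 0 by rewrite wq subr_eq0.
have [|c1 e1] := r'span w.
  by apply/matrixP => s t; rewrite !ord1 wq [RHS]mxE mulrC subrr.
have [|c2 e2] := rspan (u - ((u *m r^T) 0 0 / (w *m r^T) 0 0) *: w).
  apply/matrixP => s t; rewrite !ord1 mulmxBl -scalemxAl [RHS]mxE.
  by rewrite [LHS]mxE [X in _ + X]mxE [X in _ - X]mxE divfK // subrr.
exists (fun k => match k with inl s => c2 s
  | inr s => (u *m r^T) 0 0 / (w *m r^T) 0 0 * c1 s end).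
rewrite big_sumType /= -e2.
rewrite (eq_bigr (fun s => ((u *m r^T) 0 0 / (w *m r^T) 0 0) *: (c1 s *: (r' *m v s)))).
  by rewrite -scaler_sumr -e1 subrK.
by move=> s _; rewrite scalerA.
Qed.

(** In a common eigenbasis, skewness of A reads (a_i + a_j) G_ij = 0 for the Gram matrix G, so G is
    graded by the tuple of eigenvalues. A weight-preserving change of basis commutes with the
    diagonal matrices and leaves them unchanged. *)
Lemma hyperbolic_basis (As : seq 'M[F]_N) : {in As, forall A, A \in asym} ->
  {in As &, forall A B, A *m B = B *m A} -> {in As, forall A, diagonalizable A} ->
  exists st Q, [/\ involutive st, forall i, st i != i, Q \in unitmx,
    Q *m Q^T = inv_mx F st & {in As, forall A, conjug Q A \in diag}].
Proof.
move=> Asym AsC Asd; have [P Pu Pd] := codiag_seq AsC Asd.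
pose wt i := [ffun k : 'I_(size As) => conjug P As`_k i i].
have PA A : P *m A = conjug P A *m P by rewrite /conjug mulmxKV.
have off A i j : A \in As -> i != j -> conjug P A i j = 0.
  by move=> /Pd/mem_supp Ad; apply: contraNeq => /Ad.
have wtP A i j : A \in As -> wt i = wt j -> conjug P A i i = conjug P A j j.
  move=> AAs /ffunP wij; have kA : (index A As < size As)%N by rewrite index_mem.
  by have := wij (Ordinal kA); rewrite !ffunE /= nth_index.
have wt_torsion i : wt i + wt i = 0 -> wt i = 0.
  move=> /ffunP wi; apply/ffunP => k; have := wi k; rewrite !ffunE => /eqP.
  by rewrite -mulr2n -mulr_natl mulf_eq0 (negPf two_neq0) => /eqP.
have gform : graded_form wt (P *m P^T).
  split; first by rewrite trmx_mul trmxK.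
    by rewrite unitmx_mul unitmx_tr Pu.
  move=> i j Gij; apply/ffunP => k; rewrite !ffunE.
  have AAs : As`_k \in As by rewrite mem_nth.
  set A := As`_k in AAs *; have /eqP AT : A^T == - A by rewrite -mem_asym Asym.
  have skew C : P *m A = C *m P -> C *m (P *m P^T) = - ((P *m P^T) *m C^T).
    move=> CP; rewrite mulmxA -CP -[P *m P^T *m C^T]mulmxA -trmx_mul -CP trmx_mul AT.
    by rewrite mulNmx mulmxN opprK mulmxA.
  move: (skew _ (PA A)).
  move/matrixP/(_ i j); rewrite mxE (bigD1 i) //= big1 ?addr0 => [|l li]; last first.
    by rewrite off ?mul0r // eq_sym.
  rewrite [RHS]mxE [X in - X]mxE (bigD1 j) //= big1 ?addr0 => [|l lj]; last first.
    by rewrite [X in _ * X]mxE off ?mulr0 // eq_sym.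
  rewrite [X in - (_ * X)]mxE [X in - X]mulrC => /eqP.
  by rewrite -addr_eq0 -mulrDl mulf_eq0 (negPf Gij) orbF => /eqP.
have evN : ~~ odd N by rewrite odd_double.
have [st [stK st_neq [E [Eu Eg Est]]]] := congruent_hyperbolic two_neq0 wt_torsion gform evN.
exists st, (E *m P); split=> //; first by rewrite unitmx_mul Eu.
  by rewrite trmx_mul -Est !mulmxA.
move=> A AAs; suff -> : conjug (E *m P) A = conjug P A by apply: Pd.
rewrite [LHS]/conjug -[E *m P *m A]mulmxA PA.
suff -> : E *m (conjug P A *m P) = conjug P A *m (E *m P).
  by rewrite mulmxK // unitmx_mul Eu.
rewrite (mulmxA E (conjug P A) P) (mulmxA (conjug P A) E P); congr (_ *m _).
apply/matrixP => i j; rewrite [LHS]mxE [RHS]mxE.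
rewrite (bigD1 j) //= big1 ?addr0 => [|l lj]; last by rewrite off ?mulr0.
rewrite (bigD1 i) //= big1 ?addr0 => [|l li]; last by rewrite off ?mul0r // eq_sym.
have [->|Eij] := eqVneq (E i j) 0; first by rewrite mul0r mulr0.
by rewrite mulrC (wtP A i j) //; apply: Eg.
Qed.

Section Split.

Variables (st : 'I_N -> 'I_N) (Q : 'M[F]_N).
Hypotheses (stK : involutive st) (st_neq : forall i, st i != i) (Qu : Q \in unitmx).
Hypothesis QQ : Q *m Q^T = inv_mx F st.

Notation so := (dagsub st (-1)).

Lemma inv_mx_mul X : inv_mx F st *m X = \matrix_(i, j) X (st i) j.
Proof.
apply/matrixP => i j; rewrite !mxE (bigD1 (st i)) //= big1 ?addr0 => [|k ki].
  by rewrite mxE eqxx mul1r.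
by rewrite mxE (negPf ki) mul0r.
Qed.

Lemma mul_inv_mx X : X *m inv_mx F st = \matrix_(i, j) X i (st j).
Proof.
apply/matrixP => i j; rewrite !mxE (bigD1 (st j)) //= big1 ?addr0 => [|k kj].
  by rewrite mxE stK eqxx mulr1.
by rewrite mxE eq_sym (can2_eq stK stK) (negPf kj) mulr0.
Qed.

Lemma dag_tr X : dag st X = inv_mx F st *m X^T *m inv_mx F st.
Proof. by rewrite mul_inv_mx inv_mx_mul; apply/matrixP => i j; rewrite !mxE. Qed.

Lemma asym_conj : (linfun (conjug Q) @: asym)%VS = so.
Proof.
apply/vspaceP => A; rewrite mem_conj // mem_asym mem_so dag_tr -QQ.
have QQ2 : (Q *m Q^T) *m (Q *m Q^T) = 1%:M.
  by rewrite QQ inv_mx_mul; apply/matrixP => i j; rewrite !mxE stK eq_sym.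
have QTu : Q^T \in unitmx by rewrite unitmx_tr.
have iM : (invmx Q)^T *m invmx Q = Q *m Q^T.
  rewrite trmx_inv -[LHS]mulmx1 -QQ2 !mulmxA -[invmx Q^T *m invmx Q *m Q]mulmxA mulVmx //.
  by rewrite mulmx1 mulVmx // mul1mx.
set B := conjug (invmx Q) A; have eB : conjug Q B = A := conjKV Qu A.
have eT : conjug Q B^T = Q *m Q^T *m A^T *m (Q *m Q^T).
  by rewrite -{2}iM /conjug /B /conjug invmxK !trmx_mul !mulmxA.
by rewrite -(inj_eq (can_inj (conjK Qu)) B^T (- B)) linearN /= eB eT.
Qed.

Definition so_gen (p : 'I_N * 'I_N) : 'M[F]_N := delta_mx p.1 p.2 - dag st (delta_mx p.1 p.2).

Lemma so_gen_so p : so_gen p \in so.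
Proof. exact: skew_so. Qed.

(** Each generator occurs twice up to sign, for a position and for its mirror image, whence the
    factor 1/2. *)
Lemma so_gen_spans : spans so so_gen.
Proof.
move=> A Aso; exists (fun p => 2^-1 * A p.1 p.2).
have dagA : dag st A = - A by apply/eqP; rewrite -mem_so.
have expand : A = \sum_p A p.1 p.2 *: delta_mx p.1 p.2.
  by rewrite {1}[A]matrix_sum_delta pair_big.
have expand' : - A = \sum_p A p.1 p.2 *: dag st (delta_mx p.1 p.2).
  rewrite -dagA {1}expand; apply/matrixP => i j; rewrite [LHS]mxE !summxE.
  by apply: eq_bigr => p _; rewrite !mxE.
apply: (scalerI two_neq0); rewrite scaler_sumr.
rewrite (eq_bigr (fun p => A p.1 p.2 *: delta_mx p.1 p.2 - A p.1 p.2 *: dag st (delta_mx p.1 p.2))).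
  by rewrite sumrB -expand -expand' opprK -[RHS]mulr2n -scaler_nat.
by move=> p _; rewrite scalerA mulrA divff // mul1r scalerBr.
Qed.

Lemma so_gen_eigen (D : 'M[F]_N) p : D \in so -> D \in diag ->
  exists a, brk D (so_gen p) = a *: so_gen p.
Proof.
move=> Dso Dd; exists (D p.1 p.1 - D p.2 p.2); rewrite /so_gen (@dag_delta F _ _ stK) linearB /=.
rewrite !brk_diag_delta // scalerBr [D (st p.2) _](so_st stK _ _ Dso) [D (st p.1) _](so_st stK _ _ Dso).
by rewrite !stK opprK [- D _ _ + _]addrC.
Qed.

Lemma dim_so_diag_eq : \dim (so :&: diag) = n.
Proof.
apply/eqP; rewrite eqn_leq (dim_dag_diag stK st_neq (erefl N) two_neq0 (or_intror erefl)) andbT.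
rewrite -[leqRHS](card_half stK st_neq (erefl N) two_neq0) -[leqRHS]card_ord.
pose v (h : 'I_#|halfset st|) := enum_val h.
apply: (@dim_le_entries _ _ _ (fun h => (v h, v h))) => X; rewrite memv_cap.
case/andP => Xso /mem_supp Xd X0; apply/matrixP => i j; rewrite mxE.
have X_half k : k \in halfset st -> X k k = 0.
  by move=> kh; have := X0 (enum_rank_in kh k); rewrite /v enum_rankK_in.
have [<-|ij] := eqVneq i j; last by apply/eqP; apply: contraNT ij => /Xd.
have [ih|ih] := boolP (i \in halfset st); first exact: X_half.
rewrite (so_st stK _ _ Xso) X_half ?oppr0 // inE stK; move: ih; rewrite inE -leqNgt leq_eqVlt.
by rewrite (inj_eq val_inj) (negPf (st_neq i)).
Qed.

End Split.

Variable g : lieAlgType F.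

Lemma semisimple_diag_asym (psi : 'Hom(g, 'M[F]_N)) h :
  realizes psi asym -> lie_semisimple h -> diagonalizable (psi h).
Proof.
move=> R /(semisimple_realizes R)[m [v [_ vs ve]]].
exact: ad_diagonalizable_asym vs ve.
Qed.

Lemma lie_rank_asym (psi : 'Hom(g, 'M[F]_N)) (k : nat) :
  realizes psi asym -> lie_rank g k -> k = n.
Proof.
move=> R [H Hcart rH]; have [[Hc Hs] _] := Hcart; have [_ psi_brk _] := R.
have [|||st [Q [stK st_neq Qu QQ Qd]]] := @hyperbolic_basis [seq psi h | h <- vbasis H].
- by move=> _ /mapP[h _ ->]; apply: (mem_realizes R).
- move=> _ _ /mapP[h /vbasis_mem hH ->] /mapP[h' /vbasis_mem h'H ->].
  by apply: brk0_comm; rewrite -psi_brk (Hc h h' hH h'H) linear0.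
- by move=> _ /mapP[h /vbasis_mem hH ->]; apply/(semisimple_diag_asym R)/Hs.
have R' := realizes_conj Qu R; rewrite (asym_conj stK Qu QQ) in R'.
rewrite -rH -(dim_so_diag_eq stK st_neq).
apply: (cartan_dim R' Hcart _ (so_gen_so stK) (@so_gen_spans st)).
  move=> h /coord_vbasis ->; rewrite linear_sum; apply: rpred_sum => i _.
  rewrite linearZ /=; apply: rpredZ; rewrite comp_lfunE lfunE.
  by apply/Qd/map_f/mem_nth; rewrite size_tuple.
by move=> D p; apply: so_gen_eigen.
Qed.

Lemma no_almost_principal_asym (psi : 'Hom(g, 'M[F]_N)) : realizes psi asym ->
  ~ exists e : g * g, almost_principal e.
Proof.
move=> R [[e1 e2] [[_ _ ec [[h1 h2] /= [hc [s1 q1] [s2 q2] [h11 h12] [h21 h22]]]] [k /(lie_rank_asym R) kn dimZ]]].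
have [_ psi_brk _] := R.
have [|||st [Q [stK st_neq Qu QQ Qd]]] := @hyperbolic_basis [:: psi h1; psi h2].
- by move=> A; rewrite !inE => /orP[] /eqP ->; apply: (mem_realizes R).
- have hcm : psi h1 *m psi h2 = psi h2 *m psi h1.
    by apply: brk0_comm; rewrite -psi_brk hc linear0.
  by move=> A B; rewrite !inE => /orP[] /eqP -> /orP[] /eqP ->.
- by move=> A; rewrite !inE => /orP[] /eqP ->; apply: semisimple_diag_asym.
have R' := realizes_conj Qu R; rewrite (asym_conj stK Qu QQ) in R'.
set psi' := (_ \o _)%VF in R'; have [psi'_inj psi'_brk _] := R'.
have D1 : psi' h1 \in diag by rewrite comp_lfunE lfunE; apply: Qd; rewrite inE eqxx.
have D2 : psi' h2 \in diag by rewrite comp_lfunE lfunE; apply: Qd; rewrite !inE eqxx orbT.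
have memso x : psi' x \in dagsub st (-1) := mem_realizes R' x.
have ratr0 : ratr 0 = 0 :> F by rewrite -[0 in LHS]/(0%:~R) ratr_int.
have neg q : - ratr q = ratr (- q) :> F by rewrite -[- q]sub0r ratrB_char0 // ratr0 sub0r.
have odd_diag D i : D \in dagsub st (-1) -> D (st i) (st i) = - D i i.
  by move=> Dso; rewrite [LHS](so_st stK _ _ Dso) !stK.
have wt h : rational_eigenvalues h -> psi' h \in diag -> exists w : 'I_N -> rat,
    (forall i, w (st i) = - w i) /\ forall i j, psi' h i i - psi' h j j = ratr (w i - w j).
  move=> hq Dh; have diff i j : j != st i -> exists q : rat, psi' h i i - psi' h j j = ratr q.
    move=> ji; apply: (realizes_rational R' hq (so_gen_so stK (i, j))).
      apply/eqP => /matrixP/(_ i j)/eqP; rewrite /so_gen (@dag_delta F _ _ stK) !mxE !eqxx.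
      by rewrite [i == st j]eq_sym (can2_eq stK stK) (negPf ji) subr0 oner_eq0.
    rewrite /so_gen (@dag_delta F _ _ stK) linearB /= !brk_diag_delta // scalerBr.
    by rewrite !odd_diag // opprK [- psi' h j j + _]addrC.
  (* Here the diagonal entries themselves are rational: the entry at i is half the sum of its
     differences with those at j and st j, which are opposite. *)
  have /fin_all_exists[w wE] i : exists q : rat, psi' h i i = ratr q.
    have [j [ji jsi]] : exists j, j != i /\ j != st i.
      have : ~~ ([set: 'I_N] \subset [set i; st i]).
        apply: contraL n_gt1 => /subset_leq_card; rewrite cardsT card_ord cards2.
        by case: (_ != _) => /=; lia.
      by case/subsetPn => j _; rewrite !inE negb_or => /andP[? ?]; exists j.
    have [a ea] := diff i j jsi; have [|b eb] := diff i (st j).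
      by rewrite (inj_eq (inv_inj stK)).
    exists ((a - - b) / 2); apply: (mulfI two_neq0).
    have -> : 2%:R * ratr ((a - - b) / 2) = ratr (a - - b) :> F.
      by rewrite -[2%:R in LHS]ratr_nat -ratrM_char0 // mulrC divfK.
    rewrite ratrB_char0 // -neg -ea -eb.
    by rewrite odd_diag //; ring.
  exists w; split=> [i|i j]; last by rewrite ratrB_char0 // -!wE.
  by apply: (ratr_inj_char0 F_char0); rewrite -neg -!wE odd_diag.
have [w1 [w1st w1E]] := wt h1 q1 D1; have [w2 [w2st w2E]] := wt h2 q2 D2.
have dagN x : dag st (psi' x) = - psi' x by apply/eqP; rewrite -mem_so memso.
apply: (@dim_cent_so F N n st (psi' e1) (psi' e2) w1 w2) => //.
- by apply: (diag_raises F_char0 D1 w1E); rewrite -psi'_brk h11.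
- by apply: (diag_keeps F_char0 D2 w2E); rewrite -psi'_brk h21 linear0.
- by apply: (diag_keeps F_char0 D1 w1E); rewrite -psi'_brk h12 linear0.
- by apply: (diag_raises F_char0 D2 w2E); rewrite -psi'_brk h22.
- by apply: brk0_comm; rewrite -psi'_brk ec linear0.
by rewrite -(dim_pair_centralizer R' (e1, e2)) dimZ kn.
Qed.

End TypeD.

Lemma lie_iso_realizes (F : fieldType) (g : lieAlgType F) N (U : {vspace 'M[F]_N})
    (P : 'M[F]_N -> Prop) :
  (forall A, P A <-> A \in U) -> lie_iso_matrices g P ->
  exists psi : 'Hom(g, 'M[F]_N), realizes psi U.
Proof.
move=> PU [phi [phi_inj phi_brk phiP]]; exists (linfun phi); split=> [x y|x y|].
- by rewrite !lfunE => /phi_inj.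
- by rewrite !lfunE /= phi_brk.
apply/vspaceP => A; apply/memv_imgP/idP => [[x _ ->]|/PU /phiP[x <-]].
  by rewrite lfunE; apply/PU/phiP; exists x.
by exists x; rewrite ?memvf ?lfunE.
Qed.

Theorem theorem6p4 (F : closedFieldType) (F_char0 : [pchar F] =i pred0)
    (g : lieAlgType F) (g_simple : lie_simple g)
    (g_type : type_A g \/ type_D g) :
  ~ exists e : g * g, almost_principal e.
Proof.
case: g_type => [[n n_gt0]|[n n_ge3]] iso.
  have [|psi R] := lie_iso_realizes (U := sl F n) _ iso.
    by move=> A; rewrite mem_sl; split=> /eqP.
  exact: (no_almost_principal_sl F_char0 n_gt0 R).
have [|psi R] := lie_iso_realizes (U := asym F n) _ iso.
  by move=> A; rewrite mem_asym; split=> /eqP.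
by apply: (no_almost_principal_asym F_char0 _ R); apply: ltnW.
Qed.
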